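(* Let $\hat d=\hat d_0+\hat d_1+\hat d_2$ act on $\ker L_0\subset\mathcal F_{p,p_\varphi}$. Its cohomology (the relative cohomology of $\hat d$) is as follows, and vanishes in all other cases: (i) (tachyons) if $p^+p^-=0$ and $P^+(n)\ne0$ for all $n\ne0$ or $P^-(n)\neq 0$ for all $n\neq 0$: one-dimensional, at ghost number $0$; (ii) if $p^+=r$, $p^-=-s$ with $r,s$ negative integers: one-dimensional at ghost number $-1$ and one-dimensional at ghost number $0$; (iii) if $p^+=r$, $p^-=-s$ with $r,s$ positive integers: one-dimensional at ghost number $0$ and one-dimensional at ghost number $+1$.
   Context: Oscillators ($n\ne0$): $\alpha^\pm_n=\frac1{\sqrt2}(x_n\pm i\varphi_n)$ with $[\alpha^\pm_m,\alpha^\mp_n]=m\delta_{m+n,0}$, $[\alpha^\pm_m,\alpha^\pm_n]=0$; fermionic $\tilde b_n,c_n$ with $\{\tilde b_m,c_n\}=\delta_{m+n,0}$; fermionic $\zeta_n,\tilde\eta_n$ with $\{\zeta_m,\tilde\eta_n\}=\delta_{m+n,0}$; bosonic $\beta_n,\gamma_n$ with $[\gamma_m,\beta_n]=\delta_{m+n,0}$; all other (anti)commutators zero. $\mathcal F_{p,p_\varphi}$ is the Fock space generated by these modes on the vacuum $|p,p_\varphi\rangle$, which is annihilated by all modes with positive index. $p^\pm=\frac1{\sqrt2}\big(p\pm i(p_\varphi+i\sqrt2)\big)$ and $P^\pm(n)=p^\pm\mp n$. $\hat L_0$ is the level operator (sum of $-n$ over creation modes with index $n<0$), with $\hat L_0|p,p_\varphi\rangle=0$;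 $L_0=p^+p^-+\hat L_0$. Ghost number: $c_n,\tilde\eta_n$ carry $+1$, $\tilde b_n,\zeta_n$ carry $-1$, all others $0$, vacuum $0$. The operators (all level-preserving): $\hat d_0=\sum_{n\ne0}\big(P^+(n)\,c_{-n}\alpha^-_n+\tilde\eta_n\beta_{-n}\big)$, $\hat d_1=\sum_{n,m\ne0,\ n+m\ne0} c_{-n}\big(\alpha^+_{-m}\alpha^-_{n+m}+\tfrac12(m-n)c_{-m}\tilde b_{n+m}+m\,\zeta_{-m}\tilde\eta_{n+m}+m\,\beta_{-m}\gamma_{n+m}\big)$, $\hat d_2=\sum_{n\ne0}P^-(n)\,c_{-n}\alpha^+_n$. $\hat d$ is the relative BRST operator of the light-cone-gauge $c=1$ string (Wakimoto realization) with all zero modes of the ghost and $\beta\gamma$ systems removed, and is a differential on $\ker L_0$. *)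

(* Defs.v *)
From HB Require Import structures.
From mathcomp Require Import all_boot all_order all_algebra.
From mathcomp Require Import complex.
From mathcomp Require Import reals.
Set Implicit Arguments.
Unset Strict Implicit.
Unset Printing Implicit Defensive.
Import Order.TTheory GRing.Theory Num.Theory.
Local Open Scope ring_scope.

(*   bosonic  : BAp = alpha^+, BAm = alpha^-, BBe = beta, BGa = gamma         *)
(*   fermionic: FB = b~, FC = c, FZ = zeta, FE = eta~                         *)
Inductive bsp := BAp | BAm | BBe | BGa.
Inductive fsp := FB | FC | FZ | FE.

Definition bsp_to (s : bsp) : 'I_4 :=
  match s with BAp => inord 0 | BAm => inord 1 | BBe => inord 2 | BGa => inord 3 end.
Definition bsp_of (i : 'I_4) : bsp :=
  match val i with 0 => BAp | 1 => BAm | 2 => BBe | _ => BGa end.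
Lemma bsp_K : cancel bsp_to bsp_of. Proof. by case; rewrite /bsp_of /= inordK. Qed.
HB.instance Definition _ := Finite.copy bsp (can_type bsp_K).

Definition fsp_to (s : fsp) : 'I_4 :=
  match s with FB => inord 0 | FC => inord 1 | FZ => inord 2 | FE => inord 3 end.
Definition fsp_of (i : 'I_4) : fsp :=
  match val i with 0 => FB | 1 => FC | 2 => FZ | _ => FE end.
Lemma fsp_K : cancel fsp_to fsp_of. Proof. by case; rewrite /fsp_of /= inordK. Qed.
HB.instance Definition _ := Finite.copy fsp (can_type fsp_K).

(* conjugate partner: the annihilator s_n (n>0) removes a quantum of the
   creator (partner s)_{-n}, as dictated by the (anti)commutators            *)
Definition bpartner (s : bsp) : bsp :=
  match s with BAp => BAm | BAm => BAp | BBe => BGa | BGa => BBe end.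
Definition fpartner (s : fsp) : fsp :=
  match s with FB => FC | FC => FB | FZ => FE | FE => FZ end.

(* States.  A state of the Fock space at level <= N only involves modes of   *)
(* index -1,...,-N.  Mode index -(k+1) is labelled by k : 'I_N.              *)
(* A state is (occupation numbers of bosonic creators, set of occupied       *)
(* fermionic creators).  It stands for the monomial                          *)
(*   prod_bosons (s_{-(k+1)})^(occ) * f_1 f_2 ... f_r |p,p_phi>              *)
(* where the occupied fermionic creators f_1,...,f_r are written in          *)
(* increasing order of (mode index, species).                                *)
Definition BState (N : nat) : Type :=
  ({ffun bsp * 'I_N -> nat} * {set fsp * 'I_N})%type.

Inductive mop := OB of bsp & int | OF of fsp & int.

Definition mlabel (N : nat) (n : int) : option 'I_N :=
  if n == 0 then None else insub (absz n).-1.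

(* Jordan-Wigner sign for inserting/removing fermionic mode (f,k) *)
Definition fprec (N : nat) (a b : fsp * 'I_N) : bool :=
  (val a.2 < val b.2)%N || ((val a.2 == val b.2) && (val (fsp_to a.1) < val (fsp_to b.1))%N).
Definition jwsign (R : realType) (N : nat) (FS : {set fsp * 'I_N}) (x : fsp * 'I_N) : R[i] :=
  (-1) ^+ #|[set y in FS | fprec y x]|.

Definition bump_occ (N : nat) (o : {ffun bsp * 'I_N -> nat}) (x : bsp * 'I_N) (d : bool) :=
  [ffun y => if y == x then (if d then (o y).+1 else (o y).-1) else o y].

(* coefficient of the bosonic annihilator s_n (n>0) on a state with j quanta of
   its partner:  alpha^+_n = n d/d alpha^-_{-n},  alpha^-_n = n d/d alpha^+_{-n},
   gamma_n = d/d beta_{-n},  beta_n = - d/d gamma_{-n}                        *)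
Definition bann_coef (R : realType) (s : bsp) (n : int) (j : nat) : R[i] :=
  match s with
  | BAp | BAm => n%:~R * j%:R
  | BGa => j%:R
  | BBe => - j%:R
  end.

Definition act (R : realType) (N : nat) (o : mop) (cs : R[i] * BState N) : R[i] * BState N :=
  let: (c, (occ, FS)) := cs in
  match o with
  | OB s n =>
      match mlabel N n with
      | None => (0, (occ, FS))
      | Some k =>
          if n < 0 then (c, (bump_occ occ (s, k) true, FS))
          else let j := occ (bpartner s, k) in
               if j == 0%N then (0, (occ, FS))
               else (c * bann_coef R s n j, (bump_occ occ (bpartner s, k) false, FS))
      end
  | OF f n =>
      match mlabel N n with
      | None => (0, (occ, FS))
      | Some k =>
          if n < 0 then
            if (f, k) \in FS then (0, (occ, FS))
            else (c * jwsign R FS (f, k), (occ, (f, k) |: FS))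
          else
            if (fpartner f, k) \in FS then
              (c * jwsign R FS (fpartner f, k), (occ, FS :\ (fpartner f, k)))
            else (0, (occ, FS))
      end
  end.

(* a word [:: o1; ...; or] is the operator product o1 ... or (or acts first) *)
Definition actw (R : realType) (N : nat) (w : seq mop) (s : BState N) : R[i] * BState N :=
  foldr (@act R N) (1, s) w.

Definition sqrt2 (R : realType) : R[i] := (Num.sqrt (2 : R))%:C%C.
Definition iC (R : realType) : R[i] := 'i%C.
Definition pplus (R : realType) (p pphi : R[i]) : R[i] :=
  (p + iC R * (pphi + iC R * sqrt2 R)) / sqrt2 R.
Definition pminus (R : realType) (p pphi : R[i]) : R[i] :=
  (p - iC R * (pphi + iC R * sqrt2 R)) / sqrt2 R.
Definition Pplus (R : realType) (p pphi : R[i]) (n : int) : R[i] := pplus p pphi - n%:~R.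
Definition Pminus (R : realType) (p pphi : R[i]) (n : int) : R[i] := pminus p pphi + n%:~R.

(* The operator d^ = d0 + d1 + d2 as a list of (coefficient, word).           *)
(* On a state of level N every term whose mode indices are not all in        *)
(* [-N, N] vanishes, so the sums are truncated to             *)
(* indices n, m, n+m in [-N, N] \ {0}.                                        *)
Definition nzidx (N : nat) : seq int :=
  [seq (k.+1)%:Z | k <- iota 0 N] ++ [seq - (k.+1)%:Z | k <- iota 0 N].

Definition d0terms (R : realType) (p pphi : R[i]) (N : nat) : seq (R[i] * seq mop) :=
  flatten [seq [:: (Pplus p pphi n, [:: OF FC (- n); OB BAm n]);
                  (1, [:: OF FE n; OB BBe (- n)])] | n : int <- nzidx N].

Definition d1terms (R : realType) (N : nat) : seq (R[i] * seq mop) :=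
  flatten [seq flatten [seq
     if ((n + m)%R != 0%R :> int) && (absz (n + m)%R <= N)%N then
       [:: (1, [:: OF FC (- n); OB BAp (- m); OB BAm (n + m)]);
           ((m - n)%:~R / 2, [:: OF FC (- n); OF FC (- m); OF FB (n + m)]);
           (m%:~R, [:: OF FC (- n); OF FZ (- m); OF FE (n + m)]);
           (m%:~R, [:: OF FC (- n); OB BBe (- m); OB BGa (n + m)])]
     else [::] | m : int <- nzidx N] | n : int <- nzidx N].

Definition d2terms (R : realType) (p pphi : R[i]) (N : nat) : seq (R[i] * seq mop) :=
  [seq (Pminus p pphi n, [:: OF FC (- n); OB BAp n]) | n : int <- nzidx N].

Definition dterms (R : realType) (p pphi : R[i]) (N : nat) : seq (R[i] * seq mop) :=
  d0terms p pphi N ++ d1terms R N ++ d2terms p pphi N.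

Definition blevel (N : nat) (s : BState N) : nat :=
  (\sum_(x : bsp * 'I_N) s.1 x * (val x.2).+1 + \sum_(x in s.2) (val x.2).+1)%N.

Definition fcount (N : nat) (FS : {set fsp * 'I_N}) (f : fsp) : nat :=
  #|[set x in FS | x.1 == f]|.

Definition ghost (N : nat) (s : BState N) : int :=
  (fcount s.2 FC)%:Z + (fcount s.2 FE)%:Z - (fcount s.2 FB)%:Z - (fcount s.2 FZ)%:Z.

(* finite carrier: at level N every bosonic occupation is <= N *)
Definition FState (N : nat) : finType :=
  ({ffun bsp * 'I_N -> 'I_N.+1} * {set fsp * 'I_N})%type.
Definition emb (N : nat) (s : FState N) : BState N :=
  ([ffun x => val (s.1 x)], s.2).

(* basis of the level-N subspace of F_{p,p_phi}, i.e. of the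
   L^_0 = N eigenspace *)
Definition Basis (N : nat) : finType := {s : FState N | blevel (emb s) == N}.

Definition bstate (N : nat) (x : Basis N) : BState N := emb (val x).

Definition nB (N : nat) : nat := #|{: Basis N}|.
Definition bof (N : nat) (i : 'I_(nB N)) : Basis N := enum_val i.

(* matrix of d^ on the level-N subspace, row-vector convention:
   d^ (e_i) = sum_j D i j e_j *)
Definition dmx (R : realType) (p pphi : R[i]) (N : nat) : 'M[R[i]]_(nB N) :=
  \matrix_(i, j)
    \sum_(t <- dterms p pphi N)
      let: (c, s) := actw R t.2 (bstate (bof i)) in
      if s == bstate (bof j) then t.1 * c else 0.

Definition ghostmx (R : realType) (N : nat) (g : int) : 'M[R[i]]_(nB N) :=
  diag_mx (\row_i (ghost (bstate (bof i)) == g)%:R).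

(* L_0 = p^+ p^- + L^_0 acts on the level-N subspace by this scalar *)
Definition L0val (R : realType) (p pphi : R[i]) (N : nat) : R[i] :=
  pplus p pphi * pminus p pphi + N%:R.

Definition cohdim (R : realType) (p pphi : R[i]) (N : nat) (g : int) : nat :=
  (\rank (kermx (dmx p pphi N) :&: ghostmx R N g)%MS
   - \rank (ghostmx R N (g - 1) *m dmx p pphi N))%N.

Definition case_tachyon (R : realType) (p pphi : R[i]) : Prop :=
  pplus p pphi * pminus p pphi = 0 /\
  ((forall n : int, n != 0 -> Pplus p pphi n != 0) \/
   (forall n : int, n != 0 -> Pminus p pphi n != 0)).

Definition case_neg (R : realType) (p pphi : R[i]) : Prop :=
  exists r s : int, r < 0 /\ s < 0 /\ pplus p pphi = r%:~R /\ pminus p pphi = - s%:~R.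

Definition case_pos (R : realType) (p pphi : R[i]) : Prop :=
  exists r s : int, 0 < r /\ 0 < s /\ pplus p pphi = r%:~R /\ pminus p pphi = - s%:~R.

(* Main.v *)
Require Import Defs.
(** The modes act on functions on monomials and satisfy the canonical
    (anti)commutation relations, and d raises the ghost number by one.

    On levels at most N one has d^2 = M (p^+ p^- + L_0-hat) with
    M = sum_m m c_{-m} c_m.  Indeed [d, [d, x_k]] = - k M x_k for every mode x
    other than b, where only the conformal weight of x enters; hence the
    difference of the two sides supercommutes with all modes but b, and the
    identity reduces to b_{-n}|0>.  There it is the vacuum value of L_n L_{-n},
    to which each 0 < m < n contributes a total of -2n^2 over the four currents.

    The leading part d_0 of d (or its mirror image, with P^- and alpha^+) has the
    contraction K = sum_n (P(n)^{-1} b_n alpha_{-n} + n zeta_{-n} gamma_n): the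
    anticommutator {d_0, K} is diagonal and counts the level carried by the modes
    on which d_0 acts invertibly.  The other terms of d raise the degree counting
    alpha^+ and c by +1 and alpha^- and b by -1 (with alpha^+ and alpha^- exchanged
    for the mirror image), so the cohomology is the kernel of {d_0, K} as soon as
    that kernel lies in a single degree.  It is spanned by the vacuum if N = 0; if
    N > 0 it is 0 when one of P^+, P^- has no zero, and in the resonant cases
    N = r s it is spanned by (alpha^+_{-r})^s and (alpha^+_{-r})^{s-1} c_{-r}, or by
    the same monomials in alpha^-_r and b_r, with |s| for s, when r < 0. *)
From HB Require Import structures.
From mathcomp Require Import all_boot all_order all_algebra.
From mathcomp Require Import complex.
From mathcomp Require Import reals.
From mathcomp Require Import boolp functions zify ring.
Set Implicit Arguments.
Unset Strict Implicit.
Unset Printing Implicit Defensive.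
Import Order.TTheory GRing.Theory Num.Theory.
Local Open Scope ring_scope.

(** The truncation of the modes to |n| <= N shapes the proof. A relation with a single contraction
    stays exact under it, because a lost summand always contains a mode that acts as zero; but the
    truncated L_n no longer close into an algebra, and the terms that d^2 loses vanish only by
    counting levels. Hence the bounds l <= N and l - k <= N in every identity for d^2. That d^2 is M
    L_0 and not 0 comes from the removed zero modes: at n + m = 0 the cubic ghost term would be -M
    b_0, and without it nothing cancels M L_0. The mode b is set apart because {d, b_k} is a whole
    Virasoro generator. Instead of computing [d, L_k], the difference of the two sides is tested
    against all other annihilators; level and ghost number then leave only b_{-n}|0>. For the
    cohomology no spectral sequence is built. At a fixed level the degree takes finitely many
    values, so the perturbation series are finite, and an explicit invertible matrix conjugates d to
    its leading part; only ranks of diagonal matrices remain. *)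

(** * Mode indices, occupation numbers and fermionic signs *)

Lemma mem_nzidx N (n : int) : (n \in nzidx N) = (n != 0) && (`|n| <= N)%N.
Proof.
rewrite mem_cat; apply/idP/idP.
  by case/orP => /mapP[k]; rewrite mem_iota => hk ->; lia.
case: n => [[|n]|n] //= h; apply/orP; [left|right].
  by apply/mapP; exists n => //; rewrite mem_iota; lia.
by apply/mapP; exists n; rewrite ?mem_iota ?NegzE //; lia.
Qed.

Lemma uniq_nzidx N : uniq (nzidx N).
Proof.
rewrite cat_uniq; apply/and3P; split.
- by rewrite map_inj_uniq ?iota_uniq // => i j [].
- by apply/hasPn => x /mapP[k _ ->]; apply/mapP => -[j _]; lia.
- by rewrite map_inj_uniq ?iota_uniq // => i j; lia.
Qed.

Variant mlabel_spec N (n : int) : option 'I_N -> bool -> bool -> Type :=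
| MLabelNone of n \notin nzidx N : mlabel_spec n None (n < 0) false
| MLabelPos (k : 'I_N) of n = (k.+1)%:Z : mlabel_spec n (Some k) false true
| MLabelNeg (k : 'I_N) of n = - (k.+1)%:Z : mlabel_spec n (Some k) true true.

Lemma mlabelP N n : mlabel_spec n (mlabel N n) (n < 0) (n \in nzidx N).
Proof.
have [nI|nI] := boolP (n \in nzidx N); last first.
  suff -> : mlabel N n = None by constructor.
  rewrite /mlabel; case: eqP => // n0; rewrite insubF //.
  by apply/negbTE; move: nI; rewrite mem_nzidx; lia.
move: nI; rewrite mem_nzidx => /andP[n0 nN].
rewrite /mlabel (negbTE n0).
have kN : (`|n|.-1 < N)%N by lia.
rewrite (insubT (fun i => (i < N)%N) kN).
by case: ltP => n_lt0; constructor => /=; lia.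
Qed.

Lemma bump_occE N (o : {ffun bsp * 'I_N -> nat}) x d y :
  bump_occ o x d y = if y == x then if d then (o y).+1 else (o y).-1 else o y.
Proof. by rewrite ffunE. Qed.

Lemma bump_occK N (o : {ffun bsp * 'I_N -> nat}) x :
  bump_occ (bump_occ o x true) x false = o.
Proof. by apply/ffunP => y; rewrite !bump_occE; case: eqP. Qed.

Lemma bump_occVK N (o : {ffun bsp * 'I_N -> nat}) x :
  o x != 0%N -> bump_occ (bump_occ o x false) x true = o.
Proof.
move=> ox; apply/ffunP => y; rewrite !bump_occE.
by case: eqP => // ->; rewrite prednK // lt0n.
Qed.

Lemma bump_occC N (o : {ffun bsp * 'I_N -> nat}) x y d e :
  x != y -> bump_occ (bump_occ o x d) y e = bump_occ (bump_occ o y e) x d.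
Proof.
move=> xy; apply/ffunP => z; rewrite !bump_occE.
by case: (eqVneq z y) => [->|]; rewrite // eq_sym (negbTE xy).
Qed.

Section FermionSign.
Variables (F : numFieldType) (N : nat).
Implicit Types (FS : {set fsp * 'I_N}) (x y : fsp * 'I_N).

Lemma fprec_total x y : x != y -> fprec x y = ~~ fprec y x.
Proof.
case: x y => [f i] [g j] /=; rewrite xpair_eqE negb_and /fprec /= => xy.
case: (ltngtP (val i) (val j)) => //= ij.
have eij : i = j by apply/val_inj.
have: fsp_to f != fsp_to g.
  by rewrite (can_eq fsp_K); move: xy; rewrite eij eqxx orbF.
by rewrite -val_eqE /=; case: ltngtP.
Qed.

Lemma fprec_irr x : fprec x x = false.
Proof. by rewrite /fprec !ltnn andbF. Qed.

(** The Jordan-Wigner sign of [jwsign] over any numeric field; over [R[i]] the two are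
    convertible. *)
Definition jw FS x : F := (-1) ^+ #|[set y in FS | fprec y x]|.

Lemma jw_sqr FS x : jw FS x * jw FS x = 1.
Proof. by rewrite -expr2 sqrr_sign. Qed.

Lemma jw_neq0 FS x : jw FS x != 0.
Proof. by rewrite /jw signr_eq0. Qed.

Lemma jwU FS x y : y \notin FS -> jw (y |: FS) x = (-1) ^+ fprec y x * jw FS x.
Proof.
move=> yFS; rewrite /jw -exprD; congr (_ ^+ _).
have [yx|yx] := boolP (fprec y x).
  rewrite (_ : [set _ in _ | _] = y |: [set z in FS | fprec z x]).
    by rewrite cardsU1 inE (negbTE yFS).
  by apply/setP => z; rewrite !inE andb_orl; case: eqP => // ->; rewrite yx.
apply: eq_card => z; rewrite !inE andb_orl.
by case: eqP => // ->; rewrite (negbTE yx) (negbTE yFS).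
Qed.

Lemma jwD FS x y : y \in FS -> jw (FS :\ y) x = (-1) ^+ fprec y x * jw FS x.
Proof.
move=> yFS; rewrite -{2}(setD1K yFS) jwU ?setD11 //.
by rewrite mulrA -expr2 sqrr_sign mul1r.
Qed.

(** Exactly one of two distinct modes precedes the other; the minus sign of every anticommutation
    relation comes from here. *)
Lemma sign_fprec x y : x != y -> (-1) ^+ fprec x y = - (-1) ^+ fprec y x :> F.
Proof. by move/fprec_total ->; case: (fprec y x); rewrite ?opprK. Qed.

End FermionSign.

(** * Modes as operators on functions on monomials, and their commutation relations *)

(** [v s] is the coefficient of the monomial [s]. No finiteness of support is imposed: modes are
    given by pointwise formulas, and finiteness returns through homogeneity in the level. *)
Definition Vec (F : numFieldType) (N : nat) := BState N -> F^o.
HB.instance Definition _ F N := GRing.Lmodule.copy (Vec F N) (BState N -> F^o).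

Section Modes.
Variables (F : numFieldType) (N : nat).
Local Notation V := (Vec F N).
Implicit Types (v : V) (s : BState N).

Lemma vaddE v w s : (v + w) s = v s + w s. Proof. by []. Qed.
Lemma vscaleE a v s : (a *: v) s = a * v s. Proof. by []. Qed.
Lemma voppE v s : (- v) s = - v s. Proof. by []. Qed.
Lemma vzeroE s : (0 : V) s = 0. Proof. by []. Qed.
Lemma vsumE (I : Type) (r : seq I) (P : pred I) (f : I -> V) s :
  (\sum_(i <- r | P i) f i) s = \sum_(i <- r | P i) f i s.
Proof. exact: (big_morph (fun v : V => v s)). Qed.

Definition vE := (vaddE, vscaleE, voppE, vzeroE).

(** On coefficients a creator reads the value at the state with one quantum less and an annihilator
    at the state with one more. The usual action on basis vectors is recovered in the [_kdelta]
    lemmas. *)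
Definition bcr (x : bsp * 'I_N) v : V :=
  fun s => if s.1 x == 0%N then 0 else v (bump_occ s.1 x false, s.2).
Definition ban (x : bsp * 'I_N) v : V :=
  fun s => (s.1 x).+1%:R * v (bump_occ s.1 x true, s.2).
Definition fcr (y : fsp * 'I_N) v : V :=
  fun s => if y \in s.2 then jw F s.2 y * v (s.1, s.2 :\ y) else 0.
Definition fan (y : fsp * 'I_N) v : V :=
  fun s => if y \in s.2 then 0 else jw F s.2 y * v (s.1, y |: s.2).

Lemma bcr_linear x : linear (bcr x).
Proof.
move=> a u v; apply/funext => s; rewrite !vE /bcr.
by case: ifP => _; rewrite ?mulr0 ?addr0.
Qed.
Lemma ban_linear x : linear (ban x).
Proof. by move=> a u v; apply/funext => s; rewrite !vE /ban !vE; ring. Qed.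
Lemma fcr_linear x : linear (fcr x).
Proof.
move=> a u v; apply/funext => s; rewrite !vE /fcr.
by case: ifP => _; rewrite ?mulr0 ?addr0 // !vE; ring.
Qed.
Lemma fan_linear x : linear (fan x).
Proof.
move=> a u v; apply/funext => s; rewrite !vE /fan.
by case: ifP => _; rewrite ?mulr0 ?addr0 // !vE; ring.
Qed.
HB.instance Definition _ x := GRing.isLinear.Build F V V _ (bcr x) (bcr_linear x).
HB.instance Definition _ x := GRing.isLinear.Build F V V _ (ban x) (ban_linear x).
HB.instance Definition _ x := GRing.isLinear.Build F V V _ (fcr x) (fcr_linear x).
HB.instance Definition _ x := GRing.isLinear.Build F V V _ (fan x) (fan_linear x).

Lemma bcr_bcr x y v : bcr x (bcr y v) = bcr y (bcr x v).
Proof.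
apply/funext => -[o S]; rewrite /bcr /=.
have [->//|xy] := eqVneq x y.
rewrite !bump_occE 1?[y == x]eq_sym ?(negbTE xy) (bump_occC _ _ _ xy).
by do 2 case: ifP.
Qed.

Lemma ban_ban x y v : ban x (ban y v) = ban y (ban x v).
Proof.
apply/funext => -[o S]; rewrite /ban /=.
have [->//|xy] := eqVneq x y.
by rewrite !bump_occE 1?[y == x]eq_sym ?(negbTE xy) (bump_occC _ _ _ xy) mulrCA.
Qed.

Lemma ban_bcr x y v : ban x (bcr y v) = bcr y (ban x v) + (x == y)%:R *: v.
Proof.
apply/funext => -[o S]; rewrite !vE /ban /bcr /= !bump_occE.
have [->|xy] := eqVneq x y.
  rewrite /= bump_occK; case: eqP => [->|/eqP oy].
    by rewrite add0r.
  by rewrite bump_occVK // prednK ?lt0n // -addn1 natrD mulrDl.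
rewrite 1?[y == x]eq_sym ?(negbTE xy) mul0r addr0.
by case: ifP => _; rewrite ?mulr0 // bump_occC.
Qed.

Lemma fcr_fcr x y v : fcr x (fcr y v) = - fcr y (fcr x v).
Proof.
apply/funext => -[o S]; rewrite !vE /fcr /= !inE.
have [->|xy] := eqVneq x y.
  by rewrite ?eqxx /=; case: ifP; rewrite ?mulr0 ?oppr0.
rewrite 1?[y == x]eq_sym ?(negbTE xy) /=.
case: (boolP (x \in S)) => xS; case: (boolP (y \in S)) => yS; rewrite ?mulr0 ?oppr0 //.
rewrite !jwD // sign_fprec // !setDDl setUC; ring.
Qed.

Lemma fan_fan x y v : fan x (fan y v) = - fan y (fan x v).
Proof.
apply/funext => -[o S]; rewrite !vE /fan /= !inE.
have [->|xy] := eqVneq x y.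
  by rewrite ?eqxx /=; case: ifP; rewrite ?mulr0 ?oppr0.
rewrite 1?[y == x]eq_sym ?(negbTE xy) /=.
case: (boolP (x \in S)) => xS; case: (boolP (y \in S)) => yS; rewrite ?mulr0 ?oppr0 //.
rewrite !jwU // sign_fprec // !setUA [[set x] :|: _]setUC; ring.
Qed.

Lemma fan_fcr x y v : fan x (fcr y v) = - fcr y (fan x v) + (x == y)%:R *: v.
Proof.
apply/funext => -[o S]; rewrite !vE /fan /fcr /= !inE.
have [->|xy] := eqVneq x y.
  rewrite ?eqxx /=; case: (boolP (y \in S)) => yS.
    by rewrite jwD // fprec_irr mul1r mulrA jw_sqr setD1K //; ring.
  by rewrite jwU // fprec_irr mul1r mulrA jw_sqr setU1K // oppr0 add0r.
rewrite 1?[y == x]eq_sym ?(negbTE xy) /= mul0r addr0.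
case: (boolP (x \in S)) => xS; case: (boolP (y \in S)) => yS; rewrite ?mulr0 ?oppr0 //.
rewrite jwU // jwD // sign_fprec // setDUl.
rewrite [[set x] :\ y](setDidPl _) ?disjoints1 ?inE //.
by ring.
Qed.

Lemma bcr_fcr x y v : bcr x (fcr y v) = fcr y (bcr x v).
Proof.
by apply/funext => -[o S]; rewrite /bcr /fcr /=; do 2 case: ifP; rewrite ?mulr0.
Qed.
Lemma bcr_fan x y v : bcr x (fan y v) = fan y (bcr x v).
Proof.
by apply/funext => -[o S]; rewrite /bcr /fan /=; do 2 case: ifP; rewrite ?mulr0.
Qed.
Lemma ban_fcr x y v : ban x (fcr y v) = fcr y (ban x v).
Proof.
by apply/funext => -[o S]; rewrite /ban /fcr /=; case: ifP; rewrite ?mulr0 ?mulrA 1?[_ * jw _ _ _]mulrC.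
Qed.
Lemma ban_fan x y v : ban x (fan y v) = fan y (ban x v).
Proof.
by apply/funext => -[o S]; rewrite /ban /fan /=; case: ifP; rewrite ?mulr0 ?mulrA 1?[_ * jw _ _ _]mulrC.
Qed.

(** [bann_coef] without the occupation number, which [ban] supplies. *)
Definition acoef (s : bsp) (n : int) : F :=
  match s with BAp | BAm => n%:~R | BGa => 1 | BBe => -1 end.

(* Locked here and below so that rewriting with linearity never unfolds it. *)
Definition opm (o : mop) v : V := locked
  match o with
  | OB s n => if mlabel N n is Some k then
      if n < 0 then bcr (s, k) v else acoef s n *: ban (bpartner s, k) v else 0
  | OF f n => if mlabel N n is Some k then
      if n < 0 then fcr (f, k) v else fan (fpartner f, k) v else 0
  end.

Lemma opm_bosonE (s : bsp) n v : opm (OB s n) v =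
  if mlabel N n is Some k then
    if n < 0 then bcr (s, k) v else acoef s n *: ban (bpartner s, k) v else 0.
Proof. by rewrite /opm -lock. Qed.

Lemma opm_fermionE f n v : opm (OF f n) v =
  if mlabel N n is Some k then
    if n < 0 then fcr (f, k) v else fan (fpartner f, k) v else 0.
Proof. by rewrite /opm -lock. Qed.

Definition opmE := (opm_bosonE, opm_fermionE).

Lemma opm_linear o : linear (opm o).
Proof.
case: o => s n a u v; rewrite !opmE; case: mlabel => [k|]; rewrite ?scaler0 ?addr0 //;
  case: ifP => _; rewrite linearP //.
by rewrite scalerDr !scalerA mulrC.
Qed.
HB.instance Definition _ o := GRing.isLinear.Build F V V _ (opm o) (opm_linear o).

Definition midx o : int := match o with OB _ n | OF _ n => n end.

Lemma opm_out o v : midx o \notin nzidx N -> opm o v = 0.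
Proof. by case: o => s n; rewrite opmE /=; case: mlabelP. Qed.

Definition fermi o := if o is OF _ _ then true else false.

Definition bbr (s t : bsp) (m : int) : F :=
  match s, t with
  | BAp, BAm | BAm, BAp => m%:~R | BGa, BBe => 1 | BBe, BGa => -1 | _, _ => 0
  end.
Definition fbr (f g : fsp) : bool :=
  match f, g with FB, FC | FC, FB | FZ, FE | FE, FZ => true | _, _ => false end.

(** The central term requires [m \in nzidx N] because a mode outside the truncation acts as zero. *)
Definition bracket o1 o2 : F :=
  match o1, o2 with
  | OB s m, OB t n => if (m + n == 0) && (m \in nzidx N) then bbr s t m else 0
  | OF f m, OF g n => if (m + n == 0) && (m \in nzidx N) then (fbr f g)%:R else 0
  | _, _ => 0
  end.

Lemma bbrE (s t : bsp) m : bbr s t m = if s == bpartner t then acoef s m else 0.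
Proof. by case: s; case: t => /=; case: eqP. Qed.

Lemma fbrE f g : fbr f g = (f == fpartner g).
Proof. by case: f; case: g => /=; case: eqP. Qed.

Lemma bpartnerK : involutive bpartner. Proof. by case. Qed.
Lemma fpartnerK : involutive fpartner. Proof. by case. Qed.

Lemma acoefN (s : bsp) m : acoef (bpartner s) (- m) = - acoef s m.
Proof. by case: s; rewrite /= ?opprK // mulrNz. Qed.

Lemma opmC o1 o2 v :
  opm o1 (opm o2 v) = (-1) ^+ (fermi o1 && fermi o2) *: opm o2 (opm o1 v)
                      + bracket o1 o2 *: v.
Proof.
case: o1 => [s|f] m; case: o2 => [t|g] n; rewrite !opmE /=; rewrite ?expr0 ?scale1r ?expr1 ?scaleN1r.
- case: (mlabelP N m) => [_|k mk|k mk]; case: (mlabelP N n) => [nI|j nj|j nj];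
    rewrite ?andbF ?andbT ?scale0r ?addr0 ?linear0 ?scaler0 //.
  + case: eqP => [mn|]; rewrite ?scale0r ?addr0 //.
    by have := ltn_ord k; move: nI; rewrite mem_nzidx; lia.
  + rewrite (_ : _ == 0 = false) ?scale0r ?addr0; last by lia.
    by rewrite !linearZ /= ban_ban !scalerA mulrC.
  + rewrite ban_bcr scalerDr scalerA !linearZ /=; congr (_ + _ *: _).
    have -> : (m + n == 0) = (k == j) by apply/eqP/eqP => [h|kj]; [apply/val_inj => /=; lia|rewrite mk nj kj; lia].
    rewrite xpair_eqE bbrE eq_sym -(inj_eq (inv_inj bpartnerK)) bpartnerK eq_sym.
    by case: eqP; case: eqP; rewrite ?mulr0 ?mulr1 // andbF.
  + case: eqP => [mn|]; rewrite ?scale0r ?addr0 //.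
    by have := ltn_ord k; move: nI; rewrite mem_nzidx; lia.
  + have -> : (m + n == 0) = (k == j) by apply/eqP/eqP => [h|kj]; [apply/val_inj => /=; lia|rewrite mk nj kj; lia].
    rewrite ban_bcr scalerDr scalerA !linearZ /= -addrA -scalerDl.
    rewrite -[LHS]addr0; congr (_ + _); apply/esym/eqP; rewrite scaler_eq0; apply/orP; left; apply/eqP.
    rewrite xpair_eqE bbrE eq_sym [j == k]eq_sym; case: eqP => // [st|_]; last by rewrite mulr0 add0r if_same.
    case: eqP => // kj; rewrite ?mulr0 ?addr0 // mulr1 st.
    (* Here the creator stands on the left, so the contraction carries the coefficient of the second
       mode; [acoefN] matches it with that of the first. *)
    by rewrite (_ : m = - n) ?acoefN ?subrr // mk nj kj; lia.
  + rewrite (_ : _ == 0 = false) ?scale0r ?addr0; last by lia.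
    by rewrite bcr_bcr.
- case: (mlabelP N m) => [_|k mk|k mk]; case: (mlabelP N n) => [nI|j nj|j nj];
    rewrite ?scale0r ?addr0 ?linear0 ?scaler0 //.
  + by rewrite linearZ /= ban_fan.
  + by rewrite linearZ /= ban_fcr.
  + by rewrite bcr_fan.
  + by rewrite bcr_fcr.
- case: (mlabelP N m) => [_|k mk|k mk]; case: (mlabelP N n) => [nI|j nj|j nj];
    rewrite ?scale0r ?addr0 ?linear0 ?scaler0 //.
  + by rewrite linearZ /= ban_fan.
  + by rewrite bcr_fan.
  + by rewrite linearZ /= ban_fcr.
  + by rewrite bcr_fcr.
- case: (mlabelP N m) => [_|k mk|k mk]; case: (mlabelP N n) => [nI|j nj|j nj];
    rewrite ?andbF ?andbT ?scale0r ?addr0 ?linear0 ?scaler0 ?oppr0 //.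
  + case: eqP => [mn|]; rewrite ?scale0r ?addr0 //.
    by have := ltn_ord k; move: nI; rewrite mem_nzidx; lia.
  + by rewrite (_ : _ == 0 = false) ?scale0r ?addr0 1?fan_fan //; lia.
  + rewrite fan_fcr; congr (_ + _ *: _).
    have -> : (m + n == 0) = (k == j) by apply/eqP/eqP => [h|kj]; [apply/val_inj => /=; lia|rewrite mk nj kj; lia].
    rewrite xpair_eqE fbrE eq_sym -(inj_eq (inv_inj fpartnerK)) fpartnerK eq_sym.
    by case: eqP; case: eqP.
  + case: eqP => [mn|]; rewrite ?scale0r ?addr0 //.
    by have := ltn_ord k; move: nI; rewrite mem_nzidx; lia.
  + have -> : (m + n == 0) = (k == j) by apply/eqP/eqP => [h|kj]; [apply/val_inj => /=; lia|rewrite mk nj kj; lia].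
    rewrite fan_fcr opprD opprK -addrA -scaleNr -scalerDl.
    rewrite -[LHS]addr0; congr (_ + _); apply/esym/eqP; rewrite scaler_eq0; apply/orP; left; apply/eqP.
    rewrite xpair_eqE fbrE eq_sym [j == k]eq_sym.
    by case: eqP; case: eqP; rewrite ?oppr0 ?addr0 // addNr.
  + by rewrite (_ : _ == 0 = false) ?scale0r ?addr0 1?fcr_fcr //; lia.
Qed.

End Modes.

(** * Additive weights, charges of monomials and homogeneous vectors *)

Definition bmode N (x : bsp * 'I_N) : mop := OB x.1 (- (x.2.+1)%:Z).
Definition fmode N (y : fsp * 'I_N) : mop := OF y.1 (- (y.2.+1)%:Z).
Definition conj_mop (o : mop) : mop :=
  match o with OB s n => OB (bpartner s) (- n) | OF f n => OF (fpartner f) (- n) end.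
(** Oddness says that an annihilator takes away the weight that the creator of the same quantum
    adds, so each mode shifts the charge by its own weight. Level, ghost number, reduced level and
    perturbation degree are all of this kind. *)
Definition odd_weight (W : mop -> int) := forall o, W (conj_mop o) = - W o.
Definition charge N (W : mop -> int) (s : BState N) : int :=
  \sum_x (s.1 x)%:Z * W (bmode x) + \sum_(y in s.2) W (fmode y).

Lemma charge_bump N W (o : {ffun bsp * 'I_N -> nat}) (S : {set fsp * 'I_N}) x :
  charge W (bump_occ o x true, S) = charge W (o, S) + W (bmode x).
Proof.
rewrite /charge /= addrAC; congr (_ + _).
rewrite (bigD1 x) //= [in RHS](bigD1 x) //= addrAC; congr (_ + _).
  by rewrite bump_occE eqxx -addn1 PoszD mulrDl mul1r.
by apply: eq_bigr => y yx; rewrite bump_occE (negbTE yx).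
Qed.

Lemma charge_setU1 N W o (S : {set fsp * 'I_N}) y : y \notin S ->
  charge W (o, y |: S) = charge W (o, S) + W (fmode y).
Proof. by move=> yS; rewrite /charge /= big_setU1 //= -addrA; congr (_ + _); rewrite addrC. Qed.

Definition level_weight (o : mop) : int := - midx o.
Lemma odd_level : odd_weight level_weight. Proof. by case. Qed.

Lemma charge_level N (s : BState N) : charge level_weight s = (blevel s)%:Z.
Proof.
rewrite /charge /blevel PoszD !(big_morph Posz PoszD (erefl _)).
by congr (_ + _); apply: eq_bigr => x _; rewrite /level_weight /= opprK ?PoszM.
Qed.

Section Homogeneous.
Variables (F : numFieldType) (N : nat).
Local Notation V := (Vec F N).

Definition kdelta (s : BState N) : V := fun t => (t == s)%:R.

Lemma bcr_kdelta x o S : bcr x (kdelta (o, S)) = kdelta (bump_occ o x true, S).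
Proof.
apply/funext => -[o' S']; rewrite /bcr /kdelta /= !xpair_eqE.
case: eqP => [ox|/eqP ox].
  case: eqP => // e; exfalso; move: ox; rewrite e bump_occE eqxx; lia.
congr (_ && _)%:R; apply/eqP/eqP => [<-|->]; by rewrite ?bump_occVK ?bump_occK.
Qed.

Lemma ban_kdelta x o S :
  ban x (kdelta (o, S)) = (o x)%:R *: kdelta (bump_occ o x false, S).
Proof.
apply/funext => -[o' S']; rewrite /ban vscaleE /kdelta /= !xpair_eqE.
case: (eqVneq S' S) => _; rewrite ?andbF ?mulr0 // !andbT.
case: (eqVneq (o x) 0%N) => ox.
  rewrite ox mul0r; case: eqP => [e|]; rewrite ?mulr0 //.
  by exfalso; move: ox; rewrite -e bump_occE eqxx.
have [<-|ne] := eqVneq (bump_occ o' x true) o.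
  by rewrite bump_occE eqxx bump_occK eqxx.
have [e|_] := eqVneq o' (bump_occ o x false); last by rewrite !mulr0.
by move: ne; rewrite e bump_occVK // eqxx.
Qed.

Lemma fcr_kdelta y o S : fcr y (kdelta (o, S)) =
  if y \in S then 0 else jw F S y *: kdelta (o, y |: S).
Proof.
apply/funext => -[o' S']; rewrite /fcr /kdelta /= !xpair_eqE.
case: (boolP (y \in S')) => yS'.
  have [e|ne] := eqVneq (S' :\ y) S.
    rewrite -e setD11 vscaleE /kdelta xpair_eqE setD1K // eqxx jwD //.
    by rewrite fprec_irr mul1r.
  rewrite andbF mulr0; case: ifP => // yS; rewrite vscaleE /kdelta xpair_eqE.
  case: (eqVneq S' _) => [e|]; rewrite ?andbF ?mulr0 //.
  by move: ne; rewrite e setU1K ?eqxx // yS.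
case: ifP => // yS; rewrite vscaleE /kdelta xpair_eqE.
case: (eqVneq S' _) => [e|]; rewrite ?andbF ?mulr0 //.
by move: yS'; rewrite e setU11.
Qed.

Lemma fan_kdelta y o S : fan y (kdelta (o, S)) =
  if y \in S then jw F S y *: kdelta (o, S :\ y) else 0.
Proof.
apply/funext => -[o' S']; rewrite /fan /kdelta /= !xpair_eqE.
case: (boolP (y \in S')) => yS'.
  case: ifP => // yS; rewrite vscaleE /kdelta xpair_eqE.
  case: (eqVneq S' _) => [e|]; rewrite ?andbF ?mulr0 //.
  by move: yS'; rewrite e setD11.
have [e|ne] := eqVneq (y |: S') S.
  rewrite -e setU11 vscaleE /kdelta xpair_eqE setU1K // eqxx jwU //.
  by rewrite fprec_irr mul1r.
rewrite andbF mulr0; case: ifP => // yS; rewrite vscaleE /kdelta xpair_eqE.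
case: (eqVneq S' _) => [e|]; rewrite ?andbF ?mulr0 //.
by move: ne; rewrite e setD1K ?eqxx.
Qed.

Section Weight.
Variable W : mop -> int.

(** The zero vector is homogeneous of every charge, and a vector whose charge no monomial can have
    is zero; most vanishing arguments below have this form. *)
Definition homog (q : int) (v : V) := forall s, v s != 0 -> charge W s = q.

Lemma homog0 q : homog q 0. Proof. by move=> s; rewrite vzeroE eqxx. Qed.

Lemma homogD q u v : homog q u -> homog q v -> homog q (u + v).
Proof.
move=> hu hv s; rewrite vaddE; have [us|/hu //] := eqVneq (u s) 0.
by rewrite us add0r => /hv.
Qed.

Lemma homogZ q a v : homog q v -> homog q (a *: v).
Proof. by move=> hv s; rewrite vscaleE mulf_eq0 negb_or => /andP[_ /hv]. Qed.

Lemma homogN q v : homog q v -> homog q (- v).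
Proof. by rewrite -scaleN1r; apply: homogZ. Qed.

Lemma homog_sum q (I : eqType) (r : seq I) (P : pred I) (f : I -> V) :
  (forall i, i \in r -> P i -> homog q (f i)) -> homog q (\sum_(i <- r | P i) f i).
Proof.
move=> h; rewrite big_seq_cond; elim/big_ind: _; [exact: homog0 | exact: homogD |].
by move=> i /andP[ir Pi]; apply: h.
Qed.

Lemma homog_kdelta s : homog (charge W s) (kdelta s).
Proof. by move=> t; rewrite /kdelta; have [->|_] := eqVneq t s; rewrite ?eqxx. Qed.

Hypothesis oddW : odd_weight W.

Lemma homog_opm q o v : homog q v -> homog (q + W o) (opm o v).
Proof.
move=> hv; case: o => s n; rewrite opmE.
  case: (mlabelP N n) => [_|k nk|k nk]; first exact: homog0.
    apply: homogZ => -[o S]; rewrite /ban /= mulf_eq0 negb_or => /andP[_ /hv].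
    rewrite charge_bump /bmode /= -nk => <-.
    by rewrite -[OB (bpartner s) _]/(conj_mop (OB s n)) oddW addrNK.
  move=> -[o S]; rewrite /bcr /=; have [_|ox] := eqVneq (o (s, k)) 0%N; rewrite ?eqxx //.
  by move=> /hv <-; rewrite -{1}(bump_occVK ox) charge_bump /bmode /= nk.
case: (mlabelP N n) => [_|k nk|k nk]; first exact: homog0.
  move=> -[o S]; rewrite /fan /=; case: ifP => [|/negbT yS]; rewrite ?eqxx //.
  rewrite mulf_eq0 negb_or => /andP[_ /hv]; rewrite charge_setU1 // /fmode /= -nk => <-.
  by rewrite -[OF (fpartner s) _]/(conj_mop (OF s n)) oddW addrNK.
move=> -[o S]; rewrite /fcr /=; case: ifP => [yS|]; rewrite ?eqxx //.
rewrite mulf_eq0 negb_or => /andP[_ /hv] <-; rewrite -{1}(setD1K yS) charge_setU1 ?setD11 //.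
by rewrite /fmode /= nk.
Qed.

End Weight.

Lemma level_ge0 q v : homog level_weight q v -> q < 0 -> v = 0.
Proof.
move=> hv q0; apply/funext => s; apply/eqP; rewrite vzeroE; apply: contraT => /hv.
by rewrite charge_level; lia.
Qed.

End Homogeneous.

(** * The level-N subspace and the matrices of operators on it *)

Section Basis.
Variables (F : numFieldType) (N : nat).
Local Notation V := (Vec F N).

Lemma bstate_inj : injective (@bstate N).
Proof.
move=> x y; rewrite /bstate => e; apply/val_inj.
case: (val x) (val y) e => o S [o' S'] [e ->].
congr (_, _); apply/ffunP => z; apply/val_inj.
by move/ffunP: e => /(_ z); rewrite !ffunE.
Qed.

Lemma bstate_level (x : Basis N) : blevel (bstate x) = N.
Proof. by apply/eqP; rewrite /bstate; case: x. Qed.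

(** Each quantum adds at least 1 to the level, so at level [N] no occupation number exceeds [N] and
    the bounded type [FState] loses no state. *)
Lemma bstate_surj (s : BState N) : blevel s = N -> exists x, bstate x = s.
Proof.
move=> sN.
have occN x : (s.1 x <= N)%N.
  have : (s.1 x <= blevel s)%N.
    by rewrite /blevel (bigD1 x) //= -!addnA (leq_trans _ (leq_addr _ _)) // leq_pmulr.
  by rewrite sN.
have e : emb ([ffun x => inord (s.1 x)], s.2) = s.
  case: s {sN} occN => o S /= oN; rewrite /emb /=; congr (_, _); apply/ffunP => x.
  by rewrite !ffunE inordK // ltnS.
have h : blevel (emb ([ffun x => inord (s.1 x)] : {ffun bsp * 'I_N -> 'I_N.+1}, s.2)) == N.
  by rewrite e sN.
by exists (exist _ (([ffun x => inord (s.1 x)], s.2) : FState N) h).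
Qed.

Lemma basis_expand v : homog level_weight N v ->
  v = \sum_i v (bstate (bof i)) *: kdelta F (bstate (bof i)) :> V.
Proof.
move=> hv; apply/funext => s; rewrite vsumE.
have [sN|sN] := eqVneq (blevel s) N.
  have [x <-] := bstate_surj sN.
  rewrite (bigD1 (enum_rank x)) //= /bof vscaleE /kdelta enum_rankK eqxx mulr1.
  rewrite big1 ?addr0 // => i ix; rewrite vscaleE /kdelta.
  rewrite (inj_eq bstate_inj) (_ : _ == _ = false) ?mulr0 //.
  by apply/negbTE; apply: contra ix => /eqP ->; rewrite enum_valK.
have -> : v s = 0.
  apply/eqP; apply: contraT => /hv; rewrite charge_level => /eqP.
  by rewrite eqz_nat (negbTE sN).
rewrite big1 // => i _; rewrite vscaleE /kdelta.
case: eqP => [e|]; rewrite ?mulr0 //.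
by move: sN; rewrite e bstate_level eqxx.
Qed.

Definition opmx (O : V -> V) : 'M[F]_(nB N) :=
  \matrix_(i, j) O (kdelta F (bstate (bof i))) (bstate (bof j)).

Definition level_preserving (O : V -> V) :=
  forall v, homog level_weight N v -> homog level_weight N (O v).

Lemma kdelta_level (x : Basis N) : homog level_weight N (kdelta F (bstate x)).
Proof.
have := @homog_kdelta F N level_weight (bstate x).
by rewrite charge_level bstate_level.
Qed.

(** Rows are images of basis vectors, so matrices multiply in the opposite order of composition. The
    first operator must preserve the level for its image to be expanded in the basis. *)
Lemma opmxM (O : V -> V) (O' : {linear V -> V}) :
  level_preserving O -> opmx O *m opmx O' = opmx (O' \o O).
Proof.
move=> hO; apply/matrixP => i j; rewrite !mxE /=.
rewrite [in RHS](basis_expand (hO _ (@kdelta_level (bof i)))) linear_sum vsumE.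
by apply: eq_bigr => k _; rewrite !mxE linearZ /= vscaleE.
Qed.

Lemma opmxP (O O' : V -> V) :
  (forall v, homog level_weight N v -> O v = O' v) -> opmx O = opmx O'.
Proof. by move=> h; apply/matrixP => i j; rewrite !mxE h //; apply: kdelta_level. Qed.

End Basis.

(** * Agreement of the modes with the action of words on states *)

Section ActLink.
Variables (R : realType) (N : nat).

Lemma opm_act o c s :
  opm o (c *: kdelta R[i] s) = (act o (c, s)).1 *: kdelta R[i] (@act R N o (c, s)).2.
Proof.
case: s => occ S; rewrite linearZ /=; case: o => [s|f] n; rewrite opmE /=.
  case: (mlabelP N n) => [_|k nk|k nk] /=; rewrite ?scaler0 ?scale0r //.
    rewrite ban_kdelta !scalerA; case: eqP => [->|_] /=.
      by rewrite mulr0 !scale0r.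
    by rewrite -mulrA; case: (s) => /=; rewrite ?mul1r ?mulN1r.
  by rewrite bcr_kdelta.
case: (mlabelP N n) => [_|k nk|k nk] /=; rewrite ?scaler0 ?scale0r //.
  by rewrite fan_kdelta; case: ifP => _ /=; rewrite ?scaler0 ?scale0r // scalerA.
by rewrite fcr_kdelta; case: ifP => _ /=; rewrite ?scaler0 ?scale0r // scalerA.
Qed.

Lemma opw_act w s : foldr (fun o => opm o) (kdelta R[i] s) w =
  (actw R w s).1 *: kdelta R[i] (@actw R N w s).2.
Proof.
rewrite /actw; elim: w => /= [|o w ->]; first by rewrite scale1r.
by rewrite opm_act -surjective_pairing.
Qed.

Lemma dmxE p pphi : dmx p pphi N =
  opmx (fun v : Vec R[i] N =>
    \sum_(t <- dterms p pphi N) t.1 *: foldr (fun o => opm o) v t.2).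
Proof.
apply/matrixP => i j; rewrite !mxE vsumE; apply: eq_bigr => t _.
rewrite vscaleE opw_act; case: (actw _ _ _) => c s /=.
by rewrite vscaleE /kdelta eq_sym; case: eqP; rewrite ?mulr1 ?mulr0.
Qed.

End ActLink.

(** * Bilinear currents and the matter Virasoro generators *)

Local Notation sp := (bsp + fsp)%type.
Definition mk (s : sp) (n : int) : mop :=
  match s with inl s => OB s n | inr f => OF f n end.
Arguments mk : simpl never.
Definition ferm (s : sp) : bool := if s is inr _ then true else false.

Local Notation sAp := (inl BAp : sp).
Local Notation sAm := (inl BAm : sp).
Local Notation sBe := (inl BBe : sp).
Local Notation sGa := (inl BGa : sp).
Local Notation sB := (inr FB : sp).
Local Notation sC := (inr FC : sp).
Local Notation sZ := (inr FZ : sp).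
Local Notation sE := (inr FE : sp).

Local Notation X s n := (@opm _ _ (mk s n)).

(** [vring] proves linear identities between vectors by evaluating at a state and calling [ring].
    The vectors are generalized first, so that evaluation does not unfold the modes in them. *)
Ltac vatoms gen t :=
  lazymatch t with
  | @GRing.add _ ?a ?b => vatoms gen a; vatoms gen b
  | @GRing.opp _ ?a => vatoms gen a
  | @GRing.scale _ _ _ ?a => vatoms gen a
  | @GRing.zero _ => idtac
  | _ => tryif is_var t then idtac else gen t
  end.
Ltac vring_with gen :=
  lazymatch goal with |- ?l = ?r => vatoms gen l; vatoms gen r end;
  let s := fresh "s" in
  apply/funext => s; rewrite !vE;
  repeat match goal with |- context [?f s] => generalize (f s); intro end;
  rewrite ?(rmorphB, rmorphD, rmorphN, rmorphM) /=; ring.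
Ltac vring :=
  first [ vring_with ltac:(fun t => generalize t; intro)
        | vring_with ltac:(fun t => let x := fresh "x" in set x := t; move: x => x) ].

Section Currents.
Variables (F : numFieldType) (N : nat).
Local Notation V := (Vec F N).
Local Notation I := (nzidx N).
Implicit Types (v : V) (s t : sp) (n m k : int).

Definition br s t n : F :=
  match s, t with
  | inl s, inl t => bbr F s t n | inr f, inr g => (fbr f g)%:R | _, _ => 0
  end.
Definition sg s t : F := if ferm s && ferm t then -1 else 1.

Lemma sg_sqr s t : sg s t * sg s t = 1.
Proof. by rewrite /sg; case: ifP => _; ring. Qed.

Lemma XC s t m n v : X s m (X t n v) =
  sg s t *: X t n (X s m v) + (if (m + n == 0) && (m \in I) then br s t m else 0) *: v.
Proof.
rewrite opmC; congr (_ *: _ + _ *: _); rewrite /mk /sg /br.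
  by case: s; case: t.
by case: s; case: t => * //=; case: ifP.
Qed.

Lemma XC0 s t m n v : (forall j, br s t j = 0) -> X s m (X t n v) = sg s t *: X t n (X s m v).
Proof. by move=> st; rewrite XC st if_same scale0r addr0. Qed.

Lemma XD s n u v : X s n (u + v) = X s n u + X s n v.
Proof. exact: linearD. Qed.
Lemma XN s n v : X s n (- v) = - X s n v.
Proof. exact: linearN. Qed.
Lemma XZ s n a v : X s n (a *: v) = a *: X s n v.
Proof. by rewrite linearZ. Qed.
Lemma X0 s n : X s n 0 = 0 :> V.
Proof. exact: linear0. Qed.
Lemma Xsum s n (A : Type) (r : seq A) (P : pred A) (f : A -> V) :
  X s n (\sum_(i <- r | P i) f i) = \sum_(i <- r | P i) X s n (f i).
Proof. exact: linear_sum. Qed.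
Definition Xlin := (XD, XN, XZ, X0).

Lemma X_out s n v : n \notin I -> X s n v = 0.
Proof. by move=> nI; apply: opm_out; case: s. Qed.

Lemma nzidxN n : (- n \in I) = (n \in I).
Proof. by rewrite !mem_nzidx oppr_eq0 abszN. Qed.

Lemma nzidx_neq0 n : n \in I -> n != 0.
Proof. by rewrite mem_nzidx => /andP[]. Qed.

Lemma sum_delta (G : int -> V) j :
  \sum_(m <- I) (if m == j then G m else 0) = if j \in I then G j else 0.
Proof.
have [jI|jI] := boolP (j \in I).
  rewrite (bigD1_seq j) ?uniq_nzidx //= eqxx big1 ?addr0 // => m mj.
  by rewrite (negbTE mj).
rewrite big_seq big1 // => m mI; case: eqP => // mj.
by move: jI; rewrite -mj mI.
Qed.

(** The n-th mode of a bilinear current. For n nonzero its two factors have no central term between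
    them, so no normal ordering is needed. *)
Definition J (mu : int -> F) s t n v : V :=
  locked (\sum_(m <- I) mu m *: X s (- m) (X t (n + m) v)).

Lemma J_linear mu s t n : linear (J mu s t n).
Proof.
move=> a u v; rewrite /J -!lock scaler_sumr -big_split; apply: eq_bigr => m _ /=.
by rewrite !Xlin scalerDr !scalerA mulrC.
Qed.
HB.instance Definition _ mu s t n :=
  GRing.isLinear.Build F V V _ (J mu s t n) (J_linear mu s t n).

Lemma JC mu s t r n k v :
  (forall j, br s r j = 0) -> (forall j, br t r j = 0) -> ferm s = ferm t ->
  J mu s t n (X r k v) = X r k (J mu s t n v).
Proof.
move=> sr tr st; rewrite /J -!lock Xsum; apply: eq_bigr => m _ /=.
rewrite XZ (XC0 _ _ _ tr) XZ (XC0 _ _ _ sr) !scalerA.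
by congr (_ *: _); rewrite /sg st; case: ifP => _; ring.
Qed.

(** Only [t] contracts with the new mode, which selects the summand m = -(n+k). If n + k is outside
    the truncation that summand is missing, but then [X s (n + k)] is zero too, so the relation is
    exact. In [JC2] the factor [s] contracts and selects m = k. *)
Lemma JC1 mu s t n k v : n \in I -> k \in I ->
  (forall j, br s s j = 0) -> ferm s = ferm t ->
  J mu s t n (X s k v) =
    X s k (J mu s t n v) + (mu (- (n + k)) * br t s (- k)) *: X s (n + k) v.
Proof.
move=> nI kI ss st; rewrite /J -!lock Xsum.
rewrite (_ : _ *: X s (n + k) v =
  \sum_(m <- I) if m == - (n + k) then (mu m * br t s (- k)) *: X s (- m) v else 0).
  rewrite -big_split; apply: eq_bigr => m _ /=.
  rewrite (XC t s (n + m)) !Xlin scalerDr (XC0 (- m) k _ ss) !scalerA; congr (_ + _).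
    by congr (_ *: _); rewrite /sg st; case: ifP => _; ring.
  case: (eqVneq m (- (n + k))) => [->|ne].
    rewrite (_ : n - (n + k) = - k) 1?[- k + k]addrC ?subrr; last by ring.
    by rewrite nzidxN kI eqxx /=; congr (_ *: _); ring.
  rewrite (_ : (n + m + k == 0) = false) ?mulr0 ?mul0r ?scale0r //.
  by move/eqP: ne => ne; apply/eqP; lia.
rewrite sum_delta opprK nzidxN.
by case: ifP => // /negbT h; rewrite X_out ?scaler0.
Qed.

Lemma JC2 mu s t n k v : n \in I -> k \in I ->
  (forall j, br t t j = 0) -> ferm s = ferm t ->
  J mu s t n (X t k v) =
    X t k (J mu s t n v) + (mu k * sg t t * br s t (- k)) *: X t (n + k) v.
Proof.
move=> nI kI tt st; rewrite /J -!lock Xsum.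
rewrite (_ : _ *: X t (n + k) v =
  \sum_(m <- I) if m == k then (mu m * sg t t * br s t (- k)) *: X t (n + m) v else 0).
  rewrite -big_split; apply: eq_bigr => m _ /=.
  rewrite (XC0 (n + m) k _ tt) XZ (XC s t (- m) k) !Xlin !scalerDr !scalerA; congr (_ + _).
    by congr (_ *: _); rewrite /sg st; case: ifP => _; ring.
  have [->|ne] := eqVneq m k; first by rewrite addNr eqxx nzidxN kI /=; congr (_ *: _); ring.
  rewrite (_ : (- m + k == 0) = false) ?mulr0 ?mul0r ?scale0r //.
  by apply/negbTE; move: ne; rewrite addrC subr_eq0 eq_sym.
by rewrite sum_delta kI.
Qed.

Variables Pp Pm : int -> F.

(** The matter factor of c_{-n} in d: a Virasoro generator whose linear terms hold the zero modes
    p^+ and p^- together with the background charge. *)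
Definition Lm n v : V := locked (
  Pp n *: X sAm n v + Pm n *: X sAp n v
  + (J (fun=> 1) sAp sAm n v + J (fun m => m%:~R) sZ sE n v
     + J (fun m => m%:~R) sBe sGa n v)).

Lemma Lm_linear n : linear (Lm n).
Proof.
move=> a u v; rewrite /Lm -!lock !Xlin !J_linear; vring.
Qed.
HB.instance Definition _ n := GRing.isLinear.Build F V V _ (Lm n) (Lm_linear n).

(** A primary field of conformal weight h obeys [L_n, x_k] = ((h-1)n - k) x_{n+k}. Here h = 1 for
    alpha^+, alpha^-, gamma and eta~, and h = 0 for beta and zeta. The linear terms of [Lm] add the
    central term of alpha^+ and alpha^-. *)
Lemma Lm_Ap n k v : n \in I -> k \in I -> Lm n (X sAp k v) =
  X sAp k (Lm n v) + (- k)%:~R *: X sAp (n + k) v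
  + (if n + k == 0 then n%:~R * Pp n else 0) *: v.
Proof.
move=> nI kI; rewrite /Lm -!lock JC1 // !(JC _ _ _ (r := sAp)) //.
rewrite (@XC sAm sAp) (@XC0 sAp sAp) // !Xlin nI andbT.
by rewrite /sg /= rmorphN /=; case: ifP => _; vring.
Qed.

Lemma Lm_Am n k v : n \in I -> k \in I -> Lm n (X sAm k v) =
  X sAm k (Lm n v) + (- k)%:~R *: X sAm (n + k) v
  + (if n + k == 0 then n%:~R * Pm n else 0) *: v.
Proof.
move=> nI kI; rewrite /Lm -!lock JC2 // !(JC _ _ _ (r := sAm)) //.
rewrite (@XC sAp sAm) (@XC0 sAm sAm) // !Xlin nI andbT.
by rewrite /sg /= rmorphN /=; case: ifP => _; vring.
Qed.

Lemma Lm_Be n k v : n \in I -> k \in I -> Lm n (X sBe k v) =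
  X sBe k (Lm n v) + (- (n + k))%:~R *: X sBe (n + k) v.
Proof.
move=> nI kI; rewrite /Lm -!lock JC1 // !(JC _ _ _ (r := sBe)) //.
rewrite (@XC0 sAp sBe) // (@XC0 sAm sBe) // !Xlin.
by rewrite /sg /=; vring.
Qed.

Lemma Lm_Ga n k v : n \in I -> k \in I -> Lm n (X sGa k v) =
  X sGa k (Lm n v) + (- k)%:~R *: X sGa (n + k) v.
Proof.
move=> nI kI; rewrite /Lm -!lock JC2 // !(JC _ _ _ (r := sGa)) //.
rewrite (@XC0 sAp sGa) // (@XC0 sAm sGa) // !Xlin.
by rewrite /sg /= rmorphN /=; vring.
Qed.

Lemma Lm_Z n k v : n \in I -> k \in I -> Lm n (X sZ k v) =
  X sZ k (Lm n v) + (- (n + k))%:~R *: X sZ (n + k) v.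
Proof.
move=> nI kI; rewrite /Lm -!lock JC1 // !(JC _ _ _ (r := sZ)) //.
rewrite (@XC0 sAp sZ) // (@XC0 sAm sZ) // !Xlin.
by rewrite /sg /=; vring.
Qed.

Lemma Lm_E n k v : n \in I -> k \in I -> Lm n (X sE k v) =
  X sE k (Lm n v) + (- k)%:~R *: X sE (n + k) v.
Proof.
move=> nI kI; rewrite /Lm -!lock JC2 // !(JC _ _ _ (r := sE)) //.
rewrite (@XC0 sAp sE) // (@XC0 sAm sE) // !Xlin.
by rewrite /sg /= rmorphN /=; vring.
Qed.

Lemma Lm_C n k v : Lm n (X sC k v) = X sC k (Lm n v).
Proof.
rewrite /Lm -!lock !(JC _ _ _ (r := sC)) //.
rewrite (@XC0 sAp sC) // (@XC0 sAm sC) // !Xlin.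
by rewrite /sg /=; vring.
Qed.

Lemma Lm_B n k v : Lm n (X sB k v) = X sB k (Lm n v).
Proof.
rewrite /Lm -!lock !(JC _ _ _ (r := sB)) //.
rewrite (@XC0 sAp sB) // (@XC0 sAm sB) // !Xlin.
by rewrite /sg /=; vring.
Qed.

End Currents.

(** * The differential and its supercommutators with single modes *)

Section Differential.
Variables (F : numFieldType) (N : nat) (Pp Pm : int -> F).
Local Notation V := (Vec F N).
Local Notation I := (nzidx N).
Local Notation Ln := (@Lm F N Pp Pm).
Local Notation br := (br F).
Local Notation sg := (sg F).
Implicit Types (v : V) (s t : sp) (n m k : int).


Definition Qop v : V := locked (\sum_(n <- I) X sE n (X sBe (- n) v)).

Lemma Qop_linear : linear Qop.
Proof.
move=> a u v; rewrite /Qop -!lock scaler_sumr -big_split; apply: eq_bigr => m _ /=.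
by rewrite !Xlin.
Qed.
HB.instance Definition _ := GRing.isLinear.Build F V V _ Qop Qop_linear.

Lemma Qop_com t k v : (forall j, br sE t j = 0) -> (forall j, br sBe t j = 0) ->
  Qop (X t k v) = sg sE t *: X t k (Qop v).
Proof.
move=> Et Bt; rewrite /Qop -!lock Xsum scaler_sumr; apply: eq_bigr => n _ /=.
rewrite (XC0 (- n) k _ Bt) !Xlin (XC0 n k _ Et) scalerA; congr (_ *: _).
by rewrite /sg /=; ring.
Qed.

Lemma Qop_Ga k v : k \in I -> Qop (X sGa k v) = X sGa k (Qop v) - X sE k v.
Proof.
move=> kI; rewrite /Qop -!lock Xsum.
rewrite (_ : - X sE k v = \sum_(n <- I) if n == k then - X sE n v else 0).
  rewrite -big_split; apply: eq_bigr => n _ /=.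
  rewrite (XC sBe sGa (- n) k) !Xlin (@XC0 F N sE sGa) //.
  rewrite nzidxN addrC (addrC (- n)) subr_eq0 eq_sym.
  have [->|_] := eqVneq n k; rewrite /sg /= ?kI; vring.
by rewrite sum_delta kI.
Qed.

Lemma Qop_Z k v : k \in I -> Qop (X sZ k v) = - X sZ k (Qop v) + X sBe k v.
Proof.
move=> kI; rewrite /Qop -!lock Xsum -sumrN.
rewrite (_ : X sBe k v = \sum_(n <- I) if n == - k then X sBe (- n) v else 0).
  rewrite -big_split; apply: eq_bigr => n _ /=.
  rewrite (@XC0 F N sBe sZ) // !Xlin (XC sE sZ n k) addr_eq0.
  have [->|_] := eqVneq n (- k); rewrite /sg /= ?nzidxN ?kI; vring.
by rewrite sum_delta nzidxN kI opprK.
Qed.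


Definition gh v : V := locked (\sum_(n <- I) \sum_(m <- I)
  ((m - n)%:~R / 2) *: X sC (- n) (X sC (- m) (X sB (n + m) v))).

Lemma gh_linear : linear gh.
Proof.
move=> a u v; rewrite /gh -!lock scaler_sumr -big_split; apply: eq_bigr => n _ /=.
rewrite scaler_sumr -big_split; apply: eq_bigr => m _ /=.
by rewrite !Xlin scalerDr !scalerA [a * _]mulrC.
Qed.
HB.instance Definition _ := GRing.isLinear.Build F V V _ gh gh_linear.

Lemma gh_com t k v : (forall j, br sC t j = 0) -> (forall j, br sB t j = 0) ->
  gh (X t k v) = sg sC t *: X t k (gh v).
Proof.
move=> Ct Bt; rewrite /gh -!lock Xsum scaler_sumr; apply: eq_bigr => n _ /=.
rewrite Xsum scaler_sumr; apply: eq_bigr => m _ /=.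
rewrite (XC0 (n + m) k _ Bt) !Xlin (XC0 (- m) k _ Ct) !Xlin.
rewrite (XC0 (- n) k _ Ct) !scalerA; congr (_ *: _); rewrite /sg /=.
by case: ifP => _; ring.
Qed.

(** The anticommutator of d with c_k; it is purely ghost, as only the b~ of the cubic term contracts
    with c_k. *)
Definition dC k v : V := locked (\sum_(n <- I) \sum_(m <- I)
  if n + m == - k then ((m - n)%:~R / 2) *: X sC (- n) (X sC (- m) v) else 0).

Lemma gh_C k v : k \in I -> gh (X sC k v) = - X sC k (gh v) + dC k v.
Proof.
move=> kI; rewrite /gh /dC -!lock Xsum -sumrN -big_split; apply: eq_bigr => n _ /=.
rewrite Xsum -sumrN -big_split; apply: eq_bigr => m _ /=.
rewrite (XC sB sC (n + m) k) !Xlin (@XC0 F N sC sC (- m) k) //.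
rewrite !Xlin (@XC0 F N sC sC (- n) k) // addr_eq0.
by have [->|_] := eqVneq (n + m) (- k); rewrite /sg /= ?nzidxN ?kI; vring.
Qed.

(** Either c of the cubic term can contract with b~_k. The coefficient and the product of the two c
    are both antisymmetric, so the contractions agree and absorb the factor 1/2; the result is the
    ghost Virasoro generator. *)
Lemma gh_B k v : k \in I ->
  gh (X sB k v) = - X sB k (gh v) + J (fun m => (m - k)%:~R) sC sB k v.
Proof.
move=> kI; rewrite /gh -!lock Xsum -sumrN.
have -> : J (fun m => (m - k)%:~R) sC sB k v =
    \sum_(n <- I) \sum_(m <- I)
      ((if m == k then ((n - m)%:~R / 2) *: X sC (- n) (X sB (n + m) v) else 0) +
       (if n == k then ((m - n)%:~R / 2) *: X sC (- m) (X sB (n + m) v) else 0)).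
  under eq_bigr => n _ do rewrite big_split /= sum_delta kI.
  rewrite big_split /= [Y in _ + Y]exchange_big /=.
  under [Y in _ + Y]eq_bigr => n _ do rewrite sum_delta kI.
  rewrite /J -lock -big_split; apply: eq_bigr => m _ /=.
  rewrite [m + k]addrC -scalerDl; congr (_ *: _).
  by field.
rewrite -big_split; apply: eq_bigr => n _ /=.
rewrite Xsum -sumrN -big_split; apply: eq_bigr => m _ /=.
rewrite (@XC0 F N sB sB) // !Xlin (XC sC sB (- m) k) !Xlin.
rewrite (XC sC sB (- n) k) !nzidxN ![- _ + k]addrC !subr_eq0 ![k == _]eq_sym.
by have [->|_] := eqVneq n k; have [->|_] := eqVneq m k; rewrite /sg /= ?kI; vring.
Qed.


Definition cL v : V := locked (\sum_(n <- I) X sC (- n) (Ln n v)).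

Lemma cL_linear : linear cL.
Proof.
move=> a u v; rewrite /cL -3!lock scaler_sumr -big_split; apply: eq_bigr => n _ /=.
by rewrite !linearP.
Qed.
HB.instance Definition _ := GRing.isLinear.Build F V V _ cL cL_linear.

Lemma cL_C k v : cL (X sC k v) = - X sC k (cL v).
Proof.
rewrite /cL -2!lock Xsum -sumrN; apply: eq_bigr => n _ /=.
by rewrite Lm_C XC0 // /sg /= scaleN1r.
Qed.

Lemma cL_B k v : k \in I -> cL (X sB k v) = - X sB k (cL v) + Ln k v.
Proof.
move=> kI; rewrite /cL -2!lock Xsum -sumrN.
rewrite (_ : Ln k v = \sum_(n <- I) if n == k then Ln n v else 0).
  rewrite -big_split; apply: eq_bigr => n _ /=.
  rewrite Lm_B (XC sC sB (- n) k) nzidxN [- _ + k]addrC subr_eq0 eq_sym.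
  by have [->|_] := eqVneq n k; rewrite /sg /= ?kI; vring.
by rewrite sum_delta kI.
Qed.

Lemma cL_matter t w kap k v : (forall j, br sC t j = 0) -> k \in I ->
  (forall n, n \in I -> Ln n (X t k v) =
     X t k (Ln n v) + (w * n - k)%:~R *: X t (n + k) v
     + (if n + k == 0 then kap n else 0) *: v) ->
  cL (X t k v) = sg sC t *: X t k (cL v)
    + \sum_(n <- I) (w * n - k)%:~R *: X sC (- n) (X t (n + k) v)
    + kap (- k) *: X sC k v.
Proof.
move=> Ct kI hL; rewrite /cL -2!lock Xsum.
rewrite (_ : kap _ *: _ = \sum_(n <- I) if n == - k then kap n *: X sC (- n) v else 0).
  rewrite scaler_sumr -!big_split !big_seq; apply: eq_bigr => n nI /=.
  rewrite hL // !Xlin.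
  rewrite (XC0 (- n) k _ Ct) addr_eq0.
  by case: ifP => _; vring.
by rewrite sum_delta nzidxN kI opprK.
Qed.

Definition dop v : V := locked (Qop v + cL v + gh v).

Lemma dop_linear : linear dop.
Proof. by move=> a u v; rewrite /dop -!lock !linearP /=; vring. Qed.
HB.instance Definition _ := GRing.isLinear.Build F V V _ dop dop_linear.

Lemma dop_C k v : k \in I -> dop (X sC k v) = - X sC k (dop v) + dC k v.
Proof.
move=> kI; rewrite /dop -!lock gh_C // Qop_com // cL_C !Xlin.
by rewrite /sg /=; vring.
Qed.

(** The total Virasoro generator, matter plus ghost, in its role as {d, b~_n}. *)
Definition Ltot n v : V := locked (Ln n v + J (fun m => (m - n)%:~R) sC sB n v).

Lemma dop_B k v : k \in I -> dop (X sB k v) = - X sB k (dop v) + Ltot k v.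
Proof.
move=> kI; rewrite /dop /Ltot -!lock gh_B // Qop_com // cL_B // !Xlin.
by rewrite /sg /=; vring.
Qed.

(* w encodes the conformal weight w+1, kap the anomalous shift of alpha^+-,
   and y, t' the image of t under the term eta beta *)
Definition derives t (w : int) (kap : int -> F) (y : F) t' :=
  forall k v, k \in I -> dop (X t k v) =
    sg sC t *: X t k (dop v)
    + \sum_(n <- I) (w * n - k)%:~R *: X sC (- n) (X t (n + k) v)
    + kap (- k) *: X sC k v + y *: X t' k v.

Lemma dop_matter t w kap y t' : (forall j, br sC t j = 0) -> (forall j, br sB t j = 0) ->
  (forall n k v, n \in I -> k \in I -> Ln n (X t k v) =
     X t k (Ln n v) + (w * n - k)%:~R *: X t (n + k) v
     + (if n + k == 0 then kap n else 0) *: v) ->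
  (forall k v, k \in I -> Qop (X t k v) = sg sC t *: X t k (Qop v) + y *: X t' k v) ->
  derives t w kap y t'.
Proof.
move=> Ct Bt hL hQ k v kI; rewrite /dop -!lock gh_com // hQ // (cL_matter (w := w) (kap := kap)) //.
  by rewrite !Xlin; vring.
by move=> n nI; apply: hL.
Qed.

End Differential.

(** * The commutator of d^2 with a matter mode *)

Section SquareMatter.
Variables (F : numFieldType) (N : nat) (Pp Pm : int -> F).
Local Notation V := (Vec F N).
Local Notation I := (nzidx N).
Local Notation d := (@dop F N Pp Pm).
Local Notation br := (br F).
Local Notation sg := (sg F).
Local Notation hlev := (@homog F N level_weight).
Implicit Types (v : V) (s t : sp) (n m k : int).

Lemma dopD u v : d (u + v) = d u + d v. Proof. exact: linearD. Qed.
Lemma dopN v : d (- v) = - d v. Proof. exact: linearN. Qed.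
Lemma dopZ a v : d (a *: v) = a *: d v. Proof. by rewrite linearZ. Qed.
Lemma dop_zero : d 0 = 0. Proof. exact: linear0. Qed.
Lemma dopsum (A : Type) (r : seq A) (P : pred A) (f : A -> V) :
  d (\sum_(i <- r | P i) f i) = \sum_(i <- r | P i) d (f i).
Proof. exact: linear_sum. Qed.
Definition doplin := (dopD, dopN, dopZ, dop_zero).

(** With zero modes restored, the BRST operator would read c_0 L_0 - M b_0 + d, and its nilpotency
    would give d^2 = M L_0. *)
Definition M v : V := locked (\sum_(n <- I) n%:~R *: X sC (- n) (X sC n v)).

Lemma CC n m v : X sC n (X sC m v) = - X sC m (X sC n v).
Proof. by rewrite XC0 // /sg /= scaleN1r. Qed.

Lemma homog_X s n l v : hlev l v -> hlev (l - n) (X s n v).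
Proof. by case: s => s hv; apply: (homog_opm odd_level). Qed.

Lemma X_low s n l v : hlev l v -> l < n -> X s n v = 0.
Proof. by move=> hv ln; apply: (level_ge0 (@homog_X s n l v hv)); rewrite subr_lt0. Qed.

Lemma XX_low s t n m l v : hlev l v -> l < n + m -> X s n (X t m v) = 0.
Proof. by move=> hv ln; apply: (X_low _ (@homog_X t m l v hv)); rewrite ltrBlDr. Qed.

Lemma self_opp_eq0 v : v = - v -> v = 0.
Proof.
move=> /eqP; rewrite -addr_eq0 -mulr2n -scaler_nat scaler_eq0 pnatr_eq0 /=.
by move/eqP.
Qed.

Lemma antisym_sum (G : int -> int -> V) : (forall n m, G n m = - G m n) ->
  \sum_(n <- I) \sum_(m <- I) G n m = 0.
Proof.
move=> hG; apply: self_opp_eq0; rewrite {1}exchange_big /= -sumrN.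
by apply: eq_bigr => n _; rewrite -sumrN; apply: eq_bigr => m _; rewrite hG.
Qed.

Lemma sum_dC (a : int -> F) (x : int -> V) :
  \sum_(j <- I) a j *: dC (- j) (x j) =
  \sum_(n <- I) \sum_(m <- I) if n + m \in I then
    (a (n + m) * ((m - n)%:~R / 2)) *: X sC (- n) (X sC (- m) (x (n + m))) else 0.
Proof.
rewrite (eq_bigr (fun j => \sum_(n <- I) \sum_(m <- I) if j == n + m then
  (a j * ((m - n)%:~R / 2)) *: X sC (- n) (X sC (- m) (x j)) else 0)).
  rewrite exchange_big /=; apply: eq_bigr => n _.
  by rewrite exchange_big /=; apply: eq_bigr => m _; rewrite sum_delta.
move=> j _; rewrite /dC -lock scaler_sumr; apply: eq_bigr => n _.
rewrite scaler_sumr; apply: eq_bigr => m _; rewrite opprK eq_sym.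
by case: ifP; rewrite ?scaler0 // scalerA.
Qed.

Section Matter.
Variables (t : sp) (w : int) (kap : int -> F) (y : F) (t' : sp).
Hypothesis Ct : forall j, br sC t j = 0.
Hypothesis hd : derives N Pp Pm t w kap y t'.
(** The factor [y] makes this vacuous for y = 0. Otherwise [t'] follows the law of [t] with the
    opposite sign and without central shift. *)
Hypothesis hd' : forall k v, k \in I -> y *: d (X t' k v) =
  y *: (- sg sC t *: X t' k (d v)
        + \sum_(n <- I) (w * n - k)%:~R *: X sC (- n) (X t' (n + k) v)).
Hypothesis ww : w * (w + 1) = 0.
Hypothesis skap : forall n, sg sC t * kap n = kap n.
Hypothesis hkap : forall n m, kap (n + m) * (m - n)%:~R =
  (w * n + n + m)%:~R * kap m - (w * m + n + m)%:~R * kap n.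

Let T k v n m := X sC (- n) (X sC (- m) (X t (n + m + k) v)).

Let TC k v n m : T k v n m = - T k v m n.
Proof. by rewrite /T CC [m + n]addrC. Qed.

(** For n + m > N the mode of [t] lowers the level by more than l, because l - k <= N; for n + m <
    -N the two c do so, because l <= N. *)
Let T_nm k v l n m : hlev l v -> l <= N%:Z -> l - k <= N%:Z ->
  n + m != 0 -> n + m \notin I -> T k v n m = 0.
Proof.
move=> hv lN lkN nm0; rewrite mem_nzidx nm0 /= => nmN; rewrite /T.
have [nm|nm] := leP 0 (n + m).
  by rewrite (X_low _ hv) ?X0 //; lia.
rewrite (XC0 (- m) _ _ Ct) XZ (XC0 (- n) _ _ Ct) (XX_low _ _ hv) ?X0 ?scaler0 //.
lia.
Qed.

Let T_nk k v l n m : hlev l v -> l <= N%:Z -> l - k <= N%:Z ->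
  n + k != 0 -> n + k \notin I -> T k v n m = 0.
Proof.
move=> hv lN lkN nk0; rewrite mem_nzidx nk0 /= => nkN; rewrite /T.
have [nk|nk] := leP 0 (n + k).
  by rewrite (XX_low _ _ hv) ?X0 //; lia.
rewrite CC (XC0 (- n) _ _ Ct) (X_low _ hv) ?X0 ?scaler0 ?X0 ?oppr0 //.
lia.
Qed.

(** Over all n and m the products c_{-n} c_{-m} t_{n+m+k} would sum to zero, being antisymmetric
    against a symmetric coefficient. The term from [dC] lacks the diagonal n + m = 0, where its
    coefficient is k n, and this gap is -k M t_k. The bounds on l dispose of the terms lost to the
    truncation. *)
Lemma matter_quadratic k v l : hlev l v -> l <= N%:Z -> l - k <= N%:Z ->
  \sum_(n <- I) (w * n - k)%:~R *: dC (- n) (X t (n + k) v)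
  - \sum_(n <- I) (w * n - k)%:~R *: X sC (- n)
      (if n + k \in I then
         \sum_(m <- I) (w * m - (n + k))%:~R *: X sC (- m) (X t (m + (n + k)) v)
       else 0)
  = - (k%:~R *: M (X t k v)).
Proof.
move=> hv lN lkN.
rewrite (sum_dC (fun j => (w * j - k)%:~R) (fun j => X t (j + k) v)).
apply/eqP; rewrite -subr_eq0 opprK; apply/eqP.
have -> : M (X t k v) = \sum_(n <- I) \sum_(m <- I)
    if m == - n then n%:~R *: T k v n m else 0.
  rewrite /M -lock !big_seq; apply: eq_bigr => n nI.
  by rewrite sum_delta nzidxN nI /T subrr add0r opprK.
pose A0 n m : F := (w * (n + m) - k)%:~R * ((m - n)%:~R / 2)
                 - (w * n - k)%:~R * (w * m - (n + k))%:~R.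
rewrite -[RHS](antisym_sum (G := fun n m => A0 n m *: T k v n m)); last first.
  move=> n m; rewrite TC scalerN; congr (- (_ *: _)).
  by rewrite /A0 ?(rmorphB, rmorphD, rmorphN, rmorphM) /=; field.
rewrite scaler_sumr -sumrN -!big_split; apply: eq_bigr => n _ /=.
have -> : (w * n - k)%:~R *: X sC (- n) (if n + k \in I then
     \sum_(m <- I) (w * m - (n + k))%:~R *: X sC (- m) (X t (m + (n + k)) v) else 0)
  = \sum_(m <- I) if n + k \in I then
     ((w * n - k)%:~R * (w * m - (n + k))%:~R) *: T k v n m else 0.
  case: ifP => _; last by rewrite X0 scaler0 big1.
  rewrite Xsum scaler_sumr; apply: eq_bigr => m _.
  by rewrite XZ scalerA /T addrA [m + n]addrC.
rewrite scaler_sumr -sumrN -!big_split; apply: eq_bigr => m _ /=.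
rewrite -/(T k v n m); have [->|T0] := eqVneq (T k v n m) 0.
  by do 3 case: ifP => _; rewrite ?scaler0 ?oppr0 ?addr0.
have -> : (n + m \in I) = (m != - n).
  have [->|nm] := eqVneq m (- n); first by rewrite subrr mem_nzidx eqxx.
  apply: contraNT T0 => nmI; apply/eqP; apply: (T_nm hv) => //.
  by rewrite addrC addr_eq0.
have -> : (if n + k \in I then ((w * n - k)%:~R * (w * m - (n + k))%:~R) *: T k v n m
           else 0) = ((w * n - k)%:~R * (w * m - (n + k))%:~R) *: T k v n m.
  case: (boolP (n + k \in I)) => // nkI; have [nk|nk] := eqVneq (n + k) 0.
    (* At n + k = 0 the absent zero mode of [t] would enter with coefficient n m w (w+1), which is 0
       for the conformal weights 0 and 1. *)
    rewrite -intrM (_ : _ * _ = 0) ?scale0r //.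
    have -> : k = - n by lia.
    transitivity (n * m * (w * (w + 1))); last by rewrite ww mulr0.
    by ring.
  by move: T0; rewrite (T_nk _ hv) ?eqxx.
rewrite /A0; have [->|_] := eqVneq m (- n) => /=.
  rewrite add0r -scaleNr scalerA -scalerDl; congr (_ *: _).
  by rewrite ?(rmorphB, rmorphD, rmorphN, rmorphM) /=; field.
by rewrite scaler0 addr0 -scaleNr -scalerDl.
Qed.

(** [hkap] is the central part of the Jacobi identity for L_n, L_m and t_{-(n+m)}. It makes the
    coefficient of c_{-n} c_{-m} symmetric in n and m, so the sum cancels. *)
Lemma matter_linear k v : k \in I ->
  kap (- k) *: dC k v
  - \sum_(n <- I) ((w * n - k)%:~R * kap (- (n + k))) *: X sC (- n) (X sC (n + k) v) = 0.
Proof.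
move=> kI.
rewrite -[RHS](antisym_sum (G := fun n m => if n + m == - k then
   (kap (- k) * ((m - n)%:~R / 2) - (w * n - k)%:~R * kap m) *:
     X sC (- n) (X sC (- m) v) else 0)); last first.
  move=> n m; rewrite [m + n]addrC; case: eqP => [nm|]; last by rewrite oppr0.
  rewrite CC scalerN; congr (- (_ *: _)).
  have -> : k = - (n + m) by rewrite nm opprK.
  have := hkap n m; rewrite opprK ?(rmorphB, rmorphD, rmorphN, rmorphM) /= => h.
  apply/eqP; rewrite -subr_eq0; apply/eqP.
  by rewrite -[RHS](subrr (kap (n + m) * (m%:~R - n%:~R))) {2}h; field.
rewrite /dC -lock scaler_sumr -sumrN -big_split; apply: eq_bigr => n _ /=.
have -> : ((w * n - k)%:~R * kap (- (n + k))) *: X sC (- n) (X sC (n + k) v) =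
  \sum_(m <- I) if m == - (n + k) then
    ((w * n - k)%:~R * kap m) *: X sC (- n) (X sC (- m) v) else 0.
  rewrite sum_delta opprK nzidxN; case: ifP => // /negbT h.
  by rewrite (X_out _ v) // X0 scaler0.
rewrite scaler_sumr -sumrN -big_split; apply: eq_bigr => m _ /=.
have -> : (m == - (n + k)) = (n + m == - k) by lia.
by case: ifP => _; rewrite ?scaler0 ?subrr // scalerA -scaleNr -scalerDl.
Qed.

Lemma dop2_matter k v l : k \in I -> hlev l v -> l <= N%:Z -> l - k <= N%:Z ->
  d (d (X t k v)) = X t k (d (d v)) - k%:~R *: M (X t k v).
Proof.
move=> kI hv lN lkN.
have hdA j : d (X t j v) = sg sC t *: X t j (d v)
    + (if j \in I then \sum_(m <- I) (w * m - j)%:~R *: X sC (- m) (X t (m + j) v) else 0)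
    + (if j \in I then kap (- j) *: X sC j v + y *: X t' j v else 0).
  case: (boolP (j \in I)) => jI; first by rewrite hd // -!addrA.
  by rewrite !X_out // dop_zero scaler0 !addr0.
have dS : d (\sum_(n <- I) (w * n - k)%:~R *: X sC (- n) (X t (n + k) v)) =
   - sg sC t *: (\sum_(n <- I) (w * n - k)%:~R *: X sC (- n) (X t (n + k) (d v)))
   - \sum_(n <- I) (w * n - k)%:~R *: X sC (- n)
      (if n + k \in I then
         \sum_(m <- I) (w * m - (n + k))%:~R *: X sC (- m) (X t (m + (n + k)) v)
       else 0)
   - \sum_(n <- I) ((w * n - k)%:~R * kap (- (n + k))) *: X sC (- n) (X sC (n + k) v)
   - y *: (\sum_(n <- I) (w * n - k)%:~R *: X sC (- n) (X t' (n + k) v))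
   + \sum_(n <- I) (w * n - k)%:~R *: dC (- n) (X t (n + k) v).
  rewrite dopsum !scaler_sumr -!sumrN -!big_split !big_seq; apply: eq_bigr => n nI /=.
  rewrite dopZ dop_C ?nzidxN // hdA; set S := (if _ then \sum_(_ <- _) _ else _).
  case: (boolP (n + k \in I)) => nkI; first by rewrite !Xlin; vring.
  by rewrite !(X_out _ _ nkI) !Xlin; vring.
rewrite hd // !doplin dS (hd (d v) kI) dop_C // hd' //.
have q := matter_quadratic hv lN lkN.
have lin := matter_linear v kI.
rewrite !scalerDr !scalerA sg_sqr skap scale1r.
move: q lin.
set a1 := \sum_(_ <- _) _; set a2 := \sum_(_ <- _) _; set a3 := \sum_(_ <- _) _.
set a4 := \sum_(_ <- _) _; set a5 := \sum_(_ <- _) _.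
move=> q lin.
have -> : X t k (d (d v)) - k%:~R *: M (X t k v) =
  X t k (d (d v)) + (a1 - a2) + (kap (- k) *: dC k v - a3).
  by rewrite q lin addr0.
by vring.
Qed.

End Matter.

End SquareMatter.

(** * The commutator of d^2 with a mode of c *)

Section SquareGhost.
Variables (F : numFieldType) (N : nat) (Pp Pm : int -> F).
Local Notation V := (Vec F N).
Local Notation I := (nzidx N).
Local Notation d := (@dop F N Pp Pm).
Local Notation hlev := (@homog F N level_weight).
Implicit Types (v : V) (n m k : int).

Let T v n p q := X sC (- n) (X sC (- p) (X sC (- q) v)).

Let T_cycle v n p q : T v p q n = T v n p q.
Proof. by rewrite /T [X sC (- q) _]CC XN CC opprK. Qed.

Let T_pq k v l n p q : hlev l v -> l <= N%:Z -> l - k <= N%:Z -> n + p + q = - k ->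
  p + q != 0 -> p + q \notin I -> T v n p q = 0.
Proof.
move=> hv lN lkN npq pq0; rewrite mem_nzidx pq0 /= => pqN.
have [pq|pq] := leP 0 (p + q).
  by rewrite -T_cycle /T (X_low _ hv) ?X0 //; lia.
by rewrite /T (XX_low _ _ hv) ?X0 //; lia.
Qed.

(** The sum equals each of its cyclic relabellings, so three times it is zero. *)
Lemma cyclic_sum (G : int -> int -> int -> V) :
  (forall n p q, G n p q + G p q n + G q n p = 0) ->
  \sum_(n <- I) \sum_(p <- I) \sum_(q <- I) G n p q = 0.
Proof.
move=> hG; set S := LHS.
have S1 : S = \sum_(n <- I) \sum_(p <- I) \sum_(q <- I) G p q n.
  rewrite [RHS]exchange_big; apply: eq_bigr => n _; rewrite exchange_big.
  by apply: eq_bigr => p _.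
have S2 : S = \sum_(n <- I) \sum_(p <- I) \sum_(q <- I) G q n p.
  rewrite /S [LHS]exchange_big; apply: eq_bigr => n _; rewrite exchange_big.
  by apply: eq_bigr => p _.
have : S + S + S = 0.
  transitivity (\sum_(n <- I) \sum_(p <- I) \sum_(q <- I)
      (G n p q + G p q n + G q n p)).
    rewrite {2}S1 {2}S2 /S -!big_split; apply: eq_bigr => n _.
    rewrite -!big_split; apply: eq_bigr => p _.
    by rewrite -!big_split; apply: eq_bigr => q _.
  by rewrite big1 // => n _; rewrite big1 // => p _; rewrite big1.
move=> /eqP; rewrite -{1}[S]scale1r -{2}[S]scale1r -{3}[S]scale1r -!scalerDl scaler_eq0.
have -> : 1 + 1 + 1 = 3%:R :> F by ring.
by rewrite pnatr_eq0 /= => /eqP.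
Qed.

Lemma dC_C n m v : dC n (X sC m v) = X sC m (dC n v).
Proof.
rewrite /dC -2!lock Xsum; apply: eq_bigr => p _; rewrite Xsum; apply: eq_bigr => q _.
case: ifP => _; rewrite ?X0 // XZ; congr (_ *: _).
by rewrite [X sC (- q) _]CC XN CC opprK.
Qed.

(** d acts on either of the two c in [dC]; antisymmetry identifies the two contributions, which
    cancels the factor 1/2. *)
Lemma dop_dC k v : d (dC k v) = dC k (d v)
  - \sum_(n <- I) \sum_(m <- I)
      (if n + m == - k then (m - n)%:~R else 0) *: X sC (- n) (dC (- m) v).
Proof.
have -> : \sum_(n <- I) \sum_(m <- I)
      (if n + m == - k then (m - n)%:~R else 0) *: X sC (- n) (dC (- m) v)
  = \sum_(n <- I) \sum_(m <- I) (if n + m == - k then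
       ((m - n)%:~R / 2) *: (X sC (- n) (dC (- m) v) - X sC (- m) (dC (- n) v)) else 0).
  have sw : \sum_(n <- I) \sum_(m <- I)
      (if n + m == - k then ((m - n)%:~R / 2) else 0) *: X sC (- n) (dC (- m) v)
    = - \sum_(n <- I) \sum_(m <- I)
      (if n + m == - k then ((m - n)%:~R / 2) else 0) *: X sC (- m) (dC (- n) v).
    rewrite exchange_big -sumrN; apply: eq_bigr => n _; rewrite -sumrN.
    apply: eq_bigr => m _; rewrite [m + n]addrC -scaleNr; case: ifP => _; rewrite ?oppr0 //.
    by congr (_ *: _); rewrite !rmorphB /=; ring.
  transitivity (\sum_(n <- I) \sum_(m <- I)
      (if n + m == - k then ((m - n)%:~R / 2) else 0) *: X sC (- n) (dC (- m) v)
    - \sum_(n <- I) \sum_(m <- I)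
      (if n + m == - k then ((m - n)%:~R / 2) else 0) *: X sC (- m) (dC (- n) v)).
    rewrite -sw -big_split; apply: eq_bigr => n _; rewrite -big_split.
    apply: eq_bigr => m _ /=; rewrite -scalerDl; congr (_ *: _).
    by case: ifP => _; [field | rewrite addr0].
  rewrite -sumrN -big_split; apply: eq_bigr => n _ /=.
  rewrite -sumrN -big_split; apply: eq_bigr => m _ /=.
  by case: ifP => _; [rewrite scalerBr | rewrite !scale0r subr0].
rewrite {1 2}/dC -2!lock dopsum -sumrN -big_split !big_seq.
apply: eq_bigr => n nI /=; rewrite dopsum -sumrN -big_split !big_seq.
apply: eq_bigr => m mI /=; case: ifP => _; last by rewrite dop_zero subrr.
rewrite dopZ dop_C ?nzidxN // dop_C ?nzidxN // dC_C !Xlin.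
by vring.
Qed.

(** The cyclic sum of (p+q-n)(q-p) is zero, the Jacobi identity of the Witt algebra. As for matter,
    only the omitted diagonal p + q = 0 survives and produces M. *)
Lemma dop2_C k v l : k \in I -> hlev l v -> l <= N%:Z -> l - k <= N%:Z ->
  d (d (X sC k v)) = X sC k (d (d v)) - k%:~R *: M (X sC k v).
Proof.
move=> kI hv lN lkN.
rewrite dop_C // !doplin dop_C // dop_dC opprD opprK -!addrA; congr (_ + _).
rewrite addKr; congr (- _).
pose g n p q : F := if n + p + q == - k then (p + q - n)%:~R * ((q - p)%:~R / 2) else 0.
have -> : \sum_(n <- I) \sum_(m <- I)
      (if n + m == - k then (m - n)%:~R else 0) *: X sC (- n) (dC (- m) v)
  = \sum_(n <- I) \sum_(p <- I) \sum_(q <- I)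
      if p + q \in I then g n p q *: T v n p q else 0.
  apply: eq_bigr => n _.
  transitivity (X sC (- n) (\sum_(m <- I)
      (if n + m == - k then (m - n)%:~R else 0) *: dC (- m) v)).
    by rewrite Xsum; apply: eq_bigr => m _; rewrite XZ.
  rewrite (sum_dC (fun m => if n + m == - k then (m - n)%:~R else 0) (fun=> v)).
  rewrite Xsum; apply: eq_bigr => p _; rewrite Xsum; apply: eq_bigr => q _.
  rewrite addrA; case: ifP => _; rewrite ?X0 // XZ /g.
  by case: ifP; rewrite ?mul0r.
have -> : k%:~R *: M (X sC k v) = - \sum_(n <- I) \sum_(p <- I) \sum_(q <- I)
    if q == - p then g n p q *: T v n p q else 0.
  transitivity (- \sum_(p <- I) \sum_(n <- I) if n == - k then
     g n p (- p) *: T v n p (- p) else 0).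
    rewrite /M -lock scaler_sumr -sumrN !big_seq; apply: eq_bigr => p pI.
    rewrite sum_delta nzidxN kI /g /T !opprK.
    rewrite [X sC k (X sC (- p) _)]CC [X sC k (X sC p v)]CC XN opprK.
    rewrite addrK eqxx scalerA -scaleNr; congr (_ *: _).
    by rewrite ?(rmorphB, rmorphD, rmorphN, rmorphM) /=; field.
  congr (- _); rewrite exchange_big !big_seq; apply: eq_bigr => n nI; rewrite !big_seq.
  apply: eq_bigr => p pI.
  rewrite sum_delta nzidxN pI /g addrK.
  by case: eqP => // _; rewrite scale0r.
apply/eqP; rewrite -addr_eq0; apply/eqP.
rewrite -[RHS](cyclic_sum (G := fun n p q => g n p q *: T v n p q)); last first.
  move=> n p q; rewrite (T_cycle v n p q) -(T_cycle v q n p) -!scalerDl.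
  rewrite (_ : _ + _ = 0) ?scale0r // /g.
  have -> : p + q + n = n + p + q by ring.
  have -> : q + n + p = n + p + q by ring.
  case: ifP => _; last by rewrite !addr0.
  by rewrite ?(rmorphB, rmorphD, rmorphN, rmorphM) /=; field.
rewrite -big_split; apply: eq_bigr => n _; rewrite -big_split; apply: eq_bigr => p _.
rewrite -big_split; apply: eq_bigr => q _ /=.
have [->|T0] := eqVneq (T v n p q) 0.
  by rewrite scaler0; do 2 case: ifP => _; rewrite ?addr0.
rewrite /g; case: eqP => [npq|_]; last by rewrite scale0r; do 2 case: ifP; rewrite ?addr0.
have -> : (p + q \in I) = (q != - p).
  have [->|pq] := eqVneq q (- p); first by rewrite subrr mem_nzidx eqxx.
  apply: contraNT T0 => pqI; apply/eqP; apply: (T_pq hv lN lkN) => //.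
  by rewrite addrC addr_eq0.
by case: eqP => _ /=; rewrite ?add0r ?addr0.
Qed.

End SquareGhost.

(** * Transformation laws of all modes, and the vacuum value of L_n L_{-n} *)

Section Nilpotency.
Variables (F : numFieldType) (N : nat) (pp pm : F).
Let Pp n : F := pp - n%:~R.
Let Pm n : F := pm + n%:~R.
Local Notation V := (Vec F N).
Local Notation I := (nzidx N).
Local Notation d := (@dop F N Pp Pm).
Local Notation Ln := (@Lm F N Pp Pm).
Local Notation Lt := (@Ltot F N Pp Pm).
Local Notation br := (br F).
Local Notation hlev := (@homog F N level_weight).
Implicit Types (v : V) (s t : sp) (n m k : int).

Lemma derives_E : derives N Pp Pm sE 0 (fun=> 0) 0 sE.
Proof.
apply: dop_matter => // [n k v nI kI|k v kI].
  by rewrite Lm_E // mul0r add0r if_same scale0r addr0.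
by rewrite Qop_com // scale0r addr0.
Qed.

Lemma derives_Be : derives N Pp Pm sBe (-1) (fun=> 0) 0 sBe.
Proof.
apply: dop_matter => // [n k v nI kI|k v kI].
  by rewrite Lm_Be // mulN1r opprD if_same scale0r addr0.
by rewrite Qop_com // scale0r addr0.
Qed.

Lemma derives_Ga : derives N Pp Pm sGa 0 (fun=> 0) (-1) sE.
Proof.
apply: dop_matter => // [n k v nI kI|k v kI].
  by rewrite Lm_Ga // mul0r add0r if_same scale0r addr0.
by rewrite Qop_Ga // /sg /= scale1r scaleN1r.
Qed.

Lemma derives_Z : derives N Pp Pm sZ (-1) (fun=> 0) 1 sBe.
Proof.
apply: dop_matter => // [n k v nI kI|k v kI].
  by rewrite Lm_Z // mulN1r opprD if_same scale0r addr0.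
by rewrite Qop_Z // /sg /= scale1r scaleN1r.
Qed.

Lemma derives_Ap : derives N Pp Pm sAp 0 (fun n => n%:~R * Pp n) 0 sAp.
Proof.
apply: dop_matter => // [n k v nI kI|k v kI].
  by rewrite Lm_Ap // mul0r add0r.
by rewrite Qop_com // scale0r addr0.
Qed.

Lemma derives_Am : derives N Pp Pm sAm 0 (fun n => n%:~R * Pm n) 0 sAm.
Proof.
apply: dop_matter => // [n k v nI kI|k v kI].
  by rewrite Lm_Am // mul0r add0r.
by rewrite Qop_com // scale0r addr0.
Qed.

Lemma dop2_matter0 t w kap t' k v l : (forall j, br sC t j = 0) ->
  derives N Pp Pm t w kap 0 t' -> w * (w + 1) = 0 ->
  (forall n, sg F sC t * kap n = kap n) ->
  (forall n m, kap (n + m) * (m - n)%:~R =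
    (w * n + n + m)%:~R * kap m - (w * m + n + m)%:~R * kap n) ->
  k \in I -> hlev l v -> l <= N%:Z -> l - k <= N%:Z ->
  d (d (X t k v)) = X t k (d (d v)) - k%:~R *: M (X t k v).
Proof.
move=> Ct hd ww skap hkap; apply: (dop2_matter Ct hd _ ww skap hkap).
by move=> *; rewrite !scale0r.
Qed.

Lemma dop2_X t k v l : t != sB -> k \in I -> hlev l v -> l <= N%:Z -> l - k <= N%:Z ->
  d (d (X t k v)) = X t k (d (d v)) - k%:~R *: M (X t k v).
Proof.
have kap0 (w : int) n m : 0 * (m - n)%:~R =
    (w * n + n + m)%:~R * 0 - (w * m + n + m)%:~R * 0 :> F by rewrite mul0r !mulr0 subrr.
case: t => [[]|[]] tB.
- apply: (dop2_matter0 _ derives_Ap) => // [n|n m]; first by rewrite /sg /= mul1r.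
  (* The Jacobi condition on the shift n P(n) holds because P is affine in n. *)
  by rewrite /Pp ?(rmorphB, rmorphD, rmorphN, rmorphM) /=; ring.
- apply: (dop2_matter0 _ derives_Am) => // [n|n m]; first by rewrite /sg /= mul1r.
  by rewrite /Pm ?(rmorphB, rmorphD, rmorphN, rmorphM) /=; ring.
- by apply: (dop2_matter0 _ derives_Be) => // n; rewrite mulr0.
- apply: (dop2_matter _ derives_Ga) => // [j w jI|n]; last by rewrite mulr0.
  by rewrite derives_E // /sg /= !scale0r !addr0.
- by rewrite eqxx in tB.
- by move=> kI hv lN lkN; exact: (dop2_C Pp Pm kI hv lN lkN).
- apply: (dop2_matter _ derives_Z) => // [j w jI|n]; last by rewrite mulr0.
  by rewrite derives_Be // /sg /= opprK !scale0r !addr0.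
- by apply: (dop2_matter0 _ derives_E) => // n; rewrite mulr0.
Qed.

Lemma M_com t k v : (forall j, br sC t j = 0) -> M (X t k v) = X t k (M v).
Proof.
move=> Ct; rewrite /M -2!lock Xsum; apply: eq_bigr => n _.
rewrite (XC0 n k _ Ct) !Xlin (XC0 (- n) k _ Ct) 2!scalerA -mulrA.
by rewrite [sg _ _ _ * _]sg_sqr mulr1.
Qed.

Lemma MZ a v : M (a *: v) = a *: M v.
Proof.
rewrite /M -2!lock scaler_sumr; apply: eq_bigr => n _.
by rewrite !Xlin !scalerA mulrC.
Qed.

(** The summands n = k and n = -k contract with b~_k and give -k c_k each. *)
Lemma M_B k v : k \in I -> M (X sB k v) = X sB k (M v) + (- 2 * k%:~R) *: X sC k v.
Proof.
move=> kI; rewrite /M -2!lock Xsum.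
have -> : (- 2 * k%:~R) *: X sC k v = \sum_(n <- I)
   ((if n == k then - k%:~R *: X sC n v else 0) +
    (if n == - k then - k%:~R *: X sC (- n) v else 0)).
  by rewrite big_split /= !sum_delta nzidxN kI opprK -scalerDl; congr (_ *: _); ring.
rewrite -big_split; apply: eq_bigr => n _ /=.
rewrite (XC sC sB n k) !Xlin (XC sC sB (- n) k) nzidxN.
have -> : (n + k == 0) = (n == - k) by lia.
have -> : (- n + k == 0) = (n == k) by lia.
have k0 := nzidx_neq0 kI.
have [->|_] := eqVneq n k; first rewrite (_ : k == - k = false); last 2 first.
- by lia.
- by have [->|_] := eqVneq n (- k); rewrite ?nzidxN ?kI /sg /= ?mulrNz ?opprK; vring.
by rewrite kI /sg /=; vring.
Qed.

Lemma J_hlev mu s t n l v : hlev l v -> hlev (l - n) (J mu s t n v).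
Proof.
move=> hv; rewrite /J -lock; apply: homog_sum => m _ _; apply: homogZ.
have -> : l - n = l - (n + m) - (- m) by ring.
exact/homog_X/homog_X.
Qed.

Lemma Lm_hlev n l v : hlev l v -> hlev (l - n) (Ln n v).
Proof.
move=> hv; rewrite /Lm -lock; do ![apply: homogD | apply: homogZ];
  by [apply: homog_X | apply: J_hlev].
Qed.

Lemma Lt_hlev n l v : hlev l v -> hlev (l - n) (Lt n v).
Proof.
by move=> hv; rewrite /Ltot -lock; apply: homogD; [apply: Lm_hlev | apply: J_hlev].
Qed.

Definition vac : BState N := ([ffun=> 0%N], set0).
Local Notation dvac := (kdelta F vac : V).

Lemma charge_vac W : charge W vac = 0.
Proof. by rewrite /charge big1 ?big_set0 // => x _; rewrite ffunE mul0r. Qed.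

Lemma vac_hlev : hlev 0 dvac.
Proof. by rewrite -(charge_vac level_weight); apply: homog_kdelta. Qed.

Lemma vac_low s n : 0 < n -> X s n dvac = 0.
Proof. exact: X_low vac_hlev. Qed.

Lemma LtZ n a v : Lt n (a *: v) = a *: Lt n v.
Proof. by rewrite /Ltot -2!lock !linearZ /= scalerDr. Qed.
Lemma LtD n u v : Lt n (u + v) = Lt n u + Lt n v.
Proof. by rewrite /Ltot -3!lock !linearD /=; vring. Qed.
Lemma Ltsum n (A : Type) (r : seq A) (P : pred A) (f : A -> V) :
  Lt n (\sum_(i <- r | P i) f i) = \sum_(i <- r | P i) Lt n (f i).
Proof.
apply: (big_morph (Lt n)); first exact: LtD.
by rewrite -(scale0r (0 : V)) LtZ !scale0r.
Qed.

Lemma Lt_low n l v : hlev l v -> l < n -> Lt n v = 0.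
Proof. by move=> hv ln; apply: (level_ge0 (@Lt_hlev n l v hv)); rewrite subr_lt0. Qed.

(* Outside 0 < m < n, one of the two modes of the current can be commuted to the
   vacuum, which it annihilates. *)
Lemma Lt_J_vac mu (lam : int -> int -> F) s t n : 0 < n -> n \in I ->
  (forall m v, 0 < m < n -> m \in I -> n - m \in I ->
     Lt n (X s (- m) v) = X s (- m) (Lt n v) + lam n m *: X s (n - m) v) ->
  Lt n (J mu s t (- n) dvac) =
    (\sum_(m <- I | 0 < m < n) mu m * lam n m * br s t (n - m)) *: dvac.
Proof.
move=> n0 nI hs; rewrite /J -lock Ltsum scaler_suml big_mkcond [RHS]big_mkcond !big_seq.
have nN : (`|n| <= N)%N by move: nI; rewrite mem_nzidx => /andP[].
apply: eq_bigr => m mI; rewrite LtZ.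
have m0 := nzidx_neq0 mI.
case: ifPn => [/andP[lt0m ltmn]|mn].
  have nmI : n - m \in I by rewrite mem_nzidx; lia.
  rewrite hs ?lt0m // [Lt n _](Lt_low (@homog_X _ _ t (- n + m) 0 _ vac_hlev)); last by lia.
  rewrite X0 add0r XC nmI (_ : n - m + (- n + m) == 0); last by lia.
  rewrite vac_low ?X0; last by lia.
  by rewrite !scaler0 add0r !scalerA mulrA.
suff -> : X s (- m) (X t (- n + m) dvac) = 0.
  by rewrite -(scale0r (0 : V)) LtZ !scale0r scaler0.
have [mlt0|mge0] := ltP m 0.
  rewrite XC (_ : _ == 0 = false); last by lia.
  by rewrite vac_low ?X0 ?scale0r ?scaler0 ?addr0 //; lia.
have [->|ne] := eqVneq m n; first by rewrite addNr (X_out _ dvac) ?X0 // mem_nzidx eqxx.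
by rewrite vac_low ?X0 //; lia.
Qed.

Lemma sum_range (c : F) n : 0 < n -> n \in I ->
  \sum_(m <- I | 0 < m < n) c = (n - 1)%:~R * c.
Proof.
case: n => // -[//|n] _ nI; have nN : (n < N)%N by move: nI; rewrite mem_nzidx; lia.
rewrite big_cat !big_map /= [Y in _ + Y]big1 ?addr0; last by move=> i; lia.
transitivity (\sum_(0 <= i < N | (i < n)%N) c).
  rewrite /index_iota subn0; apply: eq_bigl => i; lia.
rewrite -(big_nat_widen 0 n N xpredT (fun=> c)) 1?ltnW // sumr_const_nat subn0.
rewrite (_ : n.+1%:Z - 1 = n%:Z); last by lia.
by rewrite -mulr_natl -pmulrn.
Qed.

(** The linear terms give 2n(p^+ p^- + n^2) and the currents (n-1)(-2n^2). The cubic terms in n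
    cancel: the background charge brings the total central charge to zero. *)
Lemma Lt_Lt_vac n : 0 < n -> n \in I ->
  Lt n (Lt (- n) dvac) = (2 * n%:~R * (pp * pm + n%:~R)) *: dvac.
Proof.
move=> n0 nI; have nnI : - n \in I by rewrite nzidxN.
have JcB m v : J (fun m => (m - n)%:~R) sC sB n v = Lt n v - Ln n v.
  by rewrite /Ltot -lock addrC addKr.
rewrite {2}/Ltot -lock LtD {1}/Lm -lock !LtD !LtZ.
have LtAm : Lt n (X sAm (- n) dvac) = (n%:~R * Pm n) *: dvac.
  rewrite {1}/Ltot -lock Lm_Am // JC // subrr eqxx (X_out _ dvac) ?mem_nzidx ?eqxx //.
  have := Lt_low vac_hlev n0; rewrite /Ltot -lock => /eqP; rewrite addr_eq0 => /eqP ->.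
  by rewrite XN; vring.
have LtAp : Lt n (X sAp (- n) dvac) = (n%:~R * Pp n) *: dvac.
  rewrite {1}/Ltot -lock Lm_Ap // JC // subrr eqxx (X_out _ dvac) ?mem_nzidx ?eqxx //.
  have := Lt_low vac_hlev n0; rewrite /Ltot -lock => /eqP; rewrite addr_eq0 => /eqP ->.
  by rewrite XN; vring.
rewrite LtAm LtAp.
rewrite -> (@Lt_J_vac (fun=> 1) (fun n m => m%:~R) sAp sAm n n0 nI); last first.
  move=> m v /andP[m0 mn] mI nmI.
  rewrite /Ltot -2!lock Lm_Ap ?nzidxN // JC // XD opprK.
  by rewrite (_ : n - m == 0 = false) ?scale0r ?addr0; [vring | lia].
rewrite -> (@Lt_J_vac (fun m => m%:~R) (fun n m => (m - n)%:~R) sZ sE n n0 nI); last first.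
  move=> m v /andP[m0 mn] mI nmI.
  rewrite /Ltot -2!lock Lm_Z ?nzidxN // JC // XD opprB.
  by vring.
rewrite -> (@Lt_J_vac (fun m => m%:~R) (fun n m => (m - n)%:~R) sBe sGa n n0 nI); last first.
  move=> m v /andP[m0 mn] mI nmI.
  rewrite /Ltot -2!lock Lm_Be ?nzidxN // JC // XD opprB.
  by vring.
rewrite -> (@Lt_J_vac (fun m => (m - - n)%:~R) (fun n m => (m - 2 * n)%:~R) sC sB n n0 nI); last first.
  move=> m v /andP[m0 mn] mI nmI.
  rewrite /Ltot -2!lock Lm_C JC1 ?nzidxN // XD.
  by vring.
rewrite !scalerA -!scalerDl; congr (_ *: _).
rewrite -!addrA -!big_split /=.
(* In the order alpha, zeta eta~, beta gamma, c b~ the contributions are m(n-m), m(m-n), m(n-m) and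
   (m+n)(m-2n). *)
rewrite (eq_bigr (fun=> - 2 * n%:~R * n%:~R : F)); last first.
  move=> m _; rewrite /= ?(rmorphB, rmorphD, rmorphN, rmorphM) /=; ring.
rewrite sum_range // /Pp /Pm ?(rmorphB, rmorphD, rmorphN, rmorphM) /=; ring.
Qed.

End Nilpotency.

(** * Ghost number, and the homogeneity of d under a weight *)

Definition ghost_weight (o : mop) : int :=
  match o with
  | OF FC _ | OF FE _ => 1 | OF FB _ | OF FZ _ => -1 | OB _ _ => 0
  end.
Lemma odd_ghost : odd_weight ghost_weight. Proof. by case=> [[]|[]]. Qed.

Lemma fcountE N (S : {set fsp * 'I_N}) (f : fsp) :
  (fcount S f)%:Z = \sum_(y in S) (y.1 == f)%:Z.
Proof.
rewrite /fcount -sum1_card (big_morph Posz PoszD (erefl _)) big_mkcond [RHS]big_mkcond.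
by apply: eq_bigr => y _; rewrite inE; case: (y \in S); case: (y.1 == f).
Qed.

Lemma charge_ghost N (s : BState N) : charge ghost_weight s = ghost s.
Proof.
rewrite /charge /ghost !fcountE big1 ?add0r => [|x _]; last by rewrite mulr0.
rewrite -!sumrN -!big_split /=; apply: eq_bigr => -[f k] _ /=.
by case: f; do !case: eqP.
Qed.

Lemma blevel_eq0 N (s : BState N) : blevel s = 0%N -> s = vac N.
Proof.
case: s => o S; rewrite /blevel /= => /eqP; rewrite addn_eq0 => /andP[].
rewrite sum_nat_eq0 => /forallP h; rewrite sum_nat_eq0 => /forallP h'.
congr (_, _).
  by apply/ffunP => x; rewrite ffunE; apply/eqP; have := h x; rewrite muln_eq0 orbF.
by apply/setP => y; rewrite inE; apply/negbTE/negP => yS; have := h' y; rewrite yS.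
Qed.

Section DopHomog.
Variables (F : numFieldType) (N : nat) (Pp Pm : int -> F) (W : mop -> int).
Hypothesis oddW : odd_weight W.
Local Notation V := (Vec F N).
Local Notation W' s n := (W (mk s n)).

Lemma homog_XW s n q (v : V) : homog W q v -> homog W (q + W' s n) (X s n v).
Proof. by case: s => s hv; apply: (homog_opm oddW). Qed.

Lemma homog_J mu s t n e q (v : V) : (forall m, W' s (- m) + W' t (n + m) = e) ->
  homog W q v -> homog W (q + e) (J mu s t n v).
Proof.
move=> he hv; rewrite /J -lock; apply: homog_sum => m _ _; apply: homogZ.
by rewrite -(he m) addrCA addrA [_ + q]addrC -addrA [_ + W' t _]addrC addrA; apply/homog_XW/homog_XW.
Qed.

Lemma homog_Qop e q (v : V) : (forall n, W' sE n + W' sBe (- n) = e) ->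
  homog W q v -> homog W (q + e) (Qop v).
Proof.
move=> he hv; rewrite /Qop -lock; apply: homog_sum => m _ _.
by rewrite -(he m) [W' sE m + _]addrC addrA; apply/homog_XW/homog_XW.
Qed.

Lemma homog_gh e q (v : V) :
  (forall n m, W' sC (- n) + (W' sC (- m) + W' sB (n + m)) = e) ->
  homog W q v -> homog W (q + e) (gh v).
Proof.
move=> he hv; rewrite /gh -lock; apply: homog_sum => n _ _; apply: homog_sum => m _ _.
apply: homogZ; rewrite -(he n m).
have -> : q + (W' sC (- n) + (W' sC (- m) + W' sB (n + m))) =
  q + W' sB (n + m) + W' sC (- m) + W' sC (- n) by ring.
exact/homog_XW/homog_XW/homog_XW.
Qed.

Lemma homog_dop e q (v : V) :
  (forall n, W' sE n + W' sBe (- n) = e) ->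
  (forall n, W' sC (- n) + W' sAm n = e) ->
  (forall n, W' sC (- n) + W' sAp n = e) ->
  (forall n m, W' sC (- n) + (W' sAp (- m) + W' sAm (n + m)) = e) ->
  (forall n m, W' sC (- n) + (W' sZ (- m) + W' sE (n + m)) = e) ->
  (forall n m, W' sC (- n) + (W' sBe (- m) + W' sGa (n + m)) = e) ->
  (forall n m, W' sC (- n) + (W' sC (- m) + W' sB (n + m)) = e) ->
  homog W q v -> homog W (q + e) (dop Pp Pm v).
Proof.
move=> h0 h1 h2 h3 h4 h5 h6 hv; rewrite /dop -lock; apply: homogD; last exact: homog_gh.
apply: homogD; first exact: homog_Qop.
rewrite /cL -lock; apply: homog_sum => n _ _.
have -> : q + e = q + (e - W' sC (- n)) + W' sC (- n) by ring.
apply: homog_XW; rewrite /Lm -lock; apply: homogD; first apply: homogD.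
- have -> : e - W' sC (- n) = W' sAm n by rewrite -(h1 n) addrC addKr.
  exact/homogZ/homog_XW.
- have -> : e - W' sC (- n) = W' sAp n by rewrite -(h2 n) addrC addKr.
  exact/homogZ/homog_XW.
- do ![apply: homogD]; apply: homog_J => // m.
  + by apply/eqP; rewrite eq_sym subr_eq addrC h3.
  + by apply/eqP; rewrite eq_sym subr_eq addrC h4.
  + by apply/eqP; rewrite eq_sym subr_eq addrC h5.
Qed.

End DopHomog.

Lemma dop_ghost F N Pp Pm q (v : Vec F N) :
  homog ghost_weight q v -> homog ghost_weight (q + 1) (dop Pp Pm v).
Proof. exact: homog_dop odd_ghost _ _ _ _ _ _ _ _ _ _. Qed.

Lemma dop_level F N Pp Pm q (v : Vec F N) :
  homog level_weight q v -> homog level_weight q (dop Pp Pm v).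
Proof.
move=> hv; rewrite -[q]addr0.
by apply: homog_dop odd_level _ _ _ _ _ _ _ _ _ _ hv => *; rewrite /mk /level_weight /=; ring.
Qed.

(** * d^2 on the vacuum and on b~_{-n}|0> *)

Section SquareVacuum.
Variables (F : numFieldType) (N : nat) (pp pm : F).
Let Pp n : F := pp - n%:~R.
Let Pm n : F := pm + n%:~R.
Local Notation V := (Vec F N).
Local Notation I := (nzidx N).
Local Notation d := (@dop F N Pp Pm).
Local Notation hlev := (@homog F N level_weight).
Local Notation dvac := (kdelta F (vac N) : V).
Implicit Types (v : V) (s t : sp) (n m k : int).

(** The vacuum is the only monomial of level 0 and has ghost number 0. Vectors such as d|0> are
    thereby zero without computation. *)
Lemma level0_ghost q v : hlev 0 v -> homog ghost_weight q v -> q != 0 -> v = 0.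
Proof.
move=> hv gv q0; apply/funext => s; apply/eqP; rewrite vzeroE; apply: contraNT q0 => vs.
have /eqP := hv s vs; rewrite charge_level eqz_nat => /eqP/blevel_eq0 s0.
by rewrite -(gv s vs) s0 charge_vac.
Qed.

Lemma vac_ghost : homog ghost_weight 0 dvac.
Proof. by rewrite -(charge_vac N ghost_weight); apply: homog_kdelta. Qed.

Lemma dop_vac : d dvac = 0.
Proof.
apply: level0_ghost (@dop_level F N Pp Pm 0 _ (@vac_hlev F N)) (@dop_ghost F N Pp Pm 0 _ vac_ghost) _.
by rewrite add0r.
Qed.

Lemma M_vac : M dvac = 0.
Proof.
rewrite /M -lock big_seq big1 // => n nI; have n0 := nzidx_neq0 nI.
have [nn|nn] := leP n 0; last by rewrite vac_low ?X0 ?scaler0.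
by rewrite CC vac_low ?X0 ?oppr0 ?scaler0 //; lia.
Qed.

(** d turns b~_{-n}|0> into L_{-n}|0>. Moving b~_n past the remaining d leaves L_n L_{-n}|0>, since
    b~_n L_{-n}|0> has level 0 and ghost number -1, hence vanishes. *)
Lemma dop2_B_vac n : 0 < n -> n \in I ->
  X sB n (d (d (X sB (- n) dvac))) = (2 * n%:~R * (pp * pm + n%:~R)) *: dvac.
Proof.
move=> n0 nI; have nnI : - n \in I by rewrite nzidxN.
have e : d (X sB (- n) dvac) = Ltot Pp Pm (- n) dvac.
  by rewrite dop_B // dop_vac X0 oppr0 add0r.
have lB : hlev n (X sB (- n) dvac).
  by have := @homog_X F N sB (- n) 0 _ (@vac_hlev F N); rewrite sub0r opprK.
have gB : homog ghost_weight (-1) (X sB (- n) dvac).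
  by have := @homog_XW F N _ odd_ghost sB (- n) 0 _ vac_ghost.
rewrite e; set u := Ltot _ _ _ _.
have Bu : X sB n u = 0.
  apply: (@level0_ghost (-1)) => //.
    by rewrite -[0](subrr n); apply: homog_X; rewrite /u -e; apply: dop_level.
  rewrite -[-1]add0r; apply: (homog_XW odd_ghost (s := sB) (n := n)).
  by rewrite /u -e -[0](addNr 1); apply: dop_ghost.
have := dop_B Pp Pm u nI; rewrite Bu dop_zero => /esym/eqP; rewrite addrC subr_eq0 => /eqP <-.
exact: Lt_Lt_vac.
Qed.

Lemma M_B_vac n : 0 < n -> n \in I -> X sB n (M (X sB (- n) dvac)) = (2 * n%:~R) *: dvac.
Proof.
move=> n0 nI; rewrite M_B ?nzidxN // M_vac X0 add0r XZ XC subrr eqxx nI.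
rewrite [X sB n _](vac_low F N _ n0) // X0 scaler0 add0r scalerA; congr (_ *: _).
by rewrite /= mulrNz; ring.
Qed.

End SquareVacuum.

(** * Single modes in terms of their labels *)

Lemma mlabel_pos N (k : 'I_N) : mlabel N (k.+1)%:Z = Some k.
Proof.
case: mlabelP => [|j [e]|j]; last by lia.
- by rewrite mem_nzidx; have := ltn_ord k; lia.
- by congr Some; apply/val_inj.
Qed.

Lemma mlabel_neg N (k : 'I_N) : mlabel N (- (k.+1)%:Z) = Some k.
Proof.
case: mlabelP => [|j|j e]; last by congr Some; apply/val_inj => /=; lia.
- by rewrite mem_nzidx; have := ltn_ord k; lia.
- by lia.
Qed.

Lemma ord_nzidx N (k : 'I_N) : (k.+1)%:Z \in nzidx N.
Proof. by rewrite mem_nzidx; have := ltn_ord k; lia. Qed.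

Section ModeActions.
Variables (F : numFieldType) (N : nat).
Local Notation V := (Vec F N).
Implicit Types (v : V).

Lemma X_bcr (x : bsp * 'I_N) v : X (inl x.1) (- (x.2.+1)%:Z) v = bcr x v.
Proof. by rewrite /mk opmE mlabel_neg; case: x => s k; rewrite oppr_lt0. Qed.

Lemma X_ban (x : bsp * 'I_N) v : X (inl x.1) (x.2.+1)%:Z v =
  acoef F x.1 (x.2.+1)%:Z *: ban (bpartner x.1, x.2) v.
Proof. by rewrite /mk opmE mlabel_pos. Qed.

Lemma X_fcr (y : fsp * 'I_N) v : X (inr y.1) (- (y.2.+1)%:Z) v = fcr y v.
Proof. by rewrite /mk opmE mlabel_neg; case: y => s k; rewrite oppr_lt0. Qed.

Lemma X_fan (y : fsp * 'I_N) v : X (inr y.1) (y.2.+1)%:Z v = fan (fpartner y.1, y.2) v.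
Proof. by rewrite /mk opmE mlabel_pos. Qed.

Lemma acoef_neq0 s k : acoef F s (k.+1)%:Z != 0.
Proof. by case: s; rewrite /= ?oppr_eq0 ?oner_eq0 // pnatr_eq0. Qed.

Lemma ann_kdelta t n s : n \in nzidx N -> 0 < n ->
  exists a s', X t n (kdelta F s) = a *: kdelta F s' :> V.
Proof.
move=> nI n0; have [k ->] : exists k : 'I_N, n = (k.+1)%:Z.
  have h : (`|n|.-1 < N)%N by move: nI; rewrite mem_nzidx; lia.
  by exists (Ordinal h) => /=; lia.
case: s => o S; case: t => f.
  rewrite (X_ban (f, k)) ban_kdelta scalerA; by do 2 eexists.
rewrite (X_fan (f, k)) fan_kdelta; case: ifP => _; first by do 2 eexists.
by exists 0, (o, S); rewrite scale0r.
Qed.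

End ModeActions.

Lemma mulf_cancel0 (F : fieldType) (a b : F) : a * b = 0 -> a != 0 -> b = 0.
Proof. by move=> /eqP; rewrite mulf_eq0 => /orP[/eqP ->|/eqP //]; rewrite eqxx. Qed.

(** * The formula for d^2 on all monomials up to level N *)

Section SquareMain.
Variables (F : numFieldType) (N : nat) (pp pm : F).
Let Pp n : F := pp - n%:~R.
Let Pm n : F := pm + n%:~R.
Local Notation V := (Vec F N).
Local Notation I := (nzidx N).
Local Notation d := (@dop F N Pp Pm).
Local Notation hlev := (@homog F N level_weight).
Local Notation delta := (fun s => kdelta F s : V).
Implicit Types (v : V) (t : sp) (n m k : int) (s : BState N).

Let squared s := d (d (delta s)) = (pp * pm + (blevel s)%:R) *: M (delta s).

Lemma kdelta_hlev s : hlev (blevel s)%:Z (delta s).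
Proof. by rewrite -charge_level; apply: homog_kdelta. Qed.

Lemma br_C0 t : t != sB -> forall j, br F sC t j = 0.
Proof. by case: t => [|[]]; rewrite ?eqxx. Qed.

Lemma X_kdelta_level t k s s' a : X t k (delta s') = a *: delta s -> a != 0 ->
  (blevel s)%:Z = (blevel s')%:Z - k.
Proof.
move=> e a0; rewrite -charge_level; apply: (@homog_X F N t k _ _ (@kdelta_hlev s')).
by rewrite e vscaleE /kdelta eqxx mulr1.
Qed.

(** The mode t_k changes the level by -k, so the term -k M t_k of the commutator is precisely the
    change of the L_0 eigenvalue in M L_0. *)
Lemma squared_step t k s s' a : t != sB -> k \in I -> (blevel s <= N)%N ->
  (blevel s' <= N)%N -> X t k (delta s') = a *: delta s -> a != 0 ->
  squared s' -> squared s.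
Proof.
move=> tB kI sN s'N e a0 sq; have lev := X_kdelta_level e a0.
apply: (scalerI a0); rewrite -2!dopZ -e.
rewrite (dop2_X pp pm tB kI (@kdelta_hlev s')) //; last by rewrite -lev.
rewrite sq XZ -(M_com _ _ (br_C0 tB)) -scalerBl e MZ !scalerA; congr (_ *: _).
have -> : (blevel s)%:R = (blevel s')%:R - k%:~R :> F.
  by rewrite -[(blevel s)%:R]/((blevel s)%:Z%:~R) lev rmorphB.
by ring.
Qed.

(** The same relation read downwards: the annihilator leads to a multiple of a monomial of lower
    level, where the formula is already known. *)
Lemma annihilated t k s : 0 < k -> k \in I -> t != sB -> (blevel s <= N)%N ->
  (forall s', (blevel s' < blevel s)%N -> squared s') ->
  X t k (d (d (delta s)) - (pp * pm + (blevel s)%:R) *: M (delta s)) = 0.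
Proof.
move=> k0 kI tB sN IH.
have := dop2_X pp pm tB kI (@kdelta_hlev s) sN.
have [a [s' e]] := ann_kdelta F t s kI k0.
have -> : (blevel s)%:Z - k <= N%:Z by lia.
move=> /(_ isT) h; rewrite XD XN XZ -(M_com _ _ (br_C0 tB)).
have -> : X t k (d (d (delta s))) = d (d (X t k (delta s))) + k%:~R *: M (X t k (delta s)).
  by rewrite h subrK.
rewrite e !dopZ !MZ; have [->|a0] := eqVneq a 0; first by rewrite !scale0r !scaler0 subr0 addr0.
have lev := X_kdelta_level e a0.
rewrite IH; last by lia.
have -> : (blevel s')%:R = (blevel s)%:R - k%:~R :> F.
  by rewrite -[(blevel s')%:R]/((blevel s')%:Z%:~R) lev rmorphB.
by vring.
Qed.

Lemma charge_pure W o (S : {set fsp * 'I_N}) : o = [ffun=> 0%N] ->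
  charge W (o, S) = \sum_(y in S) W (fmode y).
Proof. by move=> ->; rewrite /charge big1 ?add0r // => x _; rewrite ffunE mul0r. Qed.

(** The difference [Y] of the two sides is killed by every annihilator except the modes of b~, so it
    contains only c creators. Its ghost number exceeds that of [s] by 2, so the b~ in [s] and the c
    in a monomial of [Y] number 2 together; equal levels leave one of each, with the same index.
    Then [s] is b~_{-n}|0> and b~_n reads off the single coefficient c_{-n}|0>, which is zero by the
    vacuum values. *)
Lemma squared_B s : (blevel s <= N)%N -> s.1 = [ffun=> 0%N] ->
  (forall y, y \in s.2 -> y.1 = FB) ->
  (forall s', (blevel s' < blevel s)%N -> squared s') -> squared s.
Proof.
move=> sN s1 s2 IH; set c := pp * pm + (blevel s)%:R.
apply/eqP; rewrite -subr_eq0; apply/eqP; set Y := LHS; apply/funext => t.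
apply/eqP; rewrite vzeroE; apply: contraT => Yt.
have ann r k : 0 < k -> k \in I -> r != sB -> X r k Y = 0.
  by move=> k0 kI rB; apply: annihilated.
have t1 : t.1 = [ffun=> 0%N].
  apply/ffunP => x; rewrite ffunE; apply/eqP; apply: contraNT Yt => tx.
  (* The annihilated vector, evaluated at [t] with one quantum of [x] removed, is a nonzero multiple
     of [Y t]. *)
  have := ann (inl (bpartner x.1)) (x.2.+1)%:Z isT (ord_nzidx _) isT.
  rewrite (X_ban (bpartner x.1, x.2)) /= bpartnerK -surjective_pairing.
  move=> /(congr1 (fun v : V => v (bump_occ t.1 x false, t.2))).
  rewrite vscaleE /ban /= bump_occVK // -surjective_pairing bump_occE eqxx => /eqP.
  by rewrite mulf_eq0 (negbTE (acoef_neq0 _ _ _)) mulf_eq0 pnatr_eq0.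
have t2 y : y \in t.2 -> y.1 = FC.
  move=> yt; apply/eqP; apply: contraNT Yt => yC.
  have := ann (inr (fpartner y.1)) (y.2.+1)%:Z isT (ord_nzidx _).
  have -> : (inr (fpartner y.1) : sp) != sB by apply: contraNneq yC => -[]; case: (y.1).
  move=> /(_ isT); rewrite (X_fan (fpartner y.1, y.2)) /= fpartnerK -surjective_pairing.
  move=> /(congr1 (fun v : V => v (t.1, t.2 :\ y))).
  rewrite /fan /= setD11 setD1K // -surjective_pairing.
  by move=> /mulf_cancel0 -> //; apply: jw_neq0.
have levY : hlev (blevel s)%:Z Y.
  apply: homogD; first exact/dop_level/dop_level/kdelta_hlev.
  apply/homogN/homogZ; rewrite /M -lock; apply: homog_sum => m _ _; apply: homogZ.
  rewrite -[(blevel s)%:Z](addrNK m) -{2}[m]opprK.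
  exact/homog_X/homog_X/kdelta_hlev.
have gY : homog ghost_weight (ghost s + 2) Y.
  have g0 : homog ghost_weight (ghost s) (delta s).
    by rewrite -charge_ghost; apply: homog_kdelta.
  apply: homogD; first by rewrite -[2]/(1 + 1) addrA; apply/dop_ghost/dop_ghost.
  apply/homogN/homogZ; rewrite /M -lock; apply: homog_sum => m _ _; apply: homogZ.
  by rewrite -[2]/(1 + 1) addrA; apply/(homog_XW odd_ghost (s := sC))/(homog_XW odd_ghost (s := sC)).
have es : s = ([ffun=> 0%N], s.2) by rewrite -s1 -surjective_pairing.
have et : t = ([ffun=> 0%N], t.2) by rewrite -t1 -surjective_pairing.
have gs : ghost s = - (#|s.2|)%:Z.
  rewrite -charge_ghost es charge_pure //= (eq_bigr (fun=> - 1)) => [|y /s2 yB].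
    by rewrite sumr_const mulNrn natz.
  by rewrite /fmode yB.
have gt : ghost t = (#|t.2|)%:Z.
  rewrite -charge_ghost et charge_pure //= (eq_bigr (fun=> 1)) => [|y /t2 yC].
    by rewrite sumr_const natz.
  by rewrite /fmode yC.
have cards : (#|t.2| + #|s.2| = 2)%N.
  by have := gY t Yt; rewrite charge_ghost gs gt; lia.
have lev : \sum_(y in t.2) (y.2.+1)%:Z = \sum_(y in s.2) (y.2.+1)%:Z.
  by have := levY t Yt; rewrite -charge_level et es !charge_pure //=.
have pos (S : {set fsp * 'I_N}) : (#|S|)%:Z <= \sum_(y in S) (y.2.+1)%:Z.
  by rewrite -sum1_card (big_morph Posz PoszD (erefl _)); apply: ler_sum.
have nil (S : {set fsp * 'I_N}) : #|S| = 0%N -> \sum_(y in S) (y.2.+1)%:Z = 0.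
  by move/cards0_eq ->; rewrite big_set0.
have := pos t.2; have := pos s.2; rewrite lev => p1 p2.
(* If either set is empty the common level is 0, so both are empty, against a total of two
   elements. *)
have [cs|[cs ct]] : (#|s.2| = 0 \/ #|t.2| = 0)%N \/ (#|s.2| = 1 /\ #|t.2| = 1)%N by lia.
  by case: cs => /[dup] /nil e1 e2; [move: p2 | move: p1]; rewrite -?lev ?e1; lia.
have [[f i] si] : exists y, s.2 = [set y] by apply/cards1P/eqP.
have [[g j] tj] : exists y, t.2 = [set y] by apply/cards1P/eqP.
have fB : f = FB by have := s2 (f, i); rewrite si set11; apply.
have gC : g = FC by have := t2 (g, j); rewrite tj set11; apply.
have ij : j = i by move: lev; rewrite si tj !big_set1 /= => -[] /val_inj.
set n : int := (i.+1)%:Z.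
have nI : n \in I := ord_nzidx i.
have sn : (blevel s)%:Z = n by rewrite -charge_level es charge_pure // si big_set1 /level_weight /= opprK.
have ds : delta s = X sB (- n) (delta (vac N)).
  rewrite (X_fcr (FB, i)) fcr_kdelta inE /jw (_ : [set _ in _ | _] = set0); last first.
    by apply/setP => z; rewrite !inE.
  by rewrite cards0 expr0 scale1r setU0 es si fB.
(* The vacuum values of d^2 and M are in the ratio p^+ p^- + n, and the level of [s] is n. *)
have YB : X sB n Y = 0.
  rewrite /Y XD XN XZ ds dop2_B_vac // M_B_vac // scalerA -scalerBl.
  rewrite (_ : _ - _ = 0) ?scale0r // /c.
  have -> : (blevel s)%:R = n%:~R :> F by rewrite -sn.
  by ring.
move: YB; rewrite (X_fan (FB, i)) => /(congr1 (fun v : V => v (vac N))).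
rewrite /fan /= inE setU0 => /mulf_cancel0/(_ (jw_neq0 _ _ _)) Yt0.
by move: Yt; rewrite {1}et tj gC ij [Y _]Yt0 eqxx.
Qed.

(** Induction on the level: any creator other than b~ is stripped off by [squared_step], which
    leaves products of b~ creators only. *)
Lemma dop2_kdelta s : (blevel s <= N)%N -> squared s.
Proof.
have [l] := ubnP (blevel s); elim: l s => // l IHl s; rewrite ltnS => sl sN.
have IH s' : (blevel s' < blevel s)%N -> squared s'.
  by move=> s's; apply: IHl; [exact: leq_trans s's sl | exact: leq_trans (ltnW s's) sN].
have step t k s' a : t != sB -> k \in I -> k < 0 -> X t k (delta s') = a *: delta s ->
    a != 0 -> squared s.
  move=> tB kI k0 e a0; have lev := X_kdelta_level e a0.
  by apply: (squared_step tB kI sN _ e a0); [lia | apply: IH; lia].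
have [/existsP[x sx]|] := boolP [exists x, s.1 x != 0%N].
  apply: (step (inl x.1) (- (x.2.+1)%:Z) (bump_occ s.1 x false, s.2) 1) => //.
  - by rewrite nzidxN ord_nzidx.
  - by rewrite X_bcr bcr_kdelta bump_occVK // -surjective_pairing scale1r.
  - exact: oner_neq0.
rewrite negb_exists => /forallP s1.
have [/existsP[y /andP[sy yB]]|] := boolP [exists y, (y \in s.2) && (y.1 != FB)].
  apply: (step (inr y.1) (- (y.2.+1)%:Z) (s.1, s.2 :\ y) (jw F (s.2 :\ y) y)) => //.
  - by rewrite nzidxN ord_nzidx.
  - by rewrite X_fcr fcr_kdelta setD11 setD1K // -surjective_pairing.
  - exact: jw_neq0.
rewrite negb_exists => /forallP s2; apply: squared_B => // [|y ys].
  by apply/ffunP => x; rewrite ffunE; apply/eqP; have := s1 x; rewrite negbK.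
by apply/eqP; have := s2 y; rewrite ys negbK.
Qed.

Lemma dop_square v : hlev N%:Z v -> pp * pm + N%:R = 0 -> d (d v) = 0.
Proof.
move=> hv L0; rewrite (basis_expand hv) !dopsum big1 // => i _.
have := @dop2_kdelta (bstate (bof i)); rewrite /squared bstate_level L0 scale0r => e.
by rewrite !dopZ e ?scaler0 // leqnn.
Qed.

End SquareMain.

(** * The leading part of d, its contraction, and the reduced level *)

Lemma sum_bsp (U : nmodType) (G : bsp -> U) :
  \sum_s G s = G BAp + G BAm + G BBe + G BGa.
Proof.
rewrite (bigD1 BAp) // (bigD1 BAm) /=; last exact/eqP.
rewrite (bigD1 BBe) /=; last by apply/andP; split; apply/eqP.
rewrite (bigD1 BGa) /=; last by apply/andP; split; [apply/andP; split|]; apply/eqP.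
rewrite big1 ?addr0 ?addrA // => -[]; by rewrite ?eqxx ?andbF.
Qed.

Lemma sum_fsp (U : nmodType) (G : fsp -> U) :
  \sum_f G f = G FB + G FC + G FZ + G FE.
Proof.
rewrite (bigD1 FB) // (bigD1 FC) /=; last exact/eqP.
rewrite (bigD1 FZ) /=; last by apply/andP; split; apply/eqP.
rewrite (bigD1 FE) /=; last by apply/andP; split; [apply/andP; split|]; apply/eqP.
rewrite big1 ?addr0 ?addrA // => -[]; by rewrite ?eqxx ?andbF.
Qed.

Lemma sum_nzidx (U : nmodType) N (G : int -> U) :
  \sum_(n <- nzidx N) G n = \sum_(k < N) (G (k.+1)%:Z + G (- (k.+1)%:Z)).
Proof.
rewrite big_cat !big_map big_split /=.
by congr (_ + _); rewrite -{1}[N]subn0 big_mkord.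
Qed.

Section Leading.
Variables (F : numFieldType) (N : nat) (e : bool) (P : int -> F).
Local Notation V := (Vec F N).
Local Notation I := (nzidx N).
Local Notation br := (br F).
Local Notation sg := (sg F).
Implicit Types (v : V) (s : BState N) (t : sp) (n m k : int).

(* e = true is meant for the leading part of d with P = P^+, e = false for P = P^-. *)
Definition lead_mode : sp := if e then sAp else sAm.
Definition colead_mode : sp := if e then sAm else sAp.

Let br_ca n : br colead_mode lead_mode n = n%:~R.
Proof. by rewrite /lead_mode /colead_mode; case: e. Qed.
Let br_cc n : br colead_mode colead_mode n = 0.
Proof. by rewrite /colead_mode; case: e. Qed.
Let br_Cl n : br sC lead_mode n = 0. Proof. by rewrite /lead_mode; case: e. Qed.
Let br_Bc n : br sBe colead_mode n = 0. Proof. by rewrite /colead_mode; case: e. Qed.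
Let br_El n : br sE lead_mode n = 0. Proof. by rewrite /lead_mode; case: e. Qed.
Let br_Bl n : br sBe lead_mode n = 0. Proof. by rewrite /lead_mode; case: e. Qed.
Let br_cB n : br colead_mode sB n = 0. Proof. by rewrite /colead_mode; case: e. Qed.
Let br_cC n : br colead_mode sC n = 0. Proof. by rewrite /colead_mode; case: e. Qed.
Let br_cZ n : br colead_mode sZ n = 0. Proof. by rewrite /colead_mode; case: e. Qed.
Let br_cE n : br colead_mode sE n = 0. Proof. by rewrite /colead_mode; case: e. Qed.
Let br_cG n : br colead_mode sGa n = 0. Proof. by rewrite /colead_mode; case: e. Qed.
Let br_cBe n : br colead_mode sBe n = 0. Proof. by rewrite /colead_mode; case: e. Qed.
Let ferm_l : ferm lead_mode = false. Proof. by rewrite /lead_mode; case: e. Qed.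
Let ferm_c : ferm colead_mode = false. Proof. by rewrite /colead_mode; case: e. Qed.
Let sg_l t : sg t lead_mode = 1. Proof. by rewrite /sg ferm_l andbF. Qed.
Let sg_c t : sg t colead_mode = 1. Proof. by rewrite /sg ferm_c andbF. Qed.
Let sg_cl t : sg colead_mode t = 1. Proof. by rewrite /sg ferm_c. Qed.

Definition qop v : V := locked (\sum_(n <- I) P n *: X sC (- n) (X colead_mode n v)).

Lemma qop_linear : linear qop.
Proof.
move=> a u v; rewrite /qop -3!lock scaler_sumr -big_split; apply: eq_bigr => n _ /=.
by rewrite !Xlin; vring.
Qed.
HB.instance Definition _ := GRing.isLinear.Build F V V _ qop qop_linear.

Lemma qop_com t k v : (forall j, br colead_mode t j = 0) -> (forall j, br sC t j = 0) ->
  qop (X t k v) = sg sC t *: X t k (qop v).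
Proof.
move=> ct Ct; rewrite /qop -2!lock Xsum scaler_sumr; apply: eq_bigr => n _.
rewrite (XC0 n k _ ct) !Xlin (XC0 (- n) k _ Ct) sg_cl.
by vring.
Qed.

Lemma qop_B k v : k \in I -> qop (X sB k v) = - X sB k (qop v) + P k *: X colead_mode k v.
Proof.
move=> kI; rewrite /qop -2!lock Xsum -sumrN.
rewrite (_ : P k *: _ = \sum_(n <- I) if n == k then P n *: X colead_mode n v else 0).
  rewrite -big_split; apply: eq_bigr => n _ /=.
  rewrite (XC0 n k _ br_cB) !Xlin (XC sC sB (- n) k) nzidxN sg_cl.
  have -> : (- n + k == 0) = (n == k) by lia.
  by have [->|_] := eqVneq n k; rewrite ?kI /sg /=; vring.
by rewrite sum_delta kI.
Qed.

Lemma qop_lead k v : k \in I ->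
  qop (X lead_mode (- k) v) = X lead_mode (- k) (qop v) + (P k * k%:~R) *: X sC (- k) v.
Proof.
move=> kI; rewrite /qop -2!lock Xsum.
rewrite (_ : _ *: X sC (- k) v =
  \sum_(n <- I) if n == k then (P n * n%:~R) *: X sC (- n) v else 0).
  rewrite -big_split; apply: eq_bigr => n _ /=.
  rewrite (XC colead_mode lead_mode n (- k)) !Xlin (XC0 (- n) (- k) _ br_Cl) br_ca sg_cl sg_l.
  rewrite subr_eq0; have [->|_] := eqVneq n k; rewrite ?kI /=; vring.
by rewrite sum_delta kI.
Qed.

Definition dop0 v : V := locked (qop v + Qop v).

Lemma dop0_linear : linear dop0.
Proof. by move=> a u v; rewrite /dop0 -3!lock !linearP /=; vring. Qed.
HB.instance Definition _ := GRing.isLinear.Build F V V _ dop0 dop0_linear.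

Lemma dop0_com t k v : (forall j, br colead_mode t j = 0) -> (forall j, br sC t j = 0) ->
  (forall j, br sE t j = 0) -> (forall j, br sBe t j = 0) ->
  dop0 (X t k v) = sg sC t *: X t k (dop0 v).
Proof.
by move=> h1 h2 h3 h4; rewrite /dop0 -2!lock qop_com // Qop_com // !Xlin; vring.
Qed.

Lemma dop0D u v : dop0 (u + v) = dop0 u + dop0 v. Proof. exact: linearD. Qed.
Lemma dop0Z a v : dop0 (a *: v) = a *: dop0 v. Proof. by rewrite linearZ. Qed.
Lemma dop0sum (A : Type) (r : seq A) (Q : pred A) (f : A -> V) :
  dop0 (\sum_(i <- r | Q i) f i) = \sum_(i <- r | Q i) dop0 (f i).
Proof. exact: linear_sum. Qed.

Lemma dop0_expand v : dop0 v =
  \sum_(n <- I) (P n *: X sC (- n) (X colead_mode n v) + X sE n (X sBe (- n) v)).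
Proof. by rewrite /dop0 -lock /qop -lock /Qop -lock big_split. Qed.

(** No two modes occurring in the leading part contract, so [dop0] anticommutes with each of its own
    summands and its square is its own negative. *)
Lemma dop0_sqr v : dop0 (dop0 v) = 0.
Proof.
apply: self_opp_eq0; rewrite [in LHS](dop0_expand v) dop0sum [in RHS](dop0_expand (dop0 v)) -sumrN.
apply: eq_bigr => n _.
rewrite dop0D dop0Z (dop0_com (t := sC)) // (dop0_com (t := colead_mode)) //.
rewrite (dop0_com (t := sE)) // (dop0_com (t := sBe)) // sg_c /sg /= !Xlin.
by vring.
Qed.

(** At a resonance P n = 0 the convention 0^-1 = 0 drops the summand by itself; [num_op] records
    this in the factor [(P n != 0)]. *)
Definition contr v : V := locked (\sum_(n <- I)
  ((P n)^-1 *: X sB n (X lead_mode (- n) v) + n%:~R *: X sZ (- n) (X sGa n v))).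

Lemma contr_linear : linear contr.
Proof.
move=> a u v; rewrite /contr -3!lock scaler_sumr -big_split; apply: eq_bigr => n _ /=.
by rewrite !Xlin; vring.
Qed.
HB.instance Definition _ := GRing.isLinear.Build F V V _ contr contr_linear.

Lemma dop0_Ga k v : k \in I -> dop0 (X sGa k v) = X sGa k (dop0 v) - X sE k v.
Proof.
move=> kI; rewrite /dop0 -2!lock qop_com // Qop_Ga // !Xlin.
by rewrite /sg /=; vring.
Qed.

Lemma dop0_Z k v : k \in I -> dop0 (X sZ k v) = - X sZ k (dop0 v) + X sBe k v.
Proof.
move=> kI; rewrite /dop0 -2!lock qop_com // Qop_Z // !Xlin.
by rewrite /sg /=; vring.
Qed.

Lemma dop0_B k v : k \in I -> dop0 (X sB k v) = - X sB k (dop0 v) + P k *: X colead_mode k v.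
Proof.
move=> kI; rewrite /dop0 -2!lock qop_B // Qop_com // !Xlin.
by rewrite /sg /=; vring.
Qed.

Lemma dop0_lead k v : k \in I ->
  dop0 (X lead_mode (- k) v) = X lead_mode (- k) (dop0 v) + (P k * k%:~R) *: X sC (- k) v.
Proof.
move=> kI; rewrite /dop0 -2!lock qop_lead // Qop_com // !Xlin sg_l.
by vring.
Qed.

Definition num_op n v : V :=
  (P n != 0)%:R *: (X colead_mode n (X lead_mode (- n) v) - n%:~R *: X sB n (X sC (- n) v))
  + n%:~R *: (X sBe (- n) (X sGa n v) + X sZ (- n) (X sE n v)).

Lemma dop0_contr v : dop0 (contr v) + contr (dop0 v) = \sum_(n <- I) num_op n v.
Proof.
rewrite /contr -2!lock dop0sum -big_split !big_seq; apply: eq_bigr => n nI /=.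
rewrite dop0D !dop0Z dop0_B // dop0_lead // dop0_Z ?nzidxN // dop0_Ga // !Xlin /num_op.
have [->|Pn] := eqVneq (P n) 0; first by rewrite invr0; vring.
rewrite !scalerDr !scalerN !scalerDr !scalerA !mulrA mulVf //=.
by vring.
Qed.

(** Its charge is the eigenvalue of {d_0, K}: the level without the resonant creators. The argument
    of P is the summation index with which the mode enters d_0 or K, which explains the signs. *)
Definition reduced_weight (o : mop) : int :=
  match o with
  | OB BAp n => if P (if e then - n else n) != 0 then - n else 0
  | OB BAm n => if P (if e then n else - n) != 0 then - n else 0
  | OF FC n => if P (- n) != 0 then - n else 0
  | OF FB n => if P n != 0 then - n else 0
  | OB _ n | OF _ n => - n
  end.

Lemma odd_reduced : odd_weight reduced_weight.
Proof.
rewrite /odd_weight /reduced_weight.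
by case=> [[]|[]] n /=; case: (e); rewrite ?opprK //; case: ifP; rewrite ?oppr0 ?opprK.
Qed.

Lemma bcr_ban x v s : bcr x (ban x v) s = (s.1 x)%:R * v s.
Proof.
rewrite /bcr /ban; case: s => o S /=; case: eqP => [->|/eqP ox]; first by rewrite mul0r.
by rewrite bump_occE eqxx bump_occVK // prednK // lt0n.
Qed.

Lemma fcr_fan y v s : fcr y (fan y v) s = (y \in s.2)%:R * v s.
Proof.
rewrite /fcr /fan; case: s => o S /=; case: ifP => yS; last by rewrite mul0r.
by rewrite setD11 mulrA jwD // fprec_irr mul1r jw_sqr setD1K.
Qed.

End Leading.

Lemma sum_pair (U : nmodType) (T : finType) N (G : T * 'I_N -> U) :
  \sum_x G x = \sum_(k < N) \sum_t G (t, k).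
Proof. by rewrite exchange_big pair_bigA /=; apply: eq_bigr => -[]. Qed.

Section Reduced.
Variables (F : numFieldType) (N : nat) (e : bool) (P : int -> F).
Local Notation V := (Vec F N).
Local Notation I := (nzidx N).
Local Notation lead := (lead_mode e).
Local Notation colead := (colead_mode e).
Local Notation rw := (reduced_weight e P).
Local Notation dop0 := (dop0 e P).
Local Notation numop := (num_op e P).
Implicit Types (v : V) (s : BState N) (n m : int).

Lemma boson_number (t : bsp) (k : 'I_N) v s :
  X (inl t) (- (k.+1)%:Z) (X (inl (bpartner t)) (k.+1)%:Z v) s =
  acoef F (bpartner t) (k.+1)%:Z * ((s.1 (t, k))%:R * v s).
Proof.
by rewrite (X_bcr (t, k)) (X_ban (bpartner t, k)) linearZ /= bpartnerK vscaleE bcr_ban.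
Qed.

Lemma fermion_number (f : fsp) (k : 'I_N) v s :
  X (inr f) (- (k.+1)%:Z) (X (inr (fpartner f)) (k.+1)%:Z v) s =
  ((f, k) \in s.2)%:R * v s.
Proof. by rewrite (X_fcr (f, k)) (X_fan (fpartner f, k)) /= fpartnerK fcr_fan. Qed.

Lemma numop_pos (k : 'I_N) v s (n := (k.+1)%:Z) : numop n v s =
  n%:~R * ((P n != 0)%:R * ((s.1 (if e then BAp else BAm, k))%:R + ((FC, k) \in s.2)%:R)
   + ((s.1 (BBe, k))%:R + ((FZ, k) \in s.2)%:R)) * v s.
Proof.
have nI : n \in I := ord_nzidx k.
rewrite /num_op /lead_mode /colead_mode XC (XC sB sC) !subrr eqxx nI /= !vE.
rewrite (boson_number BBe) !(fermion_number FC) (fermion_number FZ) /=.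
rewrite (_ : X (if e then sAp else sAm) (- n) (X (if e then sAm else sAp) n v) s =
    n%:~R * ((s.1 (if e then BAp else BAm, k))%:R * v s)); last first.
  by case: e; [apply: (boson_number BAp) | apply: (boson_number BAm)].
rewrite (_ : sg F _ _ = 1); last by case: e.
rewrite (_ : br F (if e then sAm else sAp) _ n = n%:~R); last by case: e.
by rewrite /sg /=; ring.
Qed.

Lemma numop_neg (k : 'I_N) v s (n := (k.+1)%:Z) : numop (- n) v s =
  n%:~R * ((P (- n) != 0)%:R * ((s.1 (if e then BAm else BAp, k))%:R + ((FB, k) \in s.2)%:R)
   + ((s.1 (BGa, k))%:R + ((FE, k) \in s.2)%:R)) * v s.
Proof.
have nI : n \in I := ord_nzidx k.
rewrite /num_op /lead_mode /colead_mode !opprK (XC sBe sGa) (XC sZ sE) !subrr eqxx nI /= !vE.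
rewrite (boson_number BGa) !(fermion_number FB) (fermion_number FE) /=.
rewrite (_ : X (if e then sAm else sAp) (- n) (X (if e then sAp else sAm) n v) s =
    n%:~R * ((s.1 (if e then BAm else BAp, k))%:R * v s)); last first.
  by case: e; [apply: (boson_number BAm) | apply: (boson_number BAp)].
by rewrite mulrNz /sg /=; ring.
Qed.

Lemma sum_numop v s : (\sum_(n <- I) numop n v) s = (charge rw s)%:~R * v s.
Proof.
rewrite vsumE sum_nzidx.
have -> : charge rw s = \sum_(k < N) (k.+1)%:Z *
   ((P (k.+1)%:Z != 0)%:Z * ((s.1 (if e then BAp else BAm, k))%:Z + ((FC, k) \in s.2)%:Z)
   + ((s.1 (BBe, k))%:Z + ((FZ, k) \in s.2)%:Z)
   + ((P (- (k.+1)%:Z) != 0)%:Z * ((s.1 (if e then BAm else BAp, k))%:Z + ((FB, k) \in s.2)%:Z)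
   + ((s.1 (BGa, k))%:Z + ((FE, k) \in s.2)%:Z))).
  rewrite /charge [Y in _ + Y]big_mkcond /=.
  rewrite !sum_pair -big_split; apply: eq_bigr => k _ /=.
  rewrite sum_bsp sum_fsp /bmode /fmode /= !opprK.
  have ifE (b : bool) (x : int) : (if b then x else 0) = b%:Z * x.
    by case: b; rewrite ?mul1r ?mul0r.
  case: e; rewrite !ifE; ring.
rewrite rmorph_sum mulr_suml; apply: eq_bigr => k _ /=.
rewrite numop_pos numop_neg ?(rmorphB, rmorphD, rmorphN, rmorphM) /=.
by ring.
Qed.

Lemma dop0_contr_diag v s : (dop0 (contr e P v) + contr e P (dop0 v)) s =
  (charge rw s)%:~R * v s.
Proof. by rewrite dop0_contr sum_numop. Qed.

Lemma reduced_mode_ge0 t (k : 'I_N) : 0 <= rw (mk t (- (k.+1)%:Z)).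
Proof. by case: t => [[]|[]] /=; rewrite /mk /= ?opprK //; case: ifP. Qed.

Lemma reduced_ge0 s : 0 <= charge rw s.
Proof.
apply: addr_ge0; apply: sumr_ge0 => x _; last exact: (reduced_mode_ge0 (inr x.1)).
by apply: mulr_ge0 => //; apply: (reduced_mode_ge0 (inl x.1)).
Qed.

Lemma reduced_low t n v : homog rw 0 v -> rw (mk t n) < 0 -> X t n v = 0.
Proof.
move=> hv neg; apply/funext => s; apply/eqP; rewrite vzeroE; apply: contraT => Xs.
have := @homog_XW F N rw (@odd_reduced F e P) t n 0 v hv s Xs.
by rewrite add0r; have := reduced_ge0 s; lia.
Qed.

(** With its two factors in a suitable order, each summand with P n nonzero begins with a mode of
    negative reduced weight, and no reduced level lies below 0. The eta~ beta terms vanish in the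
    same way. *)
Lemma dop0_reduced0 s : charge rw s = 0 -> dop0 (kdelta F s) = 0.
Proof.
move=> s0; have hs : homog rw 0 (kdelta F s) by rewrite -s0; apply: homog_kdelta.
rewrite dop0_expand big_seq big1 // => n nI; have n0 := nzidx_neq0 nI.
have -> : X sE n (X sBe (- n) (kdelta F s)) = 0.
  have [nn|nn] := ltP n 0; first by rewrite (reduced_low hs) ?X0 //= opprK.
  by rewrite (XC0 (s := sE)) // (reduced_low hs) ?X0 ?scaler0 //= oppr_lt0; lia.
rewrite addr0; have [->|Pn] := eqVneq (P n) 0; first by rewrite scale0r.
have [nn|nn] := ltP n 0.
  rewrite (XC0 (s := sC)); last by rewrite /colead_mode; case: e.
  by rewrite (reduced_low hs) ?X0 ?scaler0 // /mk /= !opprK Pn.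
rewrite (reduced_low hs) ?X0 ?scaler0 // /colead_mode /mk.
by case: e => /=; rewrite ?opprK Pn oppr_lt0; lia.
Qed.

Section Weights.
Variables (W : mop -> int) (oddW : odd_weight W) (r q : int) (v : V).
Hypothesis hv : homog W q v.

Lemma homog_dop0 : (forall n, W (mk sC (- n)) + W (mk colead n) = r) ->
  (forall n, W (mk sE n) + W (mk sBe (- n)) = r) -> homog W (q + r) (dop0 v).
Proof.
move=> h1 h2; rewrite dop0_expand; apply: homog_sum => n _ _; apply: homogD.
  by apply: homogZ; rewrite -(h1 n) addrCA addrC; apply/homog_XW/homog_XW.
by rewrite -(h2 n) addrCA addrC; apply/homog_XW/homog_XW.
Qed.

Lemma homog_contr : (forall n, W (mk sB n) + W (mk lead (- n)) = r) ->
  (forall n, W (mk sZ (- n)) + W (mk sGa n) = r) -> homog W (q + r) (contr e P v).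
Proof.
move=> h1 h2; rewrite /contr -lock; apply: homog_sum => n _ _; apply: homogD.
  by apply: homogZ; rewrite -(h1 n) addrCA addrC; apply/homog_XW/homog_XW.
by apply: homogZ; rewrite -(h2 n) addrCA addrC; apply/homog_XW/homog_XW.
Qed.

End Weights.

Definition degree_weight (o : mop) : int :=
  match o with
  | OB BAp _ => if e then 1 else -1 | OB BAm _ => if e then -1 else 1
  | OF FC _ => 1 | OF FB _ => -1 | _ => 0
  end.

Lemma odd_degree : odd_weight degree_weight.
Proof. by rewrite /degree_weight; case=> [[]|[]] n /=; case: e. Qed.

Variable P' : int -> F.

(** The rest of d, split by degree: [pert1] raises it by 1, [pert2] by 2. *)
Definition pert1 v : V :=
  \sum_(n <- I) X sC (- n) (J (fun=> 1) sAp sAm n v + J (fun m => m%:~R) sZ sE n v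
     + J (fun m => m%:~R) sBe sGa n v) + gh v.
Definition pert2 v : V := \sum_(n <- I) P' n *: X sC (- n) (X lead n v).

Lemma dop_split v : dop (if e then P else P') (if e then P' else P) v =
  dop0 v + (pert1 v + pert2 v).
Proof.
rewrite /dop -lock /cL -lock dop0_expand /Qop -lock big_split /= /pert1 /pert2.
rewrite (_ : \sum_(n <- I) X sC (- n) (Lm _ _ n v) =
  \sum_(n <- I) P n *: X sC (- n) (X colead n v)
  + \sum_(n <- I) P' n *: X sC (- n) (X lead n v)
  + \sum_(n <- I) X sC (- n) (J (fun=> 1) sAp sAm n v + J (fun m => m%:~R) sZ sE n v
     + J (fun m => m%:~R) sBe sGa n v)).
  by vring.
rewrite -!big_split; apply: eq_bigr => n _ /=; rewrite /Lm -lock !Xlin /lead_mode /colead_mode.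
by case: e; vring.
Qed.

Lemma homog_pert1 q v : homog degree_weight q v -> homog degree_weight (q + 1) (pert1 v).
Proof.
move=> hv; apply: homogD; last by apply: (homog_gh odd_degree) => // *; rewrite /mk /=.
apply: homog_sum => n _ _; apply: (homog_XW odd_degree (s := sC)).
rewrite -[q]addr0; do ![apply: homogD]; apply: (homog_J odd_degree _ hv) => m;
  by rewrite /mk /=; case: e.
Qed.

Lemma homog_pert2 q v : homog degree_weight q v -> homog degree_weight (q + 2) (pert2 v).
Proof.
move=> hv; apply: homog_sum => n _ _; apply: homogZ.
rewrite -[2]/(1 + 1) addrA; apply: (homog_XW odd_degree (s := sC)).
have -> : 1 = degree_weight (mk lead n) by rewrite /degree_weight /lead_mode /mk; case: e.
exact: (homog_XW odd_degree).
Qed.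

End Reduced.

(** * Homological perturbation for matrices *)

Section Cohomology.
Variables (F : fieldType) (n : nat).
Implicit Types (A B D : 'M[F]_n).

(** A homotopy from 1 to p, with p D = D p = 0, splits the cycles of each ghost number into the
    image of p and the boundaries, so the image of p represents the cohomology. *)
Lemma rank_cohomology (D p h : 'M[F]_n) (G : int -> 'M[F]_n) (g : int) :
  D *m D = 0 -> p *m D = 0 -> D *m p = 0 -> p *m p = p ->
  p + D *m h + h *m D = 1%:M ->
  (forall i, G i *m G i = G i) -> (forall i, G i *m p = p *m G i) ->
  (forall i, G i *m D = D *m G (i + 1)) -> (forall i, G i *m h = h *m G (i - 1)) ->
  (\rank (kermx D :&: G g)%MS - \rank (G (g - 1)%R *m D))%N = \rank (p *m G g).
Proof.
move=> DD pD Dp pp hom GG Gp GD Gh.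
have GD' : G (g - 1) *m D = D *m G g by rewrite GD subrK.
have eqs : (kermx D :&: G g :=: p *m G g + G (g - 1)%R *m D)%MS.
  apply/eqmxP/andP; split; last first.
    rewrite addsmx_sub !sub_capmx; apply/andP; split.
      by rewrite -Gp; apply/andP; split; [apply/sub_kermxP; rewrite -mulmxA pD mulmx0 | rewrite Gp submxMl].
    by apply/andP; split; [apply/sub_kermxP; rewrite -mulmxA DD mulmx0 | rewrite GD' submxMl].
  set B := (kermx D :&: G g)%MS.
  have BD : B *m D = 0 by apply/sub_kermxP; apply: capmxSl.
  have BG : B *m G g = B.
    by have /submxP[C BC] := capmxSr (kermx D) (G g); rewrite /B BC -mulmxA GG.
  rewrite -[B]mulmx1 -hom !mulmxDr !mulmxA BD mul0mx addr0.
  rewrite -{1 2}BG -[B *m G g *m p]mulmxA Gp -[B *m G g *m h]mulmxA Gh.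
  by rewrite mulmxA -mulmxA addmx_sub_adds // ?submxMl // mulmxA -mulmxA submxMl.
have dis : (p *m G g :&: G (g - 1)%R *m D)%MS = 0.
  apply/eqP; rewrite -submx0; set Y := (_ :&: _)%MS.
  have /submxP[A YA] : (Y <= p *m G g)%MS by apply: capmxSl.
  have /submxP[B YB] : (Y <= G (g - 1)%R *m D)%MS by apply: capmxSr.
  have -> : Y = Y *m p by rewrite YA -[RHS]mulmxA -Gp -[G g *m p *m p]mulmxA pp.
  by rewrite YB -!mulmxA Dp !mulmx0 sub0mx.
by rewrite eqs mxrank_disjoint_sum // addnK.
Qed.

Variable deg : 'I_n -> int.

Definition raising (r : int) A := forall i j, A i j != 0 -> deg i + r <= deg j.

Lemma raising0 r : raising r 0.
Proof. by move=> i j; rewrite mxE eqxx. Qed.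

Lemma raising1 : raising 0 1%:M.
Proof. by move=> i j; rewrite mxE; case: (eqVneq i j) => [->|]; rewrite ?addr0 ?eqxx. Qed.

Lemma raisingD r A B : raising r A -> raising r B -> raising r (A + B).
Proof.
move=> hA hB i j; rewrite mxE; have [A0|/hA //] := eqVneq (A i j) 0.
by rewrite A0 add0r => /hB.
Qed.

Lemma raisingN r A : raising r A -> raising r (- A).
Proof. by move=> hA i j; rewrite mxE oppr_eq0 => /hA. Qed.

Lemma raisingM r s A B : raising r A -> raising s B -> raising (r + s) (A *m B).
Proof.
move=> hA hB i j; rewrite mxE => AB.
have [k /andP[Aik Bkj]] : exists k, (A i k != 0) && (B k j != 0).
  apply/existsP; apply: contraNT AB; rewrite negb_exists => /forallP h.
  apply/eqP; apply: big1 => k _; apply/eqP; rewrite mulf_eq0.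
  by have := h k; rewrite negb_and !negbK.
by rewrite addrA; apply: le_trans (hB _ _ Bkj); rewrite lerD2r hA.
Qed.

(** A strictly raising matrix is nilpotent, as only finitely many degrees occur; the inverse is the
    finite Neumann series. *)
Lemma raising_unipotent A : raising 1 A ->
  exists U : 'M[F]_n, [/\ U *m (1%:M + A) = 1%:M, (1%:M + A) *m U = 1%:M & raising 0 U].
Proof.
move=> hA.
have hX k : raising k%:Z ((- A) ^+ k).
  elim: k => [|k IH]; first exact: raising1.
  by rewrite exprS -mulmxE -[k.+1]add1n PoszD; apply: raisingM; [apply: raisingN|].
(* All degrees lie in [-b, b], so raising by more than 2b is impossible. *)
pose b := (\sum_i `|deg i|)%N.
have degb i : (`|deg i| <= b)%N by rewrite /b (bigD1 i) //= leq_addr.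
have nil : (- A) ^+ (b + b).+1 = 0.
  apply/matrixP => i j; rewrite [RHS]mxE; apply/eqP; apply: contraT => /hX.
  by have := degb i; have := degb j; lia.
exists (\sum_(i < (b + b).+1) (- A) ^+ i).
have e : (1%:M + A) *m \sum_(i < (b + b).+1) (- A) ^+ i = 1%:M.
  have := subrX1 (- A) (b + b).+1; rewrite nil sub0r -mulmxE => e1.
  have -> : 1%:M + A = - (- A - 1) by rewrite opprB opprK.
  by rewrite mulNmx -e1 opprK.
split; [exact: mulmx1C | exact: e |].
elim/big_ind: _ => [|x y|i _]; [exact: raising0 | exact: raisingD |].
by move=> k l /hX; lia.
Qed.

(* Homological perturbation: the leading part D0 of D has the contraction h onto
   p, and no perturbed differential can survive on p as p sits in one degree. *)
Lemma perturbation (D D0 p h : 'M[F]_n) (G : int -> 'M[F]_n) (q0 : int) (g : int) :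
  raising 0 D0 -> raising 1 (D - D0) -> raising 0 h ->
  (forall i j, p i j != 0 -> i = j /\ deg i = q0) ->
  D *m D = 0 -> D0 *m D0 = 0 -> p *m D0 = 0 -> D0 *m p = 0 -> p *m p = p ->
  p + D0 *m h + h *m D0 = 1%:M ->
  (forall i, G i *m G i = G i) -> (forall i, G i *m p = p *m G i) ->
  (forall i, G i *m D = D *m G (i + 1)) -> (forall i, G i *m D0 = D0 *m G (i + 1)) ->
  (forall i, G i *m h = h *m G (i - 1)) ->
  (\rank (kermx D :&: G g)%MS - \rank (G (g - 1)%R *m D))%N = \rank (p *m G g).
Proof.
move=> rD0 rdl rh pd DD D0D0 pD0 D0p pp hom GG Gp GD GD0 Gh.
have [dl dlE] : exists dl, dl = D - D0 by exists (D - D0).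
have Ddl : D = D0 + dl by rewrite dlE addrC subrK.
rewrite -dlE in rdl.
have rp : raising 0 p by move=> i j /pd[-> _]; rewrite addr0.
have rdh : raising 1 (dl *m h) by rewrite -[1]addr0; apply: raisingM.
(* U = (1 + dl h)^-1 is the series of the perturbation lemma; p U corrects the representatives of
   the cohomology of D0. *)
have [U [Ul Ur rU]] := raising_unipotent rdh.
have pU : p *m U = p - p *m U *m dl *m h.
  have UE : U = 1%:M - U *m dl *m h by rewrite -Ul mulmxDr mulmx1 !mulmxA addrK.
  by rewrite {1}UE mulmxBr mulmx1 !mulmxA.
(* This is the differential that the perturbation induces on the image of p. It would raise the
   degree by at least 1, while p starts and ends in degree q0. *)
have pUdp : p *m U *m dl *m p = 0.
  apply/matrixP => i j; rewrite [RHS]mxE mxE; apply: big1 => k _; apply/eqP.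
  apply: contraT; rewrite mulf_eq0 negb_or => /andP[a1 /pd[ekj degk]].
  move: a1; rewrite -mulmxA mxE => a1.
  have [l /andP[a2 a3]] : exists l, (p i l != 0) && ((U *m dl) l k != 0).
    apply/existsP; apply: contraNT a1; rewrite negb_exists => /forallP hl.
    apply/eqP; apply: big1 => l _; apply/eqP; rewrite mulf_eq0.
    by have := hl l; rewrite negb_and !negbK.
  have [_ degi] := pd _ _ a2; have [eil _] := pd _ _ a2.
  have := raisingM rU rdl a3; rewrite -eil degi degk; lia.
(* Y is the failure of the corrected representatives to be cycles of D. From D^2 = 0 follows Y (1 +
   dl h) = 0, and the second factor is invertible. *)
pose Y := p *m U *m D.
have YE : Y = p *m U *m dl *m D0 *m h.
  have e1 : p *m U *m D0 = - (p *m U *m dl *m h *m D0).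
    by rewrite {1}pU mulmxBl pD0 sub0r.
  rewrite /Y Ddl mulmxDr e1.
  have -> : p *m U *m dl *m h *m D0 = p *m U *m dl *m (1%:M - p - D0 *m h).
    by rewrite -mulmxA -addrA -opprD -hom [p + _ + _]addrC addrK.
  rewrite !mulmxBr mulmx1 pUdp subr0 opprB addrNK.
  by rewrite !mulmxA.
have YD : Y *m D = 0 by rewrite /Y -mulmxA DD mulmx0.
have YD0 : Y *m D0 = p *m U *m dl *m D0.
  have : Y *m D0 = p *m U *m D *m D0 by [].
  by rewrite Ddl mulmxDr mulmxDl -[p *m U *m D0 *m D0]mulmxA D0D0 mulmx0 add0r.
have Y0 : Y = 0.
  have e1 : Y *m D0 = - (Y *m dl) by apply/eqP; rewrite -addr_eq0 -mulmxDr -Ddl YD.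
  have e2 : Y *m (1%:M + dl *m h) = 0.
    by rewrite mulmxDr mulmx1 mulmxA {1}YE -YD0 e1 mulNmx addNr.
  by rewrite -[Y]mulmx1 -Ur mulmxA e2 mul0mx.
(* Phi deforms the decomposition 1 = p + D0 h + h D0: p becomes p U, D0 h is kept, and in h D0 = h
   D0 h D0 the last D0 becomes D. It intertwines D with D0 and differs from 1 by a strictly raising
   matrix. *)
pose Phi := p *m U + D0 *m h + h *m D0 *m h *m D.
have D0h : D0 *m h *m D0 = D0.
  have : D0 *m (p + D0 *m h + h *m D0) = D0 by rewrite hom mulmx1.
  by rewrite !mulmxDr D0p add0r !mulmxA D0D0 mul0mx add0r.
have hD0 : D0 *m h *m D0 *m h = D0 *m h by rewrite D0h.
have PhiD : Phi *m D = D0 *m Phi.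
  rewrite /Phi !mulmxDl !mulmxDr -[p *m U *m D]/Y Y0 add0r !mulmxA D0p mul0mx add0r.
  by rewrite D0D0 mul0mx add0r D0h -[_ *m D *m D]mulmxA DD mulmx0 addr0.
have [Psi [Psil Psir _]] : exists U' : 'M[F]_n,
    [/\ U' *m Phi = 1%:M, Phi *m U' = 1%:M & raising 0 U'].
  have -> : Phi = 1%:M + (h *m D0 *m h *m dl - p *m U *m dl *m h).
    have e : h *m D0 *m h *m D0 = h *m D0 by rewrite -!mulmxA [D0 *m (h *m D0)]mulmxA D0h.
    rewrite /Phi {1}pU Ddl mulmxDr e -hom -!addrA; congr (_ + _).
    by rewrite addrC -!addrA.
  have r00 A B : raising 0 A -> raising 0 B -> raising 0 (A *m B).
    by move=> hA hB; rewrite -[0]addr0; apply: raisingM.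
  have r01 A : raising 0 A -> raising 1 (A *m dl).
    by move=> hA; rewrite -[1]add0r; apply: raisingM.
  apply: raising_unipotent; apply: raisingD; first exact/r01/(r00 _ _ _ rh)/(r00 _ _ rh rD0).
  by apply: raisingN; rewrite -[1]addr0; apply: (raisingM _ rh); exact/r01/(r00 _ _ rp rU).
have Gdl i : G i *m dl = dl *m G (i + 1) by rewrite dlE mulmxBr GD GD0 -mulmxBl.
have GU i : G i *m U = U *m G i.
  have c : G i *m (dl *m h) = dl *m h *m G i.
    by rewrite mulmxA Gdl -[LHS]mulmxA Gh addrK mulmxA.
  rewrite -[LHS]mul1mx -Ul -!mulmxA; congr (_ *m _); rewrite !mulmxA mulmxDl mul1mx -c.
  by rewrite -{1}[G i]mulmx1 -mulmxDr -mulmxA Ur mulmx1.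
have GPhi i : G i *m Phi = Phi *m G i.
  rewrite /Phi !mulmxDr !mulmxDl; congr (_ + _ + _).
  - by rewrite mulmxA Gp -mulmxA GU mulmxA.
  - by rewrite mulmxA GD0 -mulmxA Gh addrK mulmxA.
  - rewrite 3!mulmxA Gh -[h *m _ *m D0]mulmxA GD0 subrK mulmxA -[_ *m G i *m h]mulmxA Gh.
    by rewrite mulmxA -mulmxA GD subrK mulmxA.
have GPsi i : G i *m Psi = Psi *m G i.
  by rewrite -[LHS]mul1mx -Psil -!mulmxA; congr (_ *m _); rewrite !mulmxA -GPhi -mulmxA Psir mulmx1.
have DE : D = Psi *m D0 *m Phi by rewrite -mulmxA -PhiD mulmxA Psil mul1mx.
clearbody Phi.
(* Conjugation by Phi turns the contraction of D0 into one of D and fixes the grading projectors,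
   which commute with Phi. *)
pose conj (A : 'M[F]_n) := Psi *m A *m Phi.
have conjM A B : conj A *m conj B = conj (A *m B).
  by rewrite /conj !mulmxA -[Psi *m A *m Phi *m Psi]mulmxA Psir mulmx1.
have conj0 : conj 0 = 0 by rewrite /conj mulmx0 mul0mx.
have conjD A B : conj A + conj B = conj (A + B) by rewrite /conj mulmxDr mulmxDl.
have conjG i : G i = conj (G i) by rewrite /conj -GPsi -mulmxA Psil mulmx1.
rewrite -/(conj D0) in DE.
rewrite (rank_cohomology (p := conj p) (h := conj h)) //.
- rewrite {1}(conjG g) conjM /conj; apply/eqP; rewrite eqn_leq; apply/andP; split.
    by apply: leq_trans (mxrankM_maxl _ _) _; apply: mxrankM_maxr.
  rewrite {1}(_ : p *m G g = Phi *m (Psi *m (p *m G g) *m Phi) *m Psi); last first.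
    by rewrite !mulmxA Psir mul1mx -mulmxA Psir mulmx1.
  by apply: leq_trans (mxrankM_maxl _ _) _; apply: mxrankM_maxr.
- by rewrite DE conjM pD0 conj0.
- by rewrite DE conjM D0p conj0.
- by rewrite conjM pp.
- by rewrite DE !conjM !conjD hom /conj mulmx1 Psil.
- by move=> i; rewrite (conjG i) !conjM Gp.
- by move=> i; rewrite (conjG i) (conjG (i - 1)) !conjM Gh.
Qed.

End Cohomology.

(** * Application to the matrices of d and its leading part *)

Section Assembly.
Variables (F : numFieldType) (N : nat) (pp pm : F) (e : bool).
Let Pp n : F := pp - n%:~R.
Let Pm n : F := pm + n%:~R.
Let P := if e then Pp else Pm.
Let P' := if e then Pm else Pp.
Local Notation V := (Vec F N).
Local Notation rw := (reduced_weight e P).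
Local Notation st i := (bstate (bof i)).
Implicit Types (v : V).

Let dopE v : dop Pp Pm v = dop0 e P v + (pert1 v + pert2 e P' v).
Proof. by rewrite -dop_split /P /P'; case: e. Qed.

Lemma opmx_homog W r (O : V -> V) :
  (forall q v, homog W q v -> homog W (q + r) (O v)) ->
  forall i j, opmx O i j != 0 -> charge W (st j) = charge W (st i) + r.
Proof.
move=> hO i j; rewrite mxE => Oij.
exact: (hO (charge W (st i)) (kdelta F (st i)) (@homog_kdelta F N W (st i)) (st j) Oij).
Qed.

Definition gradmx (T : eqType) (f : BState N -> T) (g : T) : 'M[F]_(nB N) :=
  diag_mx (\row_i (f (st i) == g)%:R).

Lemma gradmx_idem (T : eqType) (f : BState N -> T) g :
  gradmx f g *m gradmx f g = gradmx f g.
Proof.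
apply/matrixP => i j; rewrite mul_diag_mx !mxE.
by case: eqP => _; rewrite ?mul1r ?mul0r ?mul0rn.
Qed.

Lemma gradmx_comm (T U : eqType) (f : BState N -> T) (k : BState N -> U) g u :
  gradmx f g *m gradmx k u = gradmx k u *m gradmx f g.
Proof.
apply/matrixP => i j; rewrite !mul_diag_mx !mxE.
have [->|_] := eqVneq i j; last by rewrite !mulr0n !mulr0.
by rewrite !mulr1n mulrC.
Qed.

Lemma gradmx_shift (f : BState N -> int) g r (A : 'M[F]_(nB N)) :
  (forall i j, A i j != 0 -> f (st j) = f (st i) + r) ->
  gradmx f g *m A = A *m gradmx f (g + r).
Proof.
move=> hA; apply/matrixP => i j; rewrite mul_diag_mx mul_mx_diag !mxE.
have [->|/hA ->] := eqVneq (A i j) 0; first by rewrite mulr0 mul0r.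
by rewrite (inj_eq (addIr r)) mulrC.
Qed.

Theorem rank_reduced q0 : pp * pm + N%:R = 0 ->
  (forall s : BState N, blevel s = N -> charge rw s = 0 ->
     charge (degree_weight e) s = q0) ->
  forall (g : int) (D := opmx (dop Pp Pm : V -> V)),
  (\rank (kermx D :&: gradmx (@ghost N) g)%MS
   - \rank (gradmx (@ghost N) (g - 1)%R *m D))%N
  = \rank (gradmx (charge rw) 0 *m gradmx (@ghost N) g).
Proof.
move=> L0 hq0 g D.
pose D0 : 'M[F]_(nB N) := opmx (dop0 e P : V -> V).
pose K : 'M[F]_(nB N) := opmx (contr e P : V -> V).
pose nn (i : 'I_(nB N)) : F := (charge rw (st i))%:~R.
(* w inverts the eigenvalues of {d_0, K} and is 0 on the kernel, by 0^-1 = 0. It commutes with D0,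
   which preserves the reduced level, so w K is a homotopy onto p. *)
pose w : 'M[F]_(nB N) := diag_mx (\row_i (nn i)^-1).
pose p := gradmx (charge rw) 0.
have lev0 : level_preserving (dop0 e P : V -> V).
  move=> v hv; rewrite -[N%:Z]addr0; apply: (homog_dop0 odd_level hv) => n.
    by rewrite /colead_mode /mk /level_weight; case: e; rewrite /=; lia.
  by rewrite /mk /level_weight /=; lia.
have levK : level_preserving (contr e P : V -> V).
  move=> v hv; rewrite -[N%:Z]addr0; apply: (homog_contr odd_level hv) => n.
    by rewrite /lead_mode /mk /level_weight; case: e; rewrite /=; lia.
  by rewrite /mk /level_weight /=; lia.
have levD : level_preserving (dop Pp Pm : V -> V) by move=> v hv; apply: dop_level.
have ghost0 i j : D0 i j != 0 -> ghost (st j) = ghost (st i) + 1.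
  rewrite -!charge_ghost; apply: opmx_homog => q v hv.
  apply: (homog_dop0 odd_ghost hv) => n; last by [].
  by rewrite /colead_mode /mk; case: e.
have ghostK i j : K i j != 0 -> ghost (st j) = ghost (st i) - 1.
  rewrite -!charge_ghost; apply: opmx_homog => q v hv.
  apply: (homog_contr odd_ghost hv) => n; last by [].
  by rewrite /lead_mode /mk; case: e.
have ghostD i j : D i j != 0 -> ghost (st j) = ghost (st i) + 1.
  by rewrite -!charge_ghost; apply: opmx_homog => q v hv; apply: dop_ghost.
have red0 i j : D0 i j != 0 -> charge rw (st j) = charge rw (st i).
  rewrite -[RHS]addr0; apply: opmx_homog => q v hv.
  apply: (homog_dop0 (@odd_reduced F e P) hv) => n.
    rewrite /colead_mode /mk; case: e @P; rewrite /= ?opprK; case: ifP; lia.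
  by rewrite /mk /= opprK; lia.
have deg0 i j : D0 i j != 0 ->
    charge (degree_weight e) (st j) = charge (degree_weight e) (st i) + 0.
  apply: opmx_homog => q v hv; apply: (homog_dop0 (odd_degree e) hv) => n; last by [].
  by rewrite /degree_weight /colead_mode /mk; case: e.
have degK i j : K i j != 0 ->
    charge (degree_weight e) (st j) = charge (degree_weight e) (st i) + 0.
  apply: opmx_homog => q v hv; apply: (homog_contr (odd_degree e) hv) => n; last by [].
  by rewrite /degree_weight /lead_mode /mk; case: e.
have D0D0 : D0 *m D0 = 0.
  rewrite opmxM // -[RHS](_ : opmx (fun=> 0 : V) = 0); last by apply/matrixP => i j; rewrite !mxE.
  by apply: opmxP => v _ /=; rewrite dop0_sqr.
have DD : D *m D = 0.
  rewrite opmxM // -[RHS](_ : opmx (fun=> 0 : V) = 0); last by apply/matrixP => i j; rewrite !mxE.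
  by apply: opmxP => v hv /=; rewrite dop_square.
have KD : D0 *m K + K *m D0 = diag_mx (\row_i nn i).
  rewrite !opmxM //; apply/matrixP => i j; rewrite !mxE /= -vaddE addrC dop0_contr_diag.
  rewrite /kdelta (inj_eq (@bstate_inj N)) (inj_eq enum_val_inj) eq_sym.
  by case: eqP => [->|_]; rewrite ?mulr1 ?mulr0.
have wD0 : D0 *m w = w *m D0.
  apply/matrixP => i j; rewrite mul_diag_mx mul_mx_diag [LHS]mxE [RHS]mxE.
  rewrite ![(\row_ _ _) _ _]mxE; have [->|h] := eqVneq (D0 i j) 0; first by rewrite mulr0 mul0r.
  by rewrite /nn (red0 _ _ h) mulrC.
have pD0 : p *m D0 = 0.
  apply/matrixP => i j; rewrite mul_diag_mx !mxE; case: eqP => [nn0|]; last by rewrite mul0r.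
  by rewrite dop0_reduced0 // mulr0.
have D0p : D0 *m p = 0.
  have := @gradmx_shift (charge rw) 0 0 D0; rewrite addr0 -/p pD0 => -> // i j /red0 ->.
  by rewrite addr0.
have hom : p + D0 *m (w *m K) + w *m K *m D0 = 1%:M.
  rewrite mulmxA wD0 -!mulmxA -addrA -mulmxDr KD.
  apply/matrixP => i j; rewrite mul_diag_mx !mxE.
  have [_|_] := eqVneq i j; last by rewrite !mulr0n mulr0 addr0.
  rewrite !mulr1n /nn; have [->|n0] := eqVneq (charge rw (st i)) 0; first by rewrite mulr0 addr0.
  by rewrite add0r mulVf // intr_eq0.
pose deg (i : 'I_(nB N)) := charge (degree_weight e) (st i).
apply: (@perturbation F (nB N) deg D D0 p (w *m K) (gradmx (@ghost N)) q0 g) => //.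
- by move=> i j /deg0; rewrite /deg => ->.
- move=> i j; set v := kdelta F (st i).
  have hv : homog (degree_weight e) (deg i) v by apply: homog_kdelta.
  have -> : (D - D0) i j = pert1 v (st j) + pert2 e P' v (st j).
    by rewrite mxE [(- D0) i j]mxE !mxE -/v dopE !vaddE addrC addKr.
  have [->|h _] := eqVneq (pert1 v (st j)) 0.
    by rewrite add0r => h; rewrite {2}/deg (homog_pert2 hv h) lerD2l.
  by rewrite {2}/deg (homog_pert1 hv h).
- by move=> i j; rewrite mul_diag_mx mxE mulf_eq0 negb_or => /andP[_ /degK]; rewrite /deg => ->.
- move=> i j; rewrite !mxE; have [->|ij] := eqVneq i j; last by rewrite mulr0n eqxx.
  rewrite mulr1n pnatr_eq0 eqb0 negbK => /eqP nn0; split => //.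
  by apply: hq0 => //; apply: bstate_level.
- exact: gradmx_idem.
- by move=> i; apply: gradmx_idem.
- by move=> i; apply: gradmx_comm.
- by move=> i; apply: gradmx_shift.
- by move=> i; apply: gradmx_shift.
- move=> i; apply: gradmx_shift => k l; rewrite mul_diag_mx mxE mulf_eq0 negb_or => /andP[_].
  exact: ghostK.
Qed.

End Assembly.

(** * Counting the monomials of reduced level zero *)

Section Counting.
Variables (F : numFieldType) (N : nat).
Local Notation st i := (bstate (bof i)).
Local Notation gradmx := (gradmx F).

Lemma bof_surj (s : BState N) : blevel s = N -> exists i : 'I_(nB N), st i = s.
Proof.
by case/bstate_surj => x <-; exists (enum_rank x); rewrite /bof enum_rankK.
Qed.

Lemma rank_gradmx0 (T U : eqType) (f : BState N -> T) (k : BState N -> U) g u :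
  (forall s, blevel s = N -> f s = g -> k s = u -> False) ->
  \rank (gradmx f g *m gradmx k u) = 0%N.
Proof.
move=> h; apply/eqP; rewrite mxrank_eq0; apply/eqP/matrixP => i j.
rewrite mul_diag_mx !mxE; case: eqP => [fi|]; last by rewrite mul0r.
case: eqP => [ki|]; last by rewrite mul0rn mulr0.
by case: (h (st i)) => //; apply: bstate_level.
Qed.

Lemma rank_gradmx1 (T U : eqType) (f : BState N -> T) (k : BState N -> U) g u s0 :
  blevel s0 = N -> f s0 = g -> k s0 = u ->
  (forall s, blevel s = N -> f s = g -> k s = u -> s = s0) ->
  \rank (gradmx f g *m gradmx k u) = 1%N.
Proof.
move=> ls0 fs0 ks0 h; have [i0 i0E] := bof_surj ls0.
rewrite (_ : _ *m _ = delta_mx i0 i0) ?mxrank_delta //.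
apply/matrixP => i j; rewrite mul_diag_mx !mxE.
have [<-|ij] := eqVneq i j; last first.
  rewrite mulr0n mulr0; case: eqP => [ii|] //=; case: eqP => // jj.
  by move: ij; rewrite ii jj eqxx.
rewrite andbb mulr1n -natrM mulnb; congr ((nat_of_bool _)%:R); apply/idP/idP => [/andP[/eqP fi /eqP ki]|].
  apply/eqP/enum_val_inj/(@bstate_inj N).
  by rewrite -/(bof i) -/(bof i0) i0E; apply: h => //; apply: bstate_level.
by move/eqP ->; rewrite i0E fs0 ks0 !eqxx.
Qed.

Variables (e : bool) (P : int -> F).
Local Notation rw := (reduced_weight e P).

Lemma reduced_eq0 (s : BState N) : charge rw s = 0 ->
  (forall x, s.1 x != 0%N -> rw (bmode x) = 0) /\
  (forall y, y \in s.2 -> rw (fmode y) = 0).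
Proof.
have b0 x : 0 <= (s.1 x)%:Z * rw (bmode x).
  by apply: mulr_ge0 => //; apply: (reduced_mode_ge0 e P (inl x.1)).
have f0 (y : fsp * 'I_N) : 0 <= rw (fmode y) by apply: (reduced_mode_ge0 e P (inr y.1) y.2).
move/eqP; rewrite /charge paddr_eq0 ?sumr_ge0 // => /andP[/eqP sb /eqP sf]; split=> [x sx|y ys].
  have /(_ x isT)/eqP := psumr_eq0P (fun x _ => b0 x) sb.
  by rewrite mulf_eq0 eqz_nat (negbTE sx) => /eqP.
by have /(_ y ys) := psumr_eq0P (fun y _ => f0 y) sf.
Qed.

Lemma reduced_full (s : BState N) : (forall n, n != 0 -> P n != 0) ->
  charge rw s = (blevel s)%:Z.
Proof.
move=> hP; rewrite -charge_level /charge.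
congr (_ + _); apply: eq_bigr => x _; [congr (_ * _)|]; case: x => t k.
  by case: t; rewrite /= ?opprK //; case: e; rewrite hP ?opprK.
by case: t; rewrite /= ?opprK // hP ?opprK.
Qed.

Variables (x : bsp) (y : fsp) (k0 : 'I_N) (m : nat).
Hypothesis m0 : (0 < m)%N.
Hypothesis lev : (m * k0.+1)%N = N.
Hypothesis rx : forall z, (rw (bmode z) == 0) = (z == (x, k0)).
Hypothesis ry : forall z, (rw (fmode z) == 0) = (z == (y, k0)).

Definition single (j : nat) (S : {set fsp * 'I_N}) : BState N :=
  ([ffun z => if z == (x, k0) then j else 0%N], S).

Lemma charge_single W j S : charge W (single j S) =
  j%:Z * W (bmode (x, k0)) + \sum_(z in S) W (fmode z).
Proof.
rewrite /charge /=; congr (_ + _); rewrite (bigD1 (x, k0)) //= ffunE eqxx.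
by rewrite big1 ?addr0 // => z zx; rewrite ffunE (negbTE zx) mul0r.
Qed.

Definition single0 := single m set0.
Definition single1 := single m.-1 [set (y, k0)].

(** Only the boson [(x, k0)] and the fermion [(y, k0)] can be occupied, the latter at most once. The
    level m (k0+1) then fixes the number of bosons: m, or m - 1 beside the fermion. *)
Lemma kernel_states (s : BState N) : blevel s = N -> charge rw s = 0 ->
  s = single0 \/ s = single1.
Proof.
move=> sN /reduced_eq0[hb hf].
have es : s = single (s.1 (x, k0)) s.2.
  case: s sN hb hf => o S _ /= hb hf; congr (_, _); apply/ffunP => z; rewrite ffunE.
  case: eqP => [-> //|/eqP zx]; apply/eqP; apply: contraNT zx => /hb/eqP.
  by rewrite rx.
have cl W : charge W s = (s.1 (x, k0))%:Z * W (bmode (x, k0)) + \sum_(z in s.2) W (fmode z).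
  by rewrite {1}es charge_single.
have := cl level_weight; rewrite charge_level sN /level_weight /= opprK => cN.
have [yS|yS] := boolP ((y, k0) \in s.2).
  have e2 : s.2 = [set (y, k0)].
    apply/setP => z; rewrite inE; apply/idP/eqP => [/hf/eqP|-> //].
    by rewrite ry => /eqP.
  right; rewrite es e2 /single1; congr single; move: cN.
  by rewrite e2 big_set1 /= opprK -{1}lev; nia.
have e2 : s.2 = set0.
  apply/setP => z; rewrite inE; apply/negbTE; apply: contraNN yS => /[dup] zs /hf/eqP.
  by rewrite ry => /eqP <-.
left; rewrite es e2 /single0; congr single; move: cN.
by rewrite e2 big_set0 addr0 -{1}lev; nia.
Qed.

Lemma single0P : [/\ blevel single0 = N, charge rw single0 = 0 & ghost single0 = 0].
Proof.
split.
- have := charge_single level_weight m set0; rewrite charge_level big_set0 addr0.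
  rewrite /level_weight /= => h.
  suff : (blevel single0)%:Z = (m * k0.+1)%N%:Z by rewrite lev => -[].
  by rewrite h ?opprK PoszM.
- rewrite charge_single big_set0 addr0; have /eqP -> : rw (bmode (x, k0)) == 0 by rewrite rx.
  by rewrite mulr0.
- by rewrite -charge_ghost charge_single big_set0 addr0 mulr0.
Qed.

Lemma single1P : [/\ blevel single1 = N, charge rw single1 = 0 &
  ghost single1 = ghost_weight (OF y 0)].
Proof.
split.
- have := charge_single level_weight m.-1 [set (y, k0)]; rewrite charge_level big_set1.
  rewrite /level_weight /= ?opprK => h.
  suff : (blevel single1)%:Z = (m * k0.+1)%N%:Z by rewrite lev => -[].
  by rewrite h -{2}(prednK m0) mulSn PoszD PoszM addrC.
- rewrite charge_single big_set1.
  have /eqP -> : rw (bmode (x, k0)) == 0 by rewrite rx.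
  have /eqP -> : rw (fmode (y, k0)) == 0 by rewrite ry.
  by rewrite mulr0 addr0.
- by rewrite -charge_ghost charge_single big_set1 mulr0 add0r.
Qed.

Lemma rank_single (g : int) : ghost_weight (OF y 0) != 0 ->
  \rank (gradmx (charge rw) 0 *m gradmx (@ghost N) g) =
  ((g == 0) || (g == ghost_weight (OF y 0))).
Proof.
move=> y0; have [l0 c0 g0] := single0P; have [l1 c1 g1] := single1P.
have [->|gn0] := eqVneq g 0.
  rewrite (@rank_gradmx1 _ _ _ _ _ _ single0) // => s sN /(kernel_states sN)[] -> //.
  by rewrite g1 => e0; move: y0; rewrite e0.
have [->|gny] := eqVneq g (ghost_weight (OF y 0)).
  rewrite (@rank_gradmx1 _ _ _ _ _ _ single1) // => s sN /(kernel_states sN)[] -> //.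
  by rewrite g0 => e0; move: y0; rewrite -e0.
rewrite rank_gradmx0 // => s sN /(kernel_states sN)[] -> gs.
  by move: gn0; rewrite -gs g0 eqxx.
by move: gny; rewrite -gs g1 eqxx.
Qed.

(** Both states have m quanta in all and each quantum has degree c; this is the single-degree
    condition of the perturbation argument. *)
Lemma degree_single (s : BState N) c : degree_weight e (OB x 0) = c ->
  degree_weight e (OF y 0) = c -> blevel s = N -> charge rw s = 0 ->
  charge (degree_weight e) s = m%:Z * c.
Proof.
move=> cx cy sN /(kernel_states sN)[] ->; rewrite charge_single ?big_set0 ?big_set1.
  by rewrite addr0 -cx; case: (x).
rewrite (_ : degree_weight e (bmode _) = c); last by rewrite -cx; case: (x).
rewrite (_ : degree_weight e (fmode _) = c); last by rewrite -cy; case: (y).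
by rewrite -{2}(prednK m0) -add1n PoszD mulrDl mul1r addrC.
Qed.

End Counting.

(** * Identification of [dmx] with the matrix of d *)

(** The words are regrouped by their leftmost c_{-n}. Those omitted from the list end in a mode of
    index n + m that is 0 or beyond N, and such a mode acts as zero. *)
Lemma word_sum_dop (F : numFieldType) N (Pp Pm : int -> F) (v : Vec F N) :
  \sum_(t <- flatten [seq [:: (Pp n, [:: OF FC (- n); OB BAm n]);
                              (1, [:: OF FE n; OB BBe (- n)])] | n : int <- nzidx N]
     ++ flatten [seq flatten [seq
          if ((n + m)%R != 0%R :> int) && (absz (n + m)%R <= N)%N then
            [:: (1, [:: OF FC (- n); OB BAp (- m); OB BAm (n + m)]);
                ((m - n)%:~R / 2, [:: OF FC (- n); OF FC (- m); OF FB (n + m)]);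
                (m%:~R, [:: OF FC (- n); OF FZ (- m); OF FE (n + m)]);
                (m%:~R, [:: OF FC (- n); OB BBe (- m); OB BGa (n + m)])]
          else [::] | m : int <- nzidx N] | n : int <- nzidx N]
     ++ [seq (Pm n, [:: OF FC (- n); OB BAp n]) | n : int <- nzidx N])
    t.1 *: foldr (fun o => opm o) v t.2 = dop Pp Pm v.
Proof.
rewrite !big_cat /=.
have -> : \sum_(t <- flatten [seq [:: (Pp n, [:: OF FC (- n); OB BAm n]);
                              (1, [:: OF FE n; OB BBe (- n)])] | n : int <- nzidx N]) t.1 *: foldr (fun o => opm o) v t.2 =
    \sum_(n <- nzidx N) Pp n *: X sC (- n) (X sAm n v) + Qop v.
  rewrite big_flatten big_map /Qop -lock -big_split; apply: eq_bigr => n _.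
  by rewrite !big_cons big_nil /= addr0 scale1r.
have -> : \sum_(t <- [seq (Pm n, [:: OF FC (- n); OB BAp n]) | n : int <- nzidx N]) t.1 *: foldr (fun o => opm o) v t.2 =
    \sum_(n <- nzidx N) Pm n *: X sC (- n) (X sAp n v).
  by rewrite big_map.
have -> : \sum_(t <- flatten [seq flatten [seq
          if ((n + m)%R != 0%R :> int) && (absz (n + m)%R <= N)%N then
            [:: (1, [:: OF FC (- n); OB BAp (- m); OB BAm (n + m)]);
                ((m - n)%:~R / 2, [:: OF FC (- n); OF FC (- m); OF FB (n + m)]);
                (m%:~R, [:: OF FC (- n); OF FZ (- m); OF FE (n + m)]);
                (m%:~R, [:: OF FC (- n); OB BBe (- m); OB BGa (n + m)])]
          else [::] | m : int <- nzidx N] | n : int <- nzidx N]) t.1 *: foldr (fun o => opm o) v t.2 =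
    \sum_(n <- nzidx N) X sC (- n)
      (J (fun=> 1) sAp sAm n v + J (fun m => m%:~R) sZ sE n v
       + J (fun m => m%:~R) sBe sGa n v) + gh v.
  rewrite big_flatten big_map /gh -lock -big_split; apply: eq_bigr => n _ /=.
  rewrite big_flatten big_map /J -!lock !Xlin !Xsum -!big_split; apply: eq_bigr => m _ /=.
  case: ifP => [_|nm]; first by rewrite !big_cons big_nil /= !Xlin; vring.
  have out t : X t (n + m) v = 0 by rewrite X_out // mem_nzidx nm.
  by rewrite big_nil !Xlin !out !Xlin !scaler0 !addr0.
rewrite /dop -lock /cL -lock; set s1 := \sum_(_ <- _) _; set s2 := \sum_(_ <- _) _.
set s3 := \sum_(_ <- _) _.
have -> : \sum_(n <- nzidx N) X sC (- n) (Lm Pp Pm n v) = s1 + s3 + s2.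
  rewrite /s1 /s2 /s3 -!big_split; apply: eq_bigr => n _ /=.
  by rewrite /Lm -lock !Xlin; vring.
by vring.
Qed.

Lemma dmx_dop (R : realType) (p pphi : R[i]) N :
  dmx p pphi N = opmx (dop (Pplus p pphi) (Pminus p pphi) : Vec R[i] N -> Vec R[i] N).
Proof. by rewrite dmxE; apply: opmxP => v _; apply: word_sum_dop. Qed.

(** * The cohomology in each range of momenta *)

Section Cases.
Variables (R : realType) (p pphi : R[i]) (N : nat).
Hypothesis L0 : pplus p pphi * pminus p pphi + N%:R = 0.
Local Notation pp := (pplus p pphi).
Local Notation pm := (pminus p pphi).

Lemma cohdim_reduced (e : bool) q0 :
  let P := if e then Pplus p pphi else Pminus p pphi in
  (forall s : BState N, blevel s = N -> charge (reduced_weight e P) s = 0 ->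
     charge (degree_weight e) s = q0) ->
  forall g, cohdim p pphi N g =
    \rank (gradmx R[i] (charge (reduced_weight e P)) 0 *m gradmx R[i] (@ghost N) g).
Proof.
move=> P hq0 g; rewrite /cohdim dmx_dop.
exact: (@rank_reduced R[i] N pp pm e q0 L0 hq0 g).
Qed.

(** Without resonances the reduced level is the full level N > 0, so no monomial survives. Which of
    the two mirror images is used depends on which P has no zero. *)
Lemma cohdim_acyclic g : (0 < N)%N ->
  (forall n : int, n != 0 -> Pplus p pphi n != 0) \/
  (forall n : int, n != 0 -> Pminus p pphi n != 0) -> cohdim p pphi N g = 0%N.
Proof.
move=> N0 hP.
have [e he] : exists e : bool, forall n : int, n != 0 ->
    (if e then Pplus p pphi else Pminus p pphi) n != 0.
  by case: hP => h; [exists true | exists false].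
have none (s : BState N) : blevel s = N ->
    charge (reduced_weight e (if e then Pplus p pphi else Pminus p pphi)) s <> 0.
  by move=> sN; rewrite reduced_full // sN; lia.
rewrite (@cohdim_reduced e 0) => [|s /none //].
by apply: rank_gradmx0 => s /none.
Qed.

Lemma cohdim_vacuum g : N = 0%N -> cohdim p pphi N g = (g == 0).
Proof.
move=> N0; have sv (s : BState N) : blevel s = N -> s = vac N.
  by move=> sN; apply: blevel_eq0; rewrite sN N0.
rewrite (@cohdim_reduced true 0) => [|s /sv -> _]; last exact: charge_vac.
have gv : ghost (vac N) = 0 by rewrite -charge_ghost charge_vac.
have lv : blevel (vac N) = N by apply/eqP; rewrite -eqz_nat -charge_level charge_vac N0.
have [->|g0] := eqVneq g 0.
  rewrite (@rank_gradmx1 _ _ _ _ _ _ _ _ (vac N)) // ?charge_vac //.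
  by move=> s /sv.
rewrite rank_gradmx0 // => s /sv -> _; rewrite gv => e; by move: g0; rewrite -e eqxx.
Qed.

Lemma cohdim_discrete (x : bsp) (y : fsp) (k0 : 'I_N) (m : nat) c g :
  (0 < m)%N -> (m * k0.+1)%N = N ->
  (forall z : bsp * 'I_N,
     (reduced_weight true (Pplus p pphi) (bmode z) == 0) = (z == (x, k0))) ->
  (forall z : fsp * 'I_N,
     (reduced_weight true (Pplus p pphi) (fmode z) == 0) = (z == (y, k0))) ->
  degree_weight true (OB x 0) = c -> degree_weight true (OF y 0) = c ->
  ghost_weight (OF y 0) != 0 ->
  cohdim p pphi N g = ((g == 0) || (g == ghost_weight (OF y 0))).
Proof.
move=> m0 lev rx ry cx cy gy.
rewrite (@cohdim_reduced true (m%:Z * c)).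
  exact: (rank_single m0 lev rx ry).
by move=> s sN s0; apply: (degree_single m0 lev rx ry).
Qed.

End Cases.

Section Resonance.
Variables (R : realType) (p pphi : R[i]) (N : nat) (r s : int).
Hypothesis L0 : pplus p pphi * pminus p pphi + N%:R = 0.
Hypothesis ppr : pplus p pphi = r%:~R.
Hypothesis pms : pminus p pphi = - s%:~R.
Local Notation P := (Pplus p pphi).

Let rs : r * s = N%:Z.
Proof.
apply/eqP; rewrite -(eqr_int R[i]); apply/eqP.
by move/eqP: L0; rewrite ppr pms addrC mulrN subr_eq0 rmorphM => /eqP <-.
Qed.

Let P_eq0 n : (P n == 0) = (n == r).
Proof. by rewrite /Pplus ppr subr_eq0 eqr_int eq_sym. Qed.

Let weight_eq0 (b : bool) (k : 'I_N) : ((if ~~ b then (k.+1)%:Z else 0) == 0) = b.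
Proof. by case: b. Qed.

Let is_Ap (t : bsp) : (t == BAp) = if t is BAp then true else false.
Proof. by case: t; apply/eqP. Qed.
Let is_Am (t : bsp) : (t == BAm) = if t is BAm then true else false.
Proof. by case: t; apply/eqP. Qed.
Let is_FC (f : fsp) : (f == FC) = if f is FC then true else false.
Proof. by case: f; apply/eqP. Qed.
Let is_FB (f : fsp) : (f == FB) = if f is FB then true else false.
Proof. by case: f; apply/eqP. Qed.

Lemma cohdim_pos g : 0 < r -> 0 < s ->
  cohdim p pphi N g = ((g == 0) || (g == 1)).
Proof.
(* Since r s = N with s > 0, the resonant index r is at most N; its label is r - 1. *)
move=> r0 s0; have kN : (`|r|.-1 < N)%N by nia.
have kE k : (k.+1%:Z == r) = (k == `|r|.-1) by lia.
have kE' k : (- k.+1%:Z == r) = false by lia.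
have lev : (`|s| * (Ordinal kN).+1)%N = N by rewrite /=; nia.
have s0' : (0 < `|s|)%N by lia.
apply: (@cohdim_discrete R p pphi N L0 BAp FC (Ordinal kN) `|s|%N 1 g s0' lev) => //.
- move=> [t k]; rewrite xpair_eqE is_Ap -val_eqE.
  by case: t; rewrite /= ?opprK ?P_eq0 ?kE ?kE' ?weight_eq0.
- move=> [t k]; rewrite xpair_eqE is_FC -val_eqE.
  by case: t; rewrite /= ?opprK ?P_eq0 ?kE ?kE' ?weight_eq0.
Qed.

Lemma cohdim_neg g : r < 0 -> s < 0 ->
  cohdim p pphi N g = ((g == -1) || (g == 0)).
Proof.
move=> r0 s0; have kN : (`|r|.-1 < N)%N by nia.
have kE k : (k.+1%:Z == r) = false by lia.
have kE' k : (- k.+1%:Z == r) = (k == `|r|.-1) by lia.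
have lev : (`|s| * (Ordinal kN).+1)%N = N by rewrite /=; nia.
rewrite orbC.
have s0' : (0 < `|s|)%N by lia.
apply: (@cohdim_discrete R p pphi N L0 BAm FB (Ordinal kN) `|s|%N (-1) g s0' lev) => //.
- move=> [t k]; rewrite xpair_eqE is_Am -val_eqE.
  by case: t; rewrite /= ?opprK ?P_eq0 ?kE ?kE' ?weight_eq0.
- move=> [t k]; rewrite xpair_eqE is_FB -val_eqE.
  by case: t; rewrite /= ?opprK ?P_eq0 ?kE ?kE' ?weight_eq0.
Qed.

End Resonance.

Theorem theorem5 (R : realType) (p pphi : R[i]) (N : nat) :
  L0val p pphi N = 0 ->
  forall g : int,
    (case_tachyon p pphi -> cohdim p pphi N g = (g == 0)) /\
    (case_neg p pphi -> cohdim p pphi N g = ((g == -1) || (g == 0))) /\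
    (case_pos p pphi -> cohdim p pphi N g = ((g == 0) || (g == 1))) /\
    (~ case_tachyon p pphi -> ~ case_neg p pphi -> ~ case_pos p pphi ->
       cohdim p pphi N g = 0%N).
Proof.
rewrite /L0val => L0 g; split; last split; last split.
- move=> [pp0 _]; apply: cohdim_vacuum => //.
  by move/eqP: L0; rewrite pp0 add0r pnatr_eq0 => /eqP.
- by move=> [r [s [r0 [s0 [ppr pms]]]]]; apply: (cohdim_neg L0 ppr pms).
- by move=> [r [s [r0 [s0 [ppr pms]]]]]; apply: (cohdim_pos L0 ppr pms).
move=> nt nn np.
have [N0|N0] := posnP N.
  (* At level 0 one of p^+, p^- is zero; then P^+(n) = -n or P^-(n) = n has no zero at nonzero n,
     which is the tachyon case. *)
  case: nt; have pp0 : pplus p pphi * pminus p pphi = 0 by rewrite -L0 N0 addr0.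
  split=> //; move/eqP: pp0; rewrite mulf_eq0 => /orP[/eqP z|/eqP z]; [left|right] => n n0.
    by rewrite /Pplus z sub0r oppr_eq0 intr_eq0.
  by rewrite /Pminus z add0r intr_eq0.
apply: (cohdim_acyclic L0 g N0).
have [|hP] := pselect (forall n : int, n != 0 -> Pplus p pphi n != 0); first by left.
(* A zero r of P^+ and a zero n of P^- would give p^+ = r and p^- = -n, and L_0 = 0 becomes r n = N
   > 0. So r and n have the same sign, which is one of the excluded discrete cases. *)
right=> n n0; apply/negP => Pmn.
have [r /andP[r0 Pr]] : exists r : int, (r != 0) && (Pplus p pphi r == 0).
  apply: contrapT => h; apply: hP => r r0; apply/negP => Pr; apply: h.
  by exists r; rewrite r0.
have ppr : pplus p pphi = r%:~R by apply/eqP; rewrite -subr_eq0.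
have pmn : pminus p pphi = - n%:~R by apply/eqP; rewrite -addr_eq0.
have rn : r * n = N%:Z.
  apply/eqP; rewrite -(eqr_int R[i]); apply/eqP.
  by move/eqP: L0; rewrite ppr pmn addrC mulrN subr_eq0 rmorphM => /eqP <-.
have [rpos|rneg] := ltP 0 r.
  by apply: np; exists r, n; split=> //; split; [nia | ].
by apply: nn; exists r, n; split; [lia | split; [nia | ]].
Qed.
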